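(* Let $n$ be a positive integer, $\mathfrak{g}=\mathfrak{gl}_n(\mathbb{C})$ and $U=U(\mathfrak{g})$. Let $\mathscr{G}\mathscr{Z}$ be the category of Gelfand--Zeitlin modules over $\mathfrak{g}$. Then $$\mathrm{gl.dim}(\mathscr{G}\mathscr{Z})=\mathrm{gl.dim}(U\text{-}\mathrm{Mod})=\dim\mathfrak{g}.$$
   Context: Gelfand--Zeitlin modules. For $k\ge 1$ let $\mathfrak{g}_k=\mathfrak{gl}_k(\mathbb{C})$, let $U_k=U(\mathfrak{g}_k)$ be its universal enveloping algebra and $Z_k$ the center of $U_k$. Consider the chain $\mathfrak{g}_1\subset\mathfrak{g}_2\subset\dots\subset\mathfrak{g}_n$ of left upper corner embeddings and the induced chain $U_1\subset U_2\subset\dots\subset U_n=U$. The Gelfand--Zeitlin subalgebra $\Gamma$ is the (commutative) subalgebra of $U$ generated by $Z_1,Z_2,\dots,Z_n$. The category $\mathscr{G}\mathscr{Z}$ is the full subcategory of the category of finitely generated $U$-modules consisting of those $M$ on which $\Gamma$ acts locally finitely, i.e. $\dim(\Gamma v)<\infty$ for all $v\in M$. $U\text{-}\mathrm{Mod}$ is the category of all $U$-modules. Global dimension. For an Abelian category $\mathcal{A}$, $\mathrm{Ext}^d_{\mathcal{A}}(M,N)$ denotes the Yoneda extension group ($\mathrm{Ext}^0_{\mathcal{A}}=\mathrm{Hom}_{\mathcal{A}}$; for $d\geq 1$, equivalence classes of exact sequences $0\to N\to X_1\to\dots\to X_d\to M\to 0$ in $\mathcal{A}$ modulo the equivalence relation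 generated by morphisms of such sequences which are identities on $N$ and $M$). The projective dimension of $M\in\mathcal{A}$ is the maximal $d$ such that there is $N\in\mathcal{A}$ with $\mathrm{Ext}^d_{\mathcal{A}}(M,N)\neq0$, and $\infty$ if no such maximal $d$ exists. The global dimension $\mathrm{gl.dim}(\mathcal{A})$ is the supremum of the projective dimensions of all objects of $\mathcal{A}$. *)

(* Defs.v *)
From HB Require Import structures.
From Stdlib Require Import Relation_Operators.
From mathcomp Require Import all_boot all_order all_algebra.
From mathcomp Require Import generic_quotient.
From mathcomp Require Import boolp classical_sets constructive_ereal reals ereal.
From mathcomp Require Import complex.

Set Implicit Arguments.
Unset Strict Implicit.
Unset Printing Implicit Defensive.

Import GRing.Theory.
Local Open Scope quotient_scope.
Local Open Scope ring_scope.

(* The universal enveloping algebra of a K-module L with bracket br: the unital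
   associative K-algebra generated by the elements of L, subject to linearity
   of the generators and to  x * y - y * x = br x y.  Elements are classes of
   algebra expressions modulo the congruence env_eq. *)

Inductive env_term (K L : Type) : Type :=
| EGen of L
| EConst of K
| EAdd of env_term K L & env_term K L
| EMul of env_term K L & env_term K L.
Arguments EGen {K L}.
Arguments EConst {K L}.

HB.instance Definition _ (K L : Type) := gen_eqMixin (env_term K L).
HB.instance Definition _ (K L : Type) := gen_choiceMixin (env_term K L).

Inductive env_eq (K : fieldType) (L : lmodType K) (br : L -> L -> L) :
  env_term K L -> env_term K L -> Prop :=
| env_refl t : env_eq br t t
| env_sym s t : env_eq br s t -> env_eq br t s
| env_trans s t u : env_eq br s t -> env_eq br t u -> env_eq br s u
| env_congD s s' t t' : env_eq br s s' -> env_eq br t t' ->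
    env_eq br (EAdd s t) (EAdd s' t')
| env_congM s s' t t' : env_eq br s s' -> env_eq br t t' ->
    env_eq br (EMul s t) (EMul s' t')
| env_addA s t u : env_eq br (EAdd s (EAdd t u)) (EAdd (EAdd s t) u)
| env_addC s t : env_eq br (EAdd s t) (EAdd t s)
| env_add0 t : env_eq br (EAdd (EConst 0) t) t
| env_addN t : env_eq br (EAdd (EMul (EConst (-1)) t) t) (EConst 0)
| env_mulA s t u : env_eq br (EMul s (EMul t u)) (EMul (EMul s t) u)
| env_mul1 t : env_eq br (EMul (EConst 1) t) t
| env_mulDl s t u :
    env_eq br (EMul (EAdd s t) u) (EAdd (EMul s u) (EMul t u))
| env_mulDr s t u :
    env_eq br (EMul s (EAdd t u)) (EAdd (EMul s t) (EMul s u))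
| env_constD a b : env_eq br (EConst (a + b)) (EAdd (EConst a) (EConst b))
| env_constM a b : env_eq br (EConst (a * b)) (EMul (EConst a) (EConst b))
| env_constC a t : env_eq br (EMul (EConst a) t) (EMul t (EConst a))
| env_genD x y : env_eq br (EGen (x + y)) (EAdd (EGen x) (EGen y))
| env_genZ a x : env_eq br (EGen (a *: x)) (EMul (EConst a) (EGen x))
| env_genB x y :
    env_eq br (EMul (EGen x) (EGen y))
              (EAdd (EMul (EGen y) (EGen x)) (EGen (br x y))).

Fixpoint env_eval (K : fieldType) (L : Type) (A : algType K) (f : L -> A)
    (t : env_term K L) : A :=
  match t with
  | EGen x => f x
  | EConst a => a%:A
  | EAdd s u => env_eval f s + env_eval f u
  | EMul s u => env_eval f s * env_eval f u
  end.

Definition lie_hom (K : fieldType) (L : lmodType K) (br : L -> L -> L)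
    (A : algType K) (f : L -> A) : Prop :=
  linear f /\ forall x y, f (br x y) = f x * f y - f y * f x.

Section EnvelopingAlgebra.
Variables (K : fieldType) (L : lmodType K) (br : L -> L -> L).

Lemma env_eval_eq (A : algType K) (f : L -> A) s t :
  lie_hom br f -> env_eq br s t -> env_eval f s = env_eval f t.
Proof.
move=> [f_lin f_br]; elim=> {s t} //=.
- by move=> s t u _ -> _ ->.
- by move=> s s' t t' _ -> _ ->.
- by move=> s s' t t' _ -> _ ->.
- by move=> s t u; rewrite addrA.
- by move=> s t; rewrite addrC.
- by move=> t; rewrite scale0r add0r.
- by move=> t; rewrite mulr_algl scaleN1r addNr scale0r.
- by move=> s t u; rewrite mulrA.
- by move=> t; rewrite scale1r mul1r.
- by move=> s t u; rewrite mulrDl.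
- by move=> s t u; rewrite mulrDr.
- by move=> a b; rewrite scalerDl.
- by move=> a b; rewrite mulr_algl scalerA.
- by move=> a t; rewrite mulr_algl mulr_algr.
- by move=> x y; rewrite -[x in f (x + y)]scale1r f_lin scale1r.
- move=> a x; rewrite mulr_algl -[a *: x]addr0 f_lin.
  suff -> : f 0 = 0 by rewrite addr0.
  by have := f_lin (-1) 0 0; rewrite scaler0 addr0 scaleN1r addNr.
- by move=> x y; rewrite f_br addrC subrK.
Qed.

Definition env_eqb (s t : env_term K L) : bool := `[< env_eq br s t >].

Lemma env_eqb_refl : reflexive env_eqb.
Proof. by move=> t; apply/asboolP; apply: env_refl. Qed.

Lemma env_eqb_sym : symmetric env_eqb.
Proof. by move=> s t; apply/asboolP/asboolP; apply: env_sym. Qed.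

Lemma env_eqb_trans : transitive env_eqb.
Proof.
by move=> t s u /asboolP st /asboolP tu; apply/asboolP; apply: env_trans tu.
Qed.

Canonical env_equiv := EquivRel env_eqb env_eqb_refl env_eqb_sym env_eqb_trans.

Definition envAlg := {eq_quot env_equiv}.

HB.instance Definition _ := Choice.on envAlg.
HB.instance Definition _ := EqQuotient.on envAlg.

Definition env_class (t : env_term K L) : envAlg := \pi_envAlg t.

Lemma env_classP s t : env_eq br s t <-> env_class s = env_class t.
Proof.
split=> [st|/eqmodP/asboolP //].
by apply/eqmodP; apply/asboolP.
Qed.

Lemma env_reprK t : env_eq br (repr (env_class t)) t.
Proof. by apply/env_classP; rewrite /env_class reprK. Qed.

Lemma env_ind (Q : envAlg -> Prop) : (forall t, Q (env_class t)) -> forall u, Q u.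
Proof. by move=> Qt u; rewrite -[u]reprK; apply: Qt. Qed.

Definition env_add (u v : envAlg) := env_class (EAdd (repr u) (repr v)).
Definition env_mul (u v : envAlg) := env_class (EMul (repr u) (repr v)).
Definition env_scale (a : K) (u : envAlg) := env_class (EMul (EConst a) (repr u)).
Definition env_opp (u : envAlg) := env_scale (-1) u.

Lemma env_addE s t : env_add (env_class s) (env_class t) = env_class (EAdd s t).
Proof. by apply/env_classP; apply: env_congD; apply: env_reprK. Qed.

Lemma env_mulE s t : env_mul (env_class s) (env_class t) = env_class (EMul s t).
Proof. by apply/env_classP; apply: env_congM; apply: env_reprK. Qed.

Lemma env_scaleE a t :
  env_scale a (env_class t) = env_class (EMul (EConst a) t).
Proof.
by apply/env_classP; apply: env_congM; [apply: env_refl | apply: env_reprK].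
Qed.

Fact env_addrA : associative env_add.
Proof.
by elim/env_ind=> s; elim/env_ind=> t; elim/env_ind=> u; rewrite !env_addE;
  apply/env_classP; apply: env_addA.
Qed.

Fact env_addrC : commutative env_add.
Proof.
by elim/env_ind=> s; elim/env_ind=> t; rewrite !env_addE;
  apply/env_classP; apply: env_addC.
Qed.

Fact env_add0r : left_id (env_class (EConst 0)) env_add.
Proof. by elim/env_ind=> t; rewrite env_addE; apply/env_classP; apply: env_add0. Qed.

Fact env_addNr : left_inverse (env_class (EConst 0)) env_opp env_add.
Proof.
by elim/env_ind=> t; rewrite /env_opp env_scaleE env_addE;
  apply/env_classP; apply: env_addN.
Qed.

HB.instance Definition _ :=
  GRing.isZmodule.Build envAlg env_addrA env_addrC env_add0r env_addNr.

Fact env_mulrA : associative env_mul.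
Proof.
by elim/env_ind=> s; elim/env_ind=> t; elim/env_ind=> u; rewrite !env_mulE;
  apply/env_classP; apply: env_mulA.
Qed.

Fact env_mul1r : left_id (env_class (EConst 1)) env_mul.
Proof. by elim/env_ind=> t; rewrite env_mulE; apply/env_classP; apply: env_mul1. Qed.

Fact env_mulr1 : right_id (env_class (EConst 1)) env_mul.
Proof.
elim/env_ind=> t; rewrite env_mulE; apply/env_classP.
apply: env_trans (env_mul1 _ _); apply: env_sym; exact: env_constC.
Qed.

Fact env_mulrDl : left_distributive env_mul env_add.
Proof.
by elim/env_ind=> s; elim/env_ind=> t; elim/env_ind=> u;
  rewrite !(env_mulE, env_addE); apply/env_classP; apply: env_mulDl.
Qed.

Fact env_mulrDr : right_distributive env_mul env_add.
Proof.
by elim/env_ind=> s; elim/env_ind=> t; elim/env_ind=> u;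
  rewrite !(env_mulE, env_addE); apply/env_classP; apply: env_mulDr.
Qed.

Fact env_oner_neq0 : env_class (EConst 1) != 0.
Proof.
apply/eqP => /env_classP /(@env_eval_eq K^o (fun=> 0)) /= aug.
suff /aug /eqP : lie_hom br (fun _ : L => 0 : K^o).
  by rewrite scale1r scale0r oner_eq0.
by split=> [a x y|x y]; rewrite ?scaler0 ?addr0 ?mulr0 ?subrr.
Qed.

HB.instance Definition _ := GRing.Zmodule_isNzRing.Build envAlg
  env_mulrA env_mul1r env_mulr1 env_mulrDl env_mulrDr env_oner_neq0.

Fact env_scalerA a b u : env_scale a (env_scale b u) = env_scale (a * b) u.
Proof.
elim/env_ind: u => t; rewrite !env_scaleE; apply/env_classP.
apply: env_trans (env_mulA _ _ _ _) _.
by apply: env_congM; [apply/env_sym/env_constM | apply: env_refl].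
Qed.

Fact env_scale1r : left_id 1 env_scale.
Proof. by elim/env_ind=> t; rewrite env_scaleE; apply/env_classP; apply: env_mul1. Qed.

Fact env_scalerDr : right_distributive env_scale +%R.
Proof.
move=> a; elim/env_ind=> s; elim/env_ind=> t.
rewrite /GRing.add /= !(env_scaleE, env_addE).
by apply/env_classP; apply: env_mulDr.
Qed.

Fact env_scalerDl u : {morph env_scale^~ u : a b / a + b}.
Proof.
elim/env_ind: u => t a b; rewrite {2}/GRing.add /= !(env_scaleE, env_addE).
apply/env_classP; apply: env_trans (env_mulDl _ _ _ _).
by apply: env_congM; [apply: env_constD | apply: env_refl].
Qed.

HB.instance Definition _ := GRing.Zmodule_isLmodule.Build K envAlg
  env_scalerA env_scale1r env_scalerDr env_scalerDl.

Fact env_scalerAl (a : K) (u v : envAlg) : a *: (u * v) = a *: u * v.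
Proof.
elim/env_ind: u => s; elim/env_ind: v => t.
rewrite /GRing.scale /GRing.mul /= !(env_scaleE, env_mulE).
by apply/env_classP; apply: env_mulA.
Qed.

HB.instance Definition _ := GRing.Lmodule_isLalgebra.Build K envAlg env_scalerAl.

Fact env_scalerAr (a : K) (u v : envAlg) : a *: (u * v) = u * (a *: v).
Proof.
elim/env_ind: u => s; elim/env_ind: v => t.
rewrite /GRing.scale /GRing.mul /= !(env_scaleE, env_mulE).
apply/env_classP; apply: env_trans (env_mulA _ _ _ _) _.
apply: env_trans (env_sym (env_mulA _ _ _ _)).
by apply: env_congM; [apply: env_constC | apply: env_refl].
Qed.

HB.instance Definition _ := GRing.Lalgebra_isAlgebra.Build K envAlg env_scalerAr.

Definition env_gen (x : L) : envAlg := env_class (EGen x).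

Definition env_lift (A : algType K) (f : L -> A) (u : envAlg) : A :=
  env_eval f (repr u).

Lemma env_lift_class (A : algType K) (f : L -> A) t :
  lie_hom br f -> env_lift f (env_class t) = env_eval f t.
Proof. by move=> f_hom; apply: env_eval_eq (env_reprK t). Qed.

Lemma env_classD s t : env_class (EAdd s t) = env_class s + env_class t.
Proof. by rewrite -env_addE. Qed.

Lemma env_classM s t : env_class (EMul s t) = env_class s * env_class t.
Proof. by rewrite -env_mulE. Qed.

Lemma env_classC a : env_class (EConst a) = a%:A.
Proof.
rewrite /GRing.scale /= env_scaleE; apply/env_classP.
by rewrite -{1}[a]mulr1; apply: env_constM.
Qed.

Lemma env_gen_lie_hom : lie_hom br env_gen.
Proof.
split=> [a x y|x y].
  rewrite -mulr_algl -env_classC -env_classM -env_classD.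
  apply/env_classP; apply: env_trans (env_genD _ _ _) _.
  by apply: env_congD; [apply: env_genZ | apply: env_refl].
apply/eqP; rewrite eq_sym subr_eq addrC -!env_classM -env_classD; apply/eqP.
by apply/env_classP; apply: env_genB.
Qed.

Theorem env_lift_universal (A : algType K) (f : L -> A) : lie_hom br f ->
  [/\ linear (env_lift f), env_lift f 1 = 1,
      {morph env_lift f : u v / u * v}, forall x, env_lift f (env_gen x) = f x
    & forall g : {lrmorphism envAlg -> A},
        (forall x, g (env_gen x) = f x) -> g =1 env_lift f].
Proof.
move=> fP; have E t := env_lift_class t fP; split.
- move=> a; elim/env_ind=> s; elim/env_ind=> t.
  rewrite -mulr_algl -env_classC -env_classM -env_classD !E /=.
  by rewrite mulr_algl.
- by rewrite -[1 in LHS]scale1r -env_classC E /= scale1r.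
- by elim/env_ind=> s; elim/env_ind=> t; rewrite -env_classM !E.
- by move=> x; rewrite E.
- move=> g gE; elim/env_ind=> t; rewrite E.
  elim: t => [x|a|s IHs t IHt|s IHs t IHt] /=; first exact: gE.
  + by rewrite env_classC linearZ rmorph1.
  + by rewrite env_classD raddfD /= IHs IHt.
  + by rewrite env_classM rmorphM /= IHs IHt.
Qed.

End EnvelopingAlgebra.

Section GelfandZeitlin.
Variable K : fieldType.

Definition mx_bracket (k : nat) (x y : 'M[K]_k) : 'M[K]_k := x *m y - y *m x.

Definition Ugl (k : nat) : algType K := envAlg (@mx_bracket k).

(* For k <= n, x sits in the left upper corner and the rest is filled with
   zeros. *)
Definition gl_corner (k n : nat) (x : 'M[K]_k) : 'M[K]_n :=
  (pid_mx k : 'M_(n, k)) *m x *m (pid_mx k : 'M_(k, n)).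

(* The map U(gl_k) -> U(gl_n) induced by gl_corner. *)
Definition Ugl_corner (k n : nat) : Ugl k -> Ugl n :=
  env_lift (fun x : 'M[K]_k => env_gen (@mx_bracket n) (gl_corner n x)).

Lemma gl_corner_lie_hom (k n : nat) : (k <= n)%N ->
  lie_hom (@mx_bracket k)
    (fun x : 'M[K]_k => env_gen (@mx_bracket n) (gl_corner n x)).
Proof.
move=> le_kn; have [gen_lin gen_br] := env_gen_lie_hom (@mx_bracket n).
have cornM (x y : 'M[K]_k) : gl_corner n (x *m y) = gl_corner n x *m gl_corner n y.
  rewrite /gl_corner !mulmxA.
  by rewrite -(mulmxA (pid_mx k *m x) (pid_mx k)) pid_mx_id // pid_mx_1 mulmx1.
split=> [a x y|x y].
  by rewrite -gen_lin /gl_corner mulmxDr mulmxDl -scalemxAr -scalemxAl.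
rewrite -gen_br /mx_bracket -!cornM; congr env_gen.
by rewrite /gl_corner mulmxBr mulmxBl.
Qed.

Definition in_center (A : pzRingType) (z : A) : Prop := forall a, z * a = a * z.

(* Gamma: the smallest subalgebra of U(gl_n) containing Z_1, ..., Z_n. *)
Definition in_GZ_subalgebra (n : nat) (g : Ugl n) : Prop :=
  forall S : {pred Ugl n},
    GRing.subalg_closed S ->
    (forall (k : nat) (z : Ugl k),
       (0 < k <= n)%N -> in_center z -> Ugl_corner n z \in S) ->
    g \in S.

Definition fin_gen (A : pzRingType) (M : lmodType A) : Prop :=
  exists (m : nat) (e : 'I_m -> M),
    forall v : M, exists a : 'I_m -> A, v = \sum_(i < m) a i *: e i.

(* For each v, the space Gamma v is spanned over K by finitely many of its
   elements; K acts on M through K -> U(gl_n). *)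
Definition GZ_locally_finite (n : nat) (M : lmodType (Ugl n)) : Prop :=
  forall v : M, exists (m : nat) (h : 'I_m -> Ugl n),
    (forall i, in_GZ_subalgebra (h i)) /\
    forall g : Ugl n, in_GZ_subalgebra g ->
      exists c : 'I_m -> K, g *: v = \sum_(i < m) (c i)%:A *: (h i *: v).

Definition GZ_module (n : nat) (M : lmodType (Ugl n)) : Prop :=
  fin_gen M /\ GZ_locally_finite M.

End GelfandZeitlin.

(* A full subcategory of A-Mod is given by the predicate P on its objects.  It
   is meant to be closed under submodules and quotients, so that it is abelian
   with kernels, cokernels, hence exact sequences, those of A-Mod; this holds
   for GZ_module because U(gl_n) is noetherian. *)

Section YonedaExt.
Variable A : pzRingType.
Implicit Types (P : lmodType A -> Prop) (M N : lmodType A).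

(* Sequences  N -> X_1 -> ... -> X_d -> M. *)
Fixpoint mod_seq (d : nat) (N M : lmodType A) : Type :=
  match d with
  | 0 => {linear N -> M}
  | d'.+1 => {X : lmodType A & ({linear N -> X} * mod_seq d' X M)%type}
  end.

Fixpoint seq_in P d N M : mod_seq d N M -> Prop :=
  match d with
  | 0 => fun _ => True
  | d'.+1 => fun s => P (projT1 s) /\ seq_in P (projT2 s).2
  end.

(* I is the image of the map preceding N; the sequence is exact at N and at all
   the X_i, and its last map is onto. *)
Fixpoint exact_from d N M (I : N -> Prop) : mod_seq d N M -> Prop :=
  match d with
  | 0 => fun f => (forall x, f x = 0 <-> I x) /\ (forall y, exists x, f x = y)
  | d'.+1 => fun s =>
      (forall x, (projT2 s).1 x = 0 <-> I x) /\
      exact_from (fun y => exists x, (projT2 s).1 x = y) (projT2 s).2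
  end.

(* phi : N -> N' extends to a morphism of sequences that is the identity on M. *)
Fixpoint seq_mor d N N' M (phi : {linear N -> N'}) :
    mod_seq d N M -> mod_seq d N' M -> Prop :=
  match d with
  | 0 => fun f f' => forall x, f x = f' (phi x)
  | d'.+1 => fun s s' =>
      exists psi : {linear projT1 s -> projT1 s'},
        (forall x, psi ((projT2 s).1 x) = (projT2 s').1 (phi x)) /\
        seq_mor psi (projT2 s).2 (projT2 s').2
  end.

(* Exact sequences  0 -> N -> X_1 -> ... -> X_d -> M -> 0  in P. *)
Record yoneda_ext P (d : nat) (M N : lmodType A) := YonedaExt {
  yext_seq :> mod_seq d N M;
  yext_in : seq_in P yext_seq;
  yext_exact : exact_from (fun x => x = 0) yext_seq
}.

Definition yext_mor P d M N (E E' : yoneda_ext P d M N) : Prop :=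
  seq_mor (idfun : {linear N -> N}) E E'.

Definition yext_equiv P d M N : yoneda_ext P d M N -> yoneda_ext P d M N -> Prop :=
  clos_refl_sym_trans _ (@yext_mor P d M N).

(* Ext^d(M, N) <> 0.  For d > 0 the group Ext^d(M, N) is the set of yext_equiv
   classes, so it is nonzero when it has two distinct elements. *)
Definition Ext_neq0 P (d : nat) (M N : lmodType A) : Prop :=
  match d with
  | 0 => exists f : {linear M -> N}, exists x, f x <> 0
  | d'.+1 => exists E E' : yoneda_ext P d'.+1 M N, ~ yext_equiv E E'
  end.

(* Dimensions are extended reals, +oo for unbounded; the zero object, all of
   whose Ext groups vanish, has projective dimension -oo. *)
Definition proj_dim (R : realType) P (M : lmodType A) : \bar R :=
  ereal_sup [set x | exists (d : nat) (N : lmodType A),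
    [/\ P N, Ext_neq0 P d M N & x = (d%:R)%:E]].

Definition gl_dim (R : realType) P : \bar R :=
  ereal_sup [set x | exists M : lmodType A, P M /\ x = proj_dim R P M].

End YonedaExt.

Definition all_modules (A : pzRingType) : lmodType A -> Prop := fun=> True.

(* Main.v *)
(* GZ_module M means that M is finitely generated and that every vector spans a
   finite-dimensional space over each center Z_k; call such vectors torsion.  For a
   U-module N, the Chevalley-Eilenberg cochains of gl_n with values in
   Hom_C(U, N) form a coresolution of N whose terms are injective, because
   Alt^i(gl_n, J) is a retract of a power of J, and vanish above degree
   D = dim gl_n; so Ext^d = 0 for d > D.  For the trivial module the
   top form represents a nonzero class, because gl_n is unimodular.

   The same complex serves GZ once it is known that its torsion part stays exact.
   This is done one center at a time, for k = n, ..., 1.  Averaging over the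
   unitary group is replaced by finite families on which gl_k acts by
   *-representations; Hilbert's argument then shows that Z_k is noetherian and that
   z x = sum_i z_i x c_i(z) for x in gl_n and z in Z_k, so that torsion is a
   submodule.  Artin-Rees for central elements makes the torsion part of an
   injective U_k-module injective, and injectives over U_k restrict to injectives
   over U_(k-1) because U_k is free over it (PBW).  Finally a coresolution by
   injectives of a torsion module splits off its torsion part degree by degree.

   Ext groups are compared with the coresolution directly on Yoneda sequences:
   each sequence lifts to a map into the complex, and sequences with the same
   lift are connected through a third one built inside the complex. *)

From HB Require Import structures.
From Stdlib Require Import Relation_Operators.
Require Import Defs.
From mathcomp Require Import all_boot all_order all_algebra.
From mathcomp Require Import boolp classical_sets constructive_ereal reals ereal complex.
From mathcomp Require Import -(notations) ssrcomplements mpoly.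
From mathcomp Require Import -(notations) functions.
From mathcomp Require Import ring zify.

Set Implicit Arguments.
Unset Strict Implicit.
Unset Printing Implicit Defensive.

Import GRing.Theory.
Local Open Scope ring_scope.

(** * Submodules, Baer's criterion and noetherian rings *)

(** The obstacle is finite generation: the category of Gelfand-Zeitlin modules cannot be expected to
    contain enough injectives, so the coresolution lives among larger torsion modules, and Yoneda
    sequences in the category are cut out of it as finitely generated submodules; this is one use of
    noetherianity. The algebra Gamma is not central in U, so the Artin-Rees argument does not apply
    to it as a whole. Each Z_k is central in U_k, and local finiteness over Gamma splits into
    torsion over the single Z_k because these commute with each other. The order of k is forced: an
    injective over U_k stays injective over U_(k-1), and after the step for k the torsion part is
    known to be injective over U_k only. Accordingly the splitting that gives exactness takes place
    over U_k, although the torsion parts are U-submodules. Characteristic 0 enters through division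
    by degrees, both for the injectivity of spaces of alternating forms and in the contracting
    homotopy. *)

Section Submodules.
Variable A : pzRingType.
Implicit Types M N J : lmodType A.

Definition submod M (S : M -> Prop) : Prop :=
  S 0 /\ forall (a : A) u v, S u -> S v -> S (a *: u + v).

Definition linear_on M N (S : M -> Prop) (f : M -> N) : Prop :=
  forall (a : A) u v, S u -> S v -> f (a *: u + v) = a *: f u + f v.

Definition left_ideal (I : A -> Prop) : Prop :=
  I 0 /\ forall a x y, I x -> I y -> I (a * x + y).

(* Injective modules are given as subsets R of an ambient module J, so that their
   torsion parts live in the same type. *)
Definition baer J (R : J -> Prop) : Prop :=
  forall (I : A -> Prop) (f : A -> J), left_ideal I ->
    (forall a x y, I x -> I y -> f (a * x + y) = a *: f x + f y) ->
    (forall a, I a -> R (f a)) ->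
    exists2 e, R e & forall a, I a -> f a = a *: e.

Definition mk_linear M N (f : M -> N) (fP : linear f) : {linear M -> N} :=
  HB.pack f (GRing.isLinear.Build A M N *:%R f fP).

Lemma submodD M (S : M -> Prop) u v : submod S -> S u -> S v -> S (u + v).
Proof. by move=> [_ SP] Su Sv; rewrite -[u]scale1r; apply: SP. Qed.

Lemma submodZ M (S : M -> Prop) a u : submod S -> S u -> S (a *: u).
Proof. by move=> [S0 SP] Su; rewrite -[_ *: _]addr0; apply: SP. Qed.

Lemma submodN M (S : M -> Prop) u : submod S -> S u -> S (- u).
Proof. by move=> SP Su; rewrite -scaleN1r; apply: submodZ. Qed.

Lemma submodB M (S : M -> Prop) u v : submod S -> S u -> S v -> S (u - v).
Proof. by move=> SP Su Sv; apply: submodD => //; apply: submodN. Qed.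

Lemma submod_sum M (S : M -> Prop) I (r : seq I) (P : pred I) (F : I -> M) :
  submod S -> (forall i, P i -> S (F i)) -> S (\sum_(i <- r | P i) F i).
Proof.
move=> SP SF; elim/big_ind: _ => //; first by case: SP.
by move=> u v; apply: submodD.
Qed.

Lemma submodT M : submod (fun _ : M => True). Proof. by []. Qed.

Lemma submod0 M : submod (fun x : M => x = 0).
Proof. by split=> // a u v -> ->; rewrite scaler0 addr0. Qed.

Lemma submodI M (S T : M -> Prop) :
  submod S -> submod T -> submod (fun x => S x /\ T x).
Proof.
by move=> [S0 SP] [T0 TP]; split=> // a u v [? ?] [? ?]; split; [apply: SP|apply: TP].
Qed.

Lemma submod_preim M N (f : {linear M -> N}) (S : N -> Prop) :
  submod S -> submod (fun x => S (f x)).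
Proof.
by move=> [S0 SP]; split=> [|a u v Su Sv]; rewrite ?linear0 // linearP; apply: SP.
Qed.

Lemma submod_im M N (f : {linear M -> N}) (S : M -> Prop) :
  submod S -> submod (fun y => exists2 x, S x & f x = y).
Proof.
move=> [S0 SP]; split=> [|a _ _ [u Su <-] [v Sv <-]].
  by exists 0 => //; rewrite linear0.
by exists (a *: u + v); [apply: SP | rewrite linearP].
Qed.

Lemma submod_add M (S T : M -> Prop) : submod S -> submod T ->
  submod (fun x => exists u v, [/\ S u, T v & x = u + v]).
Proof.
move=> [S0 SP] [T0 TP]; split=> [|a _ _ [u [v [Su Tv ->]]] [u' [v' [Su' Tv' ->]]]].
  by exists 0, 0; rewrite addr0.
exists (a *: u + u'), (a *: v + v'); split; [exact: SP|exact: TP|].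
by rewrite scalerDr addrACA.
Qed.

Lemma submod_bigcup M (S : nat -> M -> Prop) : (forall i, submod (S i)) ->
  (forall i x, S i x -> S i.+1 x) -> submod (fun x => exists i, S i x).
Proof.
move=> SP Si.
have mono i j x : (i <= j)%N -> S i x -> S j x.
  by move=> /subnK <-; elim: (j - i)%N => [//|k IH] /IH /Si; rewrite addSn.
split=> [|a u v [i Su] [j Sv]]; first by exists 0%N; have [] := SP 0%N.
exists (maxn i j); have [_] := SP (maxn i j); apply.
  exact: mono (leq_maxl i j) Su.
exact: mono (leq_maxr i j) Sv.
Qed.

(** * Baer's criterion by Zorn's lemma *)

Section Extension.
Variables (M J : lmodType A) (S : M -> Prop) (R : J -> Prop) (f : M -> J).
Hypotheses (SP : submod S) (RP : submod R) (Rbaer : baer R).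
Hypotheses (f_lin : linear_on S f) (f_R : forall x, S x -> R (f x)).

(** A partial linear map is encoded by its graph, so that no domain has to be carried along;
    linearity of the graph reduces single-valuedness to the fibre over 0. *)
Record part_ext := PartExt {
  pe_rel :> M -> J -> Prop;
  pe_ext : forall x, S x -> pe_rel x (f x);
  pe_lin : forall a x y x' y', pe_rel x y -> pe_rel x' y' ->
    pe_rel (a *: x + x') (a *: y + y');
  pe_R : forall x y, pe_rel x y -> R y;
  pe_fun : forall y, pe_rel 0 y -> y = 0 }.

Let part_ext0 : part_ext.
Proof.
apply: (@PartExt (fun x y => S x /\ y = f x)) => [//|a x _ x' _ [Sx ->] [Sx' ->]|x _ [Sx ->]|y [S0 ->]].
- by split; [apply SP | rewrite f_lin].
- exact: f_R.
- by have := f_lin (-1) S0 S0; rewrite scaler0 addr0 scaleN1r addNr.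
Defined.

Let pe_00 (G : part_ext) : G 0 0.
Proof.
have S0 : S 0 by case: SP.
by have := pe_lin (-1) (pe_ext G S0) (pe_ext G S0); rewrite !scaleN1r !addNr.
Qed.

Let pe_uniq (G : part_ext) x y y' : G x y -> G x y' -> y = y'.
Proof.
move=> Gy Gy'; apply/eqP; rewrite -subr_eq0 addrC -scaleN1r; apply/eqP.
by apply: (@pe_fun G); have := pe_lin (-1) Gy' Gy; rewrite [in X in pe_rel _ X _]scaleN1r addNr.
Qed.

Let pe_le (G H : part_ext) := `[< forall x y, G x y -> H x y >].

Let pe_max : exists G : part_ext, forall H : part_ext,
  (forall x y, G x y -> H x y) -> forall x y, H x y -> G x y.
Proof.
have [||C Ctot|G Gmax] := @ZL_preorder part_ext part_ext0 pe_le.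
- by move=> G; apply/asboolP.
- by move=> G H K /asboolP GH /asboolP HK; apply/asboolP => x y /GH/HK.
- have [C0|C0] := pselect (exists G, C G); last first.
    by exists part_ext0 => G CG; case: C0; exists G.
  have [G0 CG0] := C0.
  have ch G H : C G -> C H -> exists K : part_ext,
      [/\ C K, forall x y, G x y -> K x y & forall x y, H x y -> K x y].
    by move=> CG CH; have [/asboolP|/asboolP] := Ctot _ _ CG CH => GH; [exists H|exists G]; split.
  unshelve eexists (@PartExt (fun x y => exists2 G : part_ext, C G & G x y) _ _ _ _).
  + by move=> x Sx; exists G0 => //; apply: pe_ext.
  + move=> a x y x' y' [G CG Gxy] [H CH Hxy].
    by have [K [CK GK HK]] := ch _ _ CG CH; exists K => //; apply: pe_lin; auto.
  + by move=> x y [G _]; apply: pe_R.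
  + by move=> y [G _]; apply: pe_fun.
  by move=> G CG; apply/asboolP => x y Gxy; exists G.
exists G => H GH; apply/asboolP; apply: Gmax; exact/asboolP.
Qed.

Let pe_total : exists G : part_ext, forall x, exists y, G x y.
Proof.
have [G Gmax] := pe_max; exists G => x.
(* The multiples of [x] already in the domain. The function [h] picks their values, and the element
   given by Baer's criterion becomes the value at [x]. *)
pose I (a : A) := exists y, G (a *: x) y.
have IP : left_ideal I.
  split=> [|a b c [y Gy] [z Gz]]; first by exists 0; rewrite scale0r; apply: pe_00.
  by exists (a *: y + z); rewrite scalerDl -scalerA; apply: pe_lin.
have /choice[h hP] : forall a, exists y, I a -> G (a *: x) y.
  by move=> a; have [[y Gy]|nI] := pselect (I a); [exists y|exists 0].
have [||e Re eP] := Rbaer IP (f := h).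
- move=> a b c Ib Ic; apply: (@pe_uniq G ((a * b + c) *: x)).
    by apply: hP; case: IP => _; apply.
  by rewrite scalerDl -scalerA; apply: pe_lin; apply: hP.
- by move=> a Ia; apply: pe_R (hP _ Ia).
(* Single-valued because a relation [u + a *: x = 0] makes [u] a multiple of [x] in the domain,
   where [h] agrees with multiplication by [e]. *)
unshelve epose (H := @PartExt (fun z y => exists a u v, [/\ G u v, z = u + a *: x & y = v + a *: e]) _ _ _ _).
- by move=> z Sz; exists 0, z, (f z); rewrite !scale0r !addr0; split=> //; apply: pe_ext.
- move=> a _ _ _ _ [b [u [v [Gu -> ->]]]] [b' [u' [v' [Gu' -> ->]]]].
  exists (a * b + b'), (a *: u + u'), (a *: v + v'); split; first exact: pe_lin.
    by rewrite scalerDr scalerDl scalerA addrACA.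
  by rewrite scalerDr scalerDl scalerA addrACA.
- by move=> _ _ [a [u [v [Gu _ ->]]]]; apply: submodD (pe_R Gu) (submodZ _ _ _).
- move=> _ [a [u [v [Gu uE ->]]]].
  have Eu : u = (- a) *: x by rewrite scaleNr; apply/eqP; rewrite -addr_eq0 -uE.
  have Ia : I (- a) by exists v; rewrite -Eu.
  have -> : v = h (- a) by apply: pe_uniq (hP _ Ia); rewrite -Eu.
  by rewrite (eP _ Ia) scaleNr addNr.
exists e; apply: (Gmax H) => /= [z y Gzy|].
  by exists 0, z, y; rewrite !scale0r !addr0.
by exists 1, 0, 0; rewrite !scale1r !add0r; split.
Qed.

Lemma baer_extend : exists g : {linear M -> J},
  (forall x, S x -> g x = f x) /\ forall x, R (g x).
Proof.
have [G /choice[g gP]] := pe_total.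
have g_lin : linear g.
  by move=> a x y; apply: (@pe_uniq G) (gP _) _; apply: pe_lin.
exists (mk_linear g_lin); split=> x; last exact: pe_R (gP x).
by move=> Sx; apply: (@pe_uniq G) (gP x) _; apply: pe_ext.
Qed.

End Extension.

(** [f] descends to the image of [p] and is extended from there; no injectivity of [p] is asked,
    which suits the maps inside an exact sequence. *)
Lemma baer_factor M N J (p : {linear M -> N}) (R : J -> Prop) (f : {linear M -> J}) :
  submod R -> baer R -> (forall x, R (f x)) -> (forall x, p x = 0 -> f x = 0) ->
  exists g : {linear N -> J}, (forall x, g (p x) = f x) /\ forall y, R (g y).
Proof.
move=> RP Rb fR fp.
have fE x y : p x = p y -> f x = f y.
  by move=> pxy; apply/subr0_eq; rewrite -linearB fp // linearB pxy subrr.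
pose S y := exists2 x, True & p x = y.
have /choice[h hP] : forall y, exists x, S y -> p x = y.
  by move=> y; have [[x _ px]|nS] := pselect (S y); [exists x|exists 0].
have [|y [x _ <-]|g [gE gR]] := @baer_extend _ _ S R (f \o h) (submod_im p (@submodT M)) RP Rb.
- move=> a _ _ [x _ <-] [y _ <-] /=; rewrite -[RHS]linearP; apply: fE.
  by rewrite linearP !hP //; [exists y|exists x|exists (a *: x + y) => //; rewrite linearP].
- exact: fR.
exists g; split=> // x; rewrite gE; last by exists x.
by apply: fE; apply: hP; exists x.
Qed.

Fixpoint spn M (s : seq M) (x : M) : Prop :=
  if s is e :: s' then exists (a : A) y, spn s' y /\ x = a *: e + y else x = 0.

Lemma spnP M (s : seq M) : submod (spn s).
Proof.
elim: s => [|e s [IH0 IH]]; first exact: submod0.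
split=> [|a _ _ [b [u [Su ->]]] [c [v [Sv ->]]]]; first by exists 0, 0; rewrite scale0r addr0.
exists (a * b + c), (a *: u + v); split; first exact: IH.
by rewrite scalerDr scalerDl scalerA addrACA.
Qed.

Lemma spn_mem M (s : seq M) x : x \in s -> spn s x.
Proof.
elim: s => //= e s IH; rewrite inE => /predU1P[->|/IH Sx].
  by exists 1, 0; rewrite scale1r addr0; split=> //; apply spnP.
by exists 0, x; rewrite scale0r add0r.
Qed.

Lemma spn_min M (s : seq M) (D : M -> Prop) : submod D ->
  (forall x, x \in s -> D x) -> forall x, spn s x -> D x.
Proof.
move=> DP; elim: s => [|e s IH] Ds x /=; first by move->; case: DP.
case=> a [y [Sy ->]]; apply DP; first by apply: Ds; rewrite mem_head.
by apply: IH Sy => z zs; apply: Ds; rewrite inE zs orbT.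
Qed.

Lemma spn_sub M (s t : seq M) : {subset s <= t} -> forall x, spn s x -> spn t x.
Proof. by move=> st; apply: spn_min => [|x /st]; [apply: spnP|apply: spn_mem]. Qed.

Lemma spn_im M N (f : {linear M -> N}) (s : seq M) x : spn s x -> spn (map f s) (f x).
Proof.
apply: (@spn_min _ _ (fun x => spn (map f s) (f x))).
  exact/submod_preim/spnP.
by move=> y ys; apply/spn_mem/map_f.
Qed.

Definition fg M (D : M -> Prop) : Prop := exists s : seq M, forall x, D x <-> spn s x.

Lemma spn_tuple M (s : seq M) x :
  spn s x <-> exists a : 'I_(size s) -> A, x = \sum_(i < size s) a i *: tnth (in_tuple s) i.
Proof.
split=> [|[a ->]]; last first.
  apply: submod_sum (spnP s) _ => i _; apply: submodZ (spnP s) _.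
  exact/spn_mem/mem_tnth.
elim: s x => [|e s IH] x /=; first by move->; exists (fun=> 0); rewrite big_ord0.
case=> a [y [/IH[b ->] ->]].
exists (fun i => oapp b a (unlift ord0 i)); rewrite big_ord_recl unlift_none /= (tnth_nth 0) /=.
by congr (_ + _); apply: eq_bigr => i _; rewrite liftK /= !(tnth_nth 0).
Qed.

Lemma fin_genP M : fin_gen M <-> fg (fun _ : M => True).
Proof.
split=> [[m [e eP]]|[s sP]].
  exists (codom e) => x; split=> // _; have [a ->] := eP x.
  apply: submod_sum (spnP _) _ => i _; apply: submodZ (spnP _) _.
  exact/spn_mem/codom_f.
by exists (size s), (tnth (in_tuple s)) => v; apply/spn_tuple/sP.
Qed.

Lemma fg_submod M (D : M -> Prop) : fg D -> submod D.
Proof.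
move=> [s sP]; split=> [|a u v]; first by apply/sP; apply spnP.
by rewrite !sP; apply (spnP s).2.
Qed.

Lemma fg0 M : fg (fun x : M => x = 0). Proof. by exists [::]. Qed.

Lemma fg_add M (S T : M -> Prop) : fg S -> fg T ->
  fg (fun x => exists u v, [/\ S u, T v & x = u + v]).
Proof.
move=> Sfg Tfg; have [s sP] := Sfg; have [t tP] := Tfg.
exists (s ++ t) => x; split=> [[u [v [/sP Su /tP Tv ->]]]|].
  by apply: submodD (spnP _) _ _; [apply: spn_sub Su|apply: spn_sub Tv] => z zs;
    rewrite mem_cat zs ?orbT.
apply: (spn_min (submod_add (fg_submod Sfg) (fg_submod Tfg))) => z.
rewrite mem_cat => /orP[zs|zt].
  by exists z, 0; rewrite addr0; split=> //; [apply/sP/spn_mem|apply/tP; case: (spnP t)].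
by exists 0, z; rewrite add0r; split=> //; [apply/sP; case: (spnP s)|apply/tP/spn_mem].
Qed.

Lemma fg_im M N (f : {linear M -> N}) (D : M -> Prop) :
  fg D -> fg (fun y => exists2 x, D x & f x = y).
Proof.
move=> Dfg; have [s sP] := Dfg; exists (map f s) => y; split=> [[x /sP Dx <-]|]; first exact: spn_im.
apply: (spn_min (submod_im f (fg_submod Dfg))) => _ /mapP[x xs ->].
by exists x => //; apply/sP/spn_mem.
Qed.

Definition noeth_ring : Prop := forall I : A -> Prop, left_ideal I ->
  exists s : seq A^o, (forall x, x \in s -> I x) /\ forall x, I x -> spn s x.

Definition noeth M (S : M -> Prop) : Prop := forall D : M -> Prop, submod D ->
  (forall x, D x -> S x) -> fg D.

(** Induction on the generators: the coefficients at [e] of elements of [D] form a left ideal, and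
    what remains after subtracting combinations of lifts of its generators lies in the span of
    [s]. *)
Lemma noeth_spn M (s : seq M) : noeth_ring -> noeth (spn s).
Proof.
move=> An; elim: s => [|e s IH] D DP Ds.
  by exists [::] => x; split=> [/Ds//|/= ->]; case: DP.
pose I a := exists2 y, spn s y & D (a *: e + y).
have IP : left_ideal I.
  split=> [|a b c [y Sy Dy] [z Sz Dz]].
    by exists 0; [case: (spnP s)|rewrite scale0r addr0; case: DP].
  exists (a *: y + z); first exact: (spnP s).2.
  rewrite scalerDl -scalerA addrACA -scalerDr; exact: DP.2.
have [t [tI It]] := An I IP.
have [|x [] //|u uP] := IH (fun x => D x /\ spn s x); first exact: submodI (spnP s).
have /choice[h hP] : forall a, exists y, I a -> spn s y /\ D (a *: e + y).
  by move=> a; have [[y ? ?]|nI] := pselect (I a); [exists y|exists 0].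
pose t' := [seq (a : A) *: e + h a | a <- t].
have Dt' x : x \in t' -> D x by move=> /mapP[a /tI /hP[_ ?] ->].
exists (t' ++ u) => x; split=> [Dx|]; last first.
  apply: spn_min => // z; rewrite mem_cat => /orP[/Dt'//|zu].
  by have [] := (uP z).2 (spn_mem zu).
have [a [y [Sy xE]]] := Ds _ Dx.
have Ia : I a by exists y => //; rewrite -xE.
have [z Tz Sz] : exists2 z, spn t' z & spn s (z - a *: e).
  have {Ia} := It _ Ia.
  apply: (@spn_min A^o _ (fun b : A => exists2 z, spn t' z & spn s (z - b *: e))) => [|b bt].
    split=> [|c b d [z Tz Sz] [w Tw Sw]].
      by exists 0; rewrite ?scale0r ?subr0; [case: (spnP t')|case: (spnP s)].
    exists (c *: z + w); first exact: (spnP t').2.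
    rewrite scalerDl -scalerA opprD addrACA -scalerBr; exact: (spnP s).2.
  exists ((b : A) *: e + h b); first by apply/spn_mem/mapP; exists b.
  by rewrite addrAC subrr add0r; have [] := hP _ (tI _ bt).
rewrite -[x](subrK z); apply: submodD (spnP _) _ _; last first.
  by apply: spn_sub Tz => w wt; rewrite mem_cat wt.
apply: (@spn_sub _ u); first by move=> w wu; rewrite mem_cat wu orbT.
apply/uP; split.
  apply: submodB => //; apply: spn_min Tz => //.
have -> : x - z = y - (z - a *: e) by rewrite xE opprB addrCA addrA.
exact: submodB (spnP s) _ _.
Qed.

Lemma noeth_fg M (S : M -> Prop) : noeth_ring -> fg S -> noeth S.
Proof.
move=> An [s sP] D DP DS; apply: (@noeth_spn M s) => // x /DS.
by rewrite sP.
Qed.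

Lemma acc_stable M (S : M -> Prop) (D : nat -> M -> Prop) : noeth S ->
  (forall i, submod (D i)) -> (forall i x, D i x -> D i.+1 x) ->
  (forall i x, D i x -> S x) -> exists m, forall i x, D i x -> D m x.
Proof.
move=> Sn DP Dinc DS.
have [|x [i /DS//]|s sP] := Sn (fun x => exists i, D i x); first exact: submod_bigcup.
have mono i j x : (i <= j)%N -> D i x -> D j x.
  by move=> /subnK <-; elim: (j - i)%N => [//|k IH] /IH /Dinc; rewrite addSn.
have [m mP] : exists m, forall x, x \in s -> D m x.
  have : forall x, x \in s -> exists i, D i x by move=> x /spn_mem /sP.
  elim: s {sP} => [|e s IH] sD; first by exists 0%N.
  have [|m mP] := IH; first by move=> x xs; apply: sD; rewrite inE xs orbT.
  have [i Di] := sD e (mem_head _ _).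
  exists (maxn i m) => x; rewrite inE => /predU1P[->|/mP].
    exact: mono (leq_maxl _ _) Di.
  exact: mono (leq_maxr _ _).
exists m => i x Dx; have : exists i, D i x by exists i.
by move=> /sP; apply: spn_min.
Qed.

End Submodules.

(** * Submodules as modules, and restriction of scalars *)

Section SubmoduleType.
Variables (A : pzRingType) (M : lmodType A) (S : M -> Prop).

Record smod (SP : submod S) : Type := Smod { sm_val : M; sm_prop : S sm_val }.

Variable SP : submod S.
Local Notation T := (smod SP).

Lemma sm_inj (u v : T) : sm_val u = sm_val v -> u = v.
Proof.
by case: u v => [u Su] [v Sv] /= uv; subst v; congr Smod; apply: Prop_irrelevance.
Qed.

HB.instance Definition _ := gen_eqMixin T.
HB.instance Definition _ := gen_choiceMixin T.

Definition sm_zero : T := Smod SP (proj1 SP).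
Definition sm_add (u v : T) : T := Smod SP (submodD SP (sm_prop u) (sm_prop v)).
Definition sm_opp (u : T) : T := Smod SP (submodN SP (sm_prop u)).
Definition sm_scale (a : A) (u : T) : T := Smod SP (submodZ a SP (sm_prop u)).

Fact sm_addA : associative sm_add.
Proof. by move=> u v w; apply: sm_inj; apply: addrA. Qed.
Fact sm_addC : commutative sm_add.
Proof. by move=> u v; apply: sm_inj; apply: addrC. Qed.
Fact sm_add0 : left_id sm_zero sm_add.
Proof. by move=> u; apply: sm_inj; apply: add0r. Qed.
Fact sm_addN : left_inverse sm_zero sm_opp sm_add.
Proof. by move=> u; apply: sm_inj; apply: addNr. Qed.
HB.instance Definition _ := GRing.isZmodule.Build T sm_addA sm_addC sm_add0 sm_addN.

Fact sm_scaleA a b u : sm_scale a (sm_scale b u) = sm_scale (a * b) u.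
Proof. by apply: sm_inj; apply: scalerA. Qed.
Fact sm_scale1 : left_id 1 sm_scale.
Proof. by move=> u; apply: sm_inj; apply: scale1r. Qed.
Fact sm_scaleDr : right_distributive sm_scale +%R.
Proof. by move=> a u v; apply: sm_inj; apply: scalerDr. Qed.
Fact sm_scaleDl u : {morph sm_scale^~ u : a b / a + b}.
Proof. by move=> a b; apply: sm_inj; apply: scalerDl. Qed.
HB.instance Definition _ :=
  GRing.Zmodule_isLmodule.Build A T sm_scaleA sm_scale1 sm_scaleDr sm_scaleDl.

Fact sm_val_linear : linear (@sm_val SP).
Proof. by []. Qed.
HB.instance Definition _ := GRing.isLinear.Build A T M *:%R (@sm_val SP) sm_val_linear.

Lemma sm_fg : fg S -> fin_gen T.
Proof.
move=> [s sP].
have [t tE] : exists t : seq T, map (@sm_val SP) t = s.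
  have : forall x, x \in s -> S x by move=> x xs; apply/sP/spn_mem.
  elim: s {sP} => [|e s IH] sS; first by exists [::].
  have [|t tE] := IH; first by move=> x xs; apply: sS; rewrite inE xs orbT.
  by exists (Smod SP (sS e (mem_head _ _)) :: t); rewrite /= tE.
apply/fin_genP; exists t => x; split=> // _.
have := (sP _).1 (sm_prop x); rewrite -tE.
elim: t {s sP tE} x => [|e t IH] x /=; first by move=> x0; apply: sm_inj.
move=> [a [y [ty xE]]]; exists a, (x - a *: e); split; last by rewrite addrC subrK.
by apply: IH => /=; rewrite xE addrAC subrr add0r.
Qed.

Lemma sm_lift (N : lmodType A) (f : {linear N -> M}) : (forall x, S (f x)) ->
  exists g : {linear N -> T}, forall x, sm_val (g x) = f x.
Proof.
move=> fS; have g_lin : linear (fun x => Smod SP (fS x)).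
  by move=> a x y; apply: sm_inj; rewrite /= linearP.
by exists (mk_linear g_lin).
Qed.

End SubmoduleType.

(** An alias of [M] in which [phi] only selects the scalar action, so that one [M] carries the
    actions of all the U_k. *)
Definition resm (B A : pzRingType) (phi : {rmorphism B -> A}) (M : lmodType A) : Type := M.

Section RestrictionOfScalars.
Variables (B A : pzRingType) (phi : {rmorphism B -> A}) (M : lmodType A).
Local Notation T := (resm phi M).
HB.instance Definition _ := GRing.Zmodule.on T.
Definition res_scale (b : B) (u : T) : T := phi b *: (u : M).
Fact res_scaleA a b u : res_scale a (res_scale b u) = res_scale (a * b) u.
Proof. by rewrite /res_scale rmorphM scalerA. Qed.
Fact res_scale1 : left_id 1 res_scale.
Proof. by move=> u; rewrite /res_scale rmorph1 scale1r. Qed.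
Fact res_scaleDr : right_distributive res_scale +%R.
Proof. by move=> a u v; rewrite /res_scale scalerDr. Qed.
Fact res_scaleDl u : {morph res_scale^~ u : a b / a + b}.
Proof. by move=> a b; rewrite /res_scale rmorphD scalerDl. Qed.
HB.instance Definition _ :=
  GRing.Zmodule_isLmodule.Build B T res_scaleA res_scale1 res_scaleDr res_scaleDl.

Lemma submod_res (S : M -> Prop) : submod S -> submod (S : T -> Prop).
Proof. by move=> [S0 SP]; split=> // b u v; apply: SP. Qed.
End RestrictionOfScalars.

Definition res_linear (B A : pzRingType) (phi : {rmorphism B -> A}) (M N : lmodType A)
  (f : {linear M -> N}) : {linear resm phi M -> resm phi N} :=
  @mk_linear B (resm phi M) (resm phi N) f (fun b u v => linearP f (phi b) u v).

(** * Yoneda classes and coresolutions *)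

Section Coresolutions.
Variable A : pzRingType.
Implicit Types M N X Y : lmodType A.

(* The complex meant is the part cut out by cT; the ambient one need not be exact. *)
Record cplx := Cplx {
  cJ : nat -> lmodType A;
  cd : forall i, {linear cJ i -> cJ i.+1};
  cT : forall i, cJ i -> Prop }.

Definition shift (c : cplx) : cplx :=
  @Cplx (fun i => cJ c i.+1) (fun i => cd c i.+1) (fun i => @cT c i.+1).

(** Exactness is required in positive degrees; the augmentation from N will supply degree 0. The
    extension property concerns maps [f] vanishing on the kernel of [p], since in a Yoneda sequence
    the kernel of each map is the image of the preceding one. *)
Record good (P : lmodType A -> Prop) (c : cplx) : Prop := Good {
  good_sub : forall i, submod (@cT c i);
  good_d : forall i x, @cT c i x -> cT (cd c i x);
  good_dd : forall i x, @cT c i x -> cd c i.+1 (cd c i x) = 0;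
  good_exact : forall i x, @cT c i.+1 x -> cd c i.+1 x = 0 ->
    exists2 y, cT y & cd c i y = x;
  good_ext : forall i X Y (p : {linear X -> Y}) (f : {linear X -> cJ c i}),
    P Y -> (forall x, cT (f x)) -> (forall x, p x = 0 -> f x = 0) ->
    exists g : {linear Y -> cJ c i}, (forall x, g (p x) = f x) /\ forall y, cT (g y) }.

Lemma good_shift P c : good P c -> good P (shift c).
Proof.
case=> h1 h2 h3 h4 h5; split=> i; [exact: h1|exact: h2|exact: h3|exact: h4|].
exact: h5 i.+1.
Qed.

(* The map f on X lifts along s to a chain map into c, ending with phi on M. *)
Fixpoint lifts d c X M : mod_seq d X M -> (X -> cJ c 0) -> (M -> cJ c d.+1) -> Prop :=
  match d with
  | 0 => fun s f phi => forall x, phi (s x) = cd c 0 (f x)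
  | d'.+1 => fun s f phi => exists g : {linear projT1 s -> cJ c 1},
      [/\ forall x, @cT c 1 (g x), forall x, g ((projT2 s).1 x) = cd c 0 (f x)
        & @lifts d' (shift c) _ M (projT2 s).2 g phi]
  end.

Lemma exact_from_ext d X M (s : mod_seq d X M) (I I' : X -> Prop) :
  (forall x, I x <-> I' x) -> exact_from I s -> exact_from I' s.
Proof.
by case: d s => [|d] s II' /= [sI sE]; split=> // x; rewrite sI.
Qed.

Lemma lifts_mor d c X X' M (psi : {linear X -> X'}) (s : mod_seq d X M)
    (s' : mod_seq d X' M) (f : X -> cJ c 0) (f' : X' -> cJ c 0) phi :
  seq_mor psi s s' -> (forall x, f x = f' (psi x)) -> lifts s' f' phi -> lifts s f phi.
Proof.
elim: d c X X' psi s s' f f' phi => [|d IH] c X X' psi s s' f f' phi /=.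
  by move=> ss' ff' s'phi x; rewrite ss' s'phi ff'.
move=> [chi [chiE chi_mor]] ff' [g [gT gE gl]].
exists (g \o chi); split=> [x|x|]; first exact: gT.
  by rewrite /= chiE gE ff'.
exact: IH chi_mor (fun=> erefl) gl.
Qed.

Lemma lifts_ext d c X M (s : mod_seq d X M) (f f' : X -> cJ c 0) phi :
  (forall x, cd c 0 (f x) = cd c 0 (f' x)) -> lifts s f phi -> lifts s f' phi.
Proof.
case: d s phi => [|d] s phi /= ff'; first by move=> sphi x; rewrite -ff'.
by move=> [g [gT gE gl]]; exists g; split=> // x; rewrite gE ff'.
Qed.

Lemma lifts_sub P d c X M (s : mod_seq d X M) (f f' : X -> cJ c 0) phi phi' : good P c ->
  lifts s f phi -> lifts s f' phi' ->
  lifts s (fun x => f x - f' x) (fun y => phi y - phi' y).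
Proof.
elim: d c X s f f' phi phi' => [|d IH] c X s f f' phi phi' cP /=.
  by move=> sf sf' x; rewrite linearB sf sf'.
move=> [g [gT gE gl]] [g' [gT' gE' gl']].
exists (g \- g'); split=> [x|x|]; first exact: submodB (good_sub cP 1) _ _.
  by rewrite /= gE gE' linearB.
exact: IH (good_shift cP) gl gl'.
Qed.

(** [cd] composed with the current map vanishes on the kernel of the next map of the sequence, hence
    extends along it; by [good_dd] the extension satisfies the same condition one step later. *)
Lemma lifts_exists P d c X M (s : mod_seq d X M) (I : X -> Prop) (f : {linear X -> cJ c 0}) :
  good P c -> P M -> seq_in P s -> exact_from I s -> (forall x, cT (f x)) ->
  (forall x, I x -> cd c 0 (f x) = 0) -> exists2 phi : {linear M -> cJ c d.+1}, forall y, cT (phi y) & lifts s f phi.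
Proof.
elim: d c X s I f => [|d IH] c X s I f cP PM /=.
  move=> _ [sI _] fT If.
  have [|x /sI /If//|phi [phiE phiT]] := good_ext cP (p := s) (f := cd c 0 \o f) PM.
    by move=> x; apply: (good_d cP).
  by exists phi.
move=> [PX sP] [sI sE] fT If.
have [|x /sI /If//|g [gE gT]] := good_ext cP (p := (projT2 s).1) (f := cd c 0 \o f) PX.
  by move=> x; apply: (good_d cP).
have [_ [x <-]|phi phiT phiP] := IH (shift c) _ _ _ g (good_shift cP) PM sP sE gT.
  by rewrite gE /= (good_dd cP).
by exists phi => //; exists g.
Qed.

(** A lift of a map that vanishes on [I] is null-homotopic. Each step extends [g] along the next map
    to some [k] and replaces the next lift [h] by [h] minus [cd] of [k]; the last extension is
    [psi]. *)
Lemma lifts_uniq P d c X M (s : mod_seq d X M) (I : X -> Prop) (g : {linear X -> cJ c 0})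
    (phi : M -> cJ c d.+1) :
  good P c -> P M -> seq_in P s -> exact_from I s -> (forall x, cT (g x)) ->
  (forall x, I x -> g x = 0) -> lifts s g phi ->
  exists2 psi : {linear M -> cJ c d}, forall y, cT (psi y) & forall y, phi y = cd c d (psi y).
Proof.
elim: d c X s I g phi => [|d IH] c X s I g phi cP PM /=.
  move=> _ [sI sE] gT Ig sg.
  have [//|x /sI /Ig//|psi [psiE psiT]] := good_ext cP (p := s) (f := g) PM.
  by exists psi => // y; have [x <-] := sE y; rewrite sg psiE.
move=> [PX sP] [sI sE] gT Ig [h [hT hE hl]].
have [//|x /sI /Ig//|k [kE kT]] := good_ext cP (p := (projT2 s).1) (f := g) PX.
apply: (IH (shift c) _ _ _ (h \- (cd c 0 \o k)) phi (good_shift cP) PM sP sE) => /=.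
- by move=> x; apply: submodB (good_sub cP 1) _ _ => //; apply: (good_d cP).
- by move=> _ [x <-]; rewrite hE kE subrr.
- by apply: lifts_ext hl => x; rewrite /= linearB (good_dd cP) // subr0.
Qed.

Section Realization.
Variables (P : lmodType A -> Prop) (small : forall X : lmodType A, (X -> Prop) -> Prop).
Arguments small {X}.
Variable M : lmodType A.

(** The size condition that the category puts on submodules: finitely generated ones for
    Gelfand-Zeitlin modules, arbitrary ones for all modules. [small_lift] covers a small submodule
    of the target by a small one of the source. *)
Record small_axioms : Prop := SmallAxioms {
  small_0 : forall X, small (fun x : X => x = 0);
  small_add : forall X (S T : X -> Prop), small S -> small T ->
    small (fun x => exists u v, [/\ S u, T v & x = u + v]);
  small_P : forall X, P X -> small (fun _ : X => True);
  small_im : forall X Y (f : {linear X -> Y}) (S : X -> Prop), small S ->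
    small (fun y => exists2 x, S x & f x = y);
  small_sub : forall X (S T : X -> Prop), submod S -> small T ->
    (forall x, S x -> T x) -> small S;
  small_lift : forall X Y (f : {linear X -> Y}) (S : X -> Prop) (E : Y -> Prop),
    submod S -> small E -> (forall y, E y -> exists2 x, S x & f x = y) ->
    exists D : X -> Prop, [/\ submod D, small D, forall x, D x -> S x,
      forall x, D x -> E (f x) & forall y, E y -> exists2 x, D x & f x = y] }.

Definition small_closed (c : cplx) : Prop :=
  forall i (D : cJ c i * M -> Prop) (DP : submod D), small D ->
    (forall z, D z -> cT z.1) -> P (smod DP).

Hypothesis smallP : small_axioms.
Hypothesis PM : P M.

Lemma small_bigadd (I : finType) X (D : I -> X -> Prop) :
  (forall j, submod (D j)) -> (forall j, small (D j)) ->
  exists S : X -> Prop, [/\ submod S, small S, forall j x, D j x -> S x &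
    forall T : X -> Prop, submod T -> (forall j x, D j x -> T x) -> forall x, S x -> T x].
Proof.
move=> DP Ds.
suff [S [SP Ss DS ST]] : exists S : X -> Prop, [/\ submod S, small S,
    forall j x, j \in enum I -> D j x -> S x &
    forall T : X -> Prop, submod T -> (forall j x, D j x -> T x) -> forall x, S x -> T x].
  by exists S; split=> // j x; apply: DS; rewrite mem_enum.
elim: (enum I) => [|j s [S [SP Ss DS ST]]].
  exists (fun x => x = 0); split=> //; first exact: submod0.
    exact: small_0.
  by move=> T [T0 _] _ x ->.
exists (fun x => exists u v, [/\ D j u, S v & x = u + v]); split.
- exact: submod_add.
- exact: small_add.
- move=> i x; rewrite inE => /predU1P[->|js] Dx.
    by exists x, 0; rewrite addr0; split=> //; case: SP.
  by exists 0, x; rewrite add0r; split=> //; [case: (DP j)|apply: DS Dx].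
- move=> T TP DT _ [u [v [/DT Du /(ST T TP DT) Sv ->]]].
  exact: submodD.
Qed.

Lemma pair_linear X Y (Z : lmodType A) (f : {linear X -> Y}) (g : {linear X -> Z}) :
  linear (fun x => (f x, g x)).
Proof. by move=> a x y; rewrite !linearP. Qed.

Lemma inl_linear X Y : linear (fun x : X => (x, 0 : Y)).
Proof. by move=> a x y; congr (_, _); rewrite /= scaler0 addr0. Qed.

(** Built from the right: the last term is a small submodule of the pullback of [phi] and [cd], and
    each earlier one is a small submodule of a term of the complex that covers the kernel of the
    next map; all contain the images of the given sequences. Every term sits in [cJ c i * M], with
    second coordinate 0 except in the last, so that one type serves the whole induction. [E] makes
    room for prescribed cocycles at the left end. *)
Lemma realize d c (phi : {linear M -> cJ c d.+1}) (I : finType) (X : I -> lmodType A)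
    (s : forall j, mod_seq d (X j) M) (f : forall j, {linear X j -> cJ c 0})
    (K : forall j, X j -> Prop) (E : cJ c 0 -> Prop) :
  good P c -> small_closed c -> (forall y, cT (phi y)) -> (forall y, cd c d.+1 (phi y) = 0) ->
  (forall j x, cT (f j x)) -> (forall j, P (X j)) -> (forall j, seq_in P (s j)) ->
  (forall j, exact_from (K j) (s j)) -> (forall j, lifts (s j) (f j) phi) ->
  submod E -> small E -> (forall x, E x -> cT x) -> (forall x, E x -> cd c 0 x = 0) ->
  exists (D : cJ c 0 * M -> Prop) (DP : submod D) (s' : mod_seq d (smod DP) M),
    [/\ small D, forall z, D z -> cT z.1 & forall x, E x -> D (x, 0)] /\
    [/\ seq_in P s',
      exact_from (fun z => (sm_val z).2 = 0 /\ cd c 0 (sm_val z).1 = 0) s',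
      lifts s' (fun z => (sm_val z).1) phi &
      forall j, exists psi : {linear X j -> smod DP},
        [/\ forall x, (sm_val (psi x)).1 = f j x, forall x, K j x -> (sm_val (psi x)).2 = 0
          & seq_mor psi (s j) s']].
Proof.
elim: d c phi I X s f K E => [|d IH] c phi I X s f K E cP cs phiT phid fT XP sP sK sl EP Es ET Ed.
  pose h j := mk_linear (pair_linear (f j) (s j)).
  have h_im j : submod (fun z => exists2 x, True & h j x = z) := submod_im (h j) (@submodT _ (X j)).
  have h_small j : small (fun z => exists2 x, True & h j x = z).
    by apply: small_im => //; apply: small_P.
  have [F [FP Fs hF Fmin]] := small_bigadd h_im h_small.
  (* This pullback maps onto [M] since the cocycles [phi y] are coboundaries; [D0] is a small part
     of it that still does. *)
  pose S (z : cJ c 0 * M) := cT z.1 /\ phi z.2 = cd c 0 z.1.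
  have SP : submod S.
    split=> [|a u v [Tu uE] [Tv vE]].
      by split; rewrite ?linear0 //; case: (good_sub cP 0).
    by split; [apply (good_sub cP 0)|rewrite /= !linearP uE vE].
  have sndP : linear (@snd (cJ c 0) M) by [].
  have [y _|D0 [D0P D0s D0S _ D0M]] := small_lift smallP (f := mk_linear sndP) SP (small_P smallP PM).
    by have [x Tx xE] := good_exact cP (phiT y) (phid y); exists (x, y).
  pose inl := mk_linear (@inl_linear (cJ c 0) M).
  have E0P := submod_im inl EP.
  have E0s := small_im smallP inl Es.
  have D1P := submod_add D0P E0P.
  have DP := submod_add D1P FP.
  set D := (D in submod D) in DP.
  have FD z : F z -> D z by move=> Fz; exists 0, z; rewrite add0r; split=> //; case: D1P.
  have D0D z : D0 z -> D z.
    move=> Dz; exists z, 0; rewrite addr0; split=> //; last by case: FP.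
    by exists z, 0; rewrite addr0; split=> //; case: E0P.
  have DS z : D z -> S z.
    move=> [u [v [[u0 [v0 [/D0S Du0 [x Ex <-] ->]]] Fv ->]]].
    apply: submodD => //; first apply: submodD => //.
      by split=> /=; [apply: ET|rewrite linear0 Ed].
    by apply: (Fmin S SP _ _ Fv) => j _ [y _ <-]; split=> //=; apply: sl.
  have sP' : linear (fun z : smod DP => (sm_val z).2) by [].
  exists D, DP, (mk_linear sP'); split.
    split=> [|z /DS[]//|x Ex]; first by apply: small_add => //; apply: small_add.
    exists (x, 0), 0; rewrite addr0; split=> //; last by case: FP.
    exists 0, (x, 0); rewrite add0r; split=> //; [by case: D0P|by exists x].
  split=> //.
  - split=> [z|y] /=.
      split=> [z0|[]//]; have [_ <-] := DS _ (sm_prop z).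
      by rewrite z0 linear0.
    by have [x Dx <-] := D0M y Logic.I; exists (Smod DP (D0D _ Dx)).
  - by move=> z; have [_ ->] := DS _ (sm_prop z).
  - move=> j; have [x|psi psiE] := @sm_lift _ _ _ DP _ (h j).
      by apply/FD/(hF j); exists x.
    exists psi; split=> [x|x Kx|x] /=; rewrite psiE //=.
    by have [sKj _] := sK j; apply/sKj.
pose X1 j := projT1 (s j).
pose p j : {linear X j -> X1 j} := (projT2 (s j)).1.
pose t j : mod_seq d (X1 j) M := (projT2 (s j)).2.
have /all_sig[g gP] : forall j, {g : {linear X1 j -> cJ c 1} |
    [/\ forall x, cT (g x), forall x, g (p j x) = cd c 0 (f j x) & lifts (c := shift c) (t j) g phi]}.
  by move=> j; apply: cid; apply: sl.
pose K1 j y := exists x, p j x = y.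
have [| | | | | | | | | D1 [D1P [s1 [[D1s D1T _] [s1P s1E s1l s1mor]]]]] :=
    IH (shift c) phi I X1 t g K1 (fun x => x = 0) (good_shift cP) (fun i => @cs i.+1) phiT phid.
- by move=> j; have [] := gP j.
- by move=> j; have [] := sP j.
- by move=> j; have [] := sP j.
- by move=> j; have [] := sK j.
- by move=> j; have [] := gP j.
- exact: submod0.
- exact: small_0.
- by move=> _ ->; case: (good_sub cP 1).
- by move=> _ ->; rewrite linear0.
pose h_fun (z : cJ c 0 * M) : cJ c 1 * M := (cd c 0 z.1, 0).
have h_lin : linear h_fun.
  by move=> a u v; rewrite /h_fun linearP; congr (_, _); rewrite /= scaler0 addr0.
pose h := mk_linear h_lin.
(* The kernel of the map leaving the next term, which has to become the image of [D]. *)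
pose Ker (z : cJ c 1 * M) := D1 z /\ (z.2 = 0 /\ cd c 1 z.1 = 0).
have KerP : submod Ker.
  split=> [|a u v [Du [u0 uE]] [Dv [v0 vE]]]; first by split; [case: {+}D1P|split=> //; apply: linear0].
  split; first exact: (D1P.2).
  by split; rewrite /= ?linearP ?u0 ?v0 ?uE ?vE scaler0 addr0.
pose S (z : cJ c 0 * M) := cT z.1 /\ z.2 = 0.
have SP : submod S.
  split=> [|a u v [Tu u0] [Tv v0]]; first by split=> //; case: (good_sub cP 0).
  by split; [apply (good_sub cP 0)|rewrite /= u0 v0 scaler0 addr0].
have Kers : small Ker by apply: (small_sub smallP KerP D1s) => z [].
have [[y1 y2] [Dy [/= y0 dy]]|D0 [D0P D0s D0S D0K KD0]] := small_lift smallP (f := h) SP Kers.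
  have [x Tx xE] := good_exact cP (D1T _ Dy) dy.
  by exists (x, 0) => //; rewrite /h_fun /= xE y0.
pose inl := mk_linear (@inl_linear (cJ c 0) M).
pose fi j : {linear X j -> (cJ c 0 * M)%type} := inl \o f j.
have f_im j : submod (fun z => exists2 x, True & fi j x = z) := submod_im (fi j) (@submodT _ (X j)).
have f_small j : small (fun z => exists2 x, True & fi j x = z).
  by apply: small_im => //; apply: small_P.
have [F [FP Fs fF Fmin]] := small_bigadd f_im f_small.
have E0P := submod_im inl EP.
have E0s := small_im smallP inl Es.
have D01P := submod_add D0P E0P.
have DP := submod_add D01P FP.
set D := (D in submod D) in DP.
have FD z : F z -> D z by move=> Fz; exists 0, z; rewrite add0r; split=> //; case: D01P.
have D0D z : D0 z -> D z.
  move=> Dz; exists z, 0; rewrite addr0; split=> //; last by case: FP.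
  by exists z, 0; rewrite addr0; split=> //; case: E0P.
have /all_sig[psi1 psi1P] : forall j, {psi : {linear X1 j -> smod D1P} |
    [/\ forall x, (sm_val (psi x)).1 = g j x, forall x, K1 j x -> (sm_val (psi x)).2 = 0
          & seq_mor psi (t j) s1]}.
  by move=> j; apply: cid; apply: s1mor.
have psi1E j x : sm_val (psi1 j (p j x)) = h (fi j x).
  rewrite /= /h_fun /=; have [e1 e2 _] := psi1P j; have [_ e3 _] := gP j.
  by rewrite [LHS]surjective_pairing e1 e3 e2 //; exists x.
have DS z : D z -> S z /\ Ker (h z).
  have SKP : submod (fun z => S z /\ Ker (h z)).
    exact: submodI SP (submod_preim h KerP).
  move=> [u [v [[u0 [v0 [Du0 [x Ex <-] ->]]] Fv ->]]].
  apply: (submodD SKP); first apply: (submodD SKP).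
  - by split; [apply: D0S|apply: D0K].
  - split; first by split=> //; apply: ET.
    by rewrite /= /h_fun /= Ed //; case: KerP.
  - apply: (Fmin _ SKP _ _ Fv) => j _ [y _ <-]; split; first by split=> //=.
    rewrite -psi1E; split; first exact: sm_prop.
    by rewrite psi1E /= (good_dd cP).
have hD1 (z : smod DP) : D1 ((h \o @sm_val _ _ _ DP) z).
  by have [_ []] := DS _ (sm_prop z).
have [q qE] := @sm_lift _ _ _ D1P _ (h \o @sm_val _ _ _ DP) hD1.
pose s' : mod_seq d.+1 (smod DP) M :=
  existT (fun Y : lmodType A => ({linear smod DP -> Y} * mod_seq d Y M)%type)
    (smod D1P : lmodType A) (q, s1).
exists D, DP, s'; split.
  split=> [|z /DS[[]]//|x Ex]; first by apply: small_add => //; apply: small_add.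
  exists (x, 0), 0; rewrite addr0; split=> //; last by case: FP.
  exists 0, (x, 0); rewrite add0r; split=> //; [by case: D0P|by exists x].
split=> /=.
- by split=> //; apply: (cs 1%N).
- split=> [z|].
    have [[_ z0] _] := DS _ (sm_prop z).
    split=> [qz|[_ dz]]; last by apply: sm_inj; rewrite qE /= /h_fun dz.
    by split=> //; have := qE z; rewrite qz => /(congr1 fst).
  apply: exact_from_ext s1E => z; split=> [zK|[x <-]].
    have [|x Dx xE] := KD0 (sm_val z); first by split=> //; apply: sm_prop.
    by exists (Smod DP (D0D _ Dx)); apply: sm_inj; rewrite qE.
  by rewrite qE; have [_ []] := DS _ (sm_prop x).
- have fst_lin : linear (fun z : smod D1P => (sm_val z).1) by [].
  exists (mk_linear fst_lin); split=> //= z; last by rewrite qE.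
  by apply: D1T; apply: sm_prop.
- move=> j; have [x|psi psiE] := @sm_lift _ _ _ DP _ (fi j).
    by apply/FD/(fF j); exists x.
  exists psi; split=> [x|x _|]; rewrite ?psiE //.
  exists (psi1 j); split=> [x|]; last by have [] := psi1P j.
  by apply: sm_inj; rewrite psi1E qE /= psiE.
Qed.

End Realization.
End Coresolutions.

(** * Yoneda classes as cocycles modulo coboundaries *)

Section YonedaClasses.
Variables (A : pzRingType) (P : lmodType A -> Prop) (N M : lmodType A) (c : cplx A).
Variable eta : {linear N -> cJ c 0}.
Hypotheses (cP : good P c) (PM : P M).
Hypotheses (etaT : forall x, cT (eta x)) (eta_inj : forall x, eta x = 0 -> x = 0).
Hypotheses (d_eta : forall x, cd c 0 (eta x) = 0).
Hypothesis eta_exact : forall y, cT y -> cd c 0 y = 0 -> exists x, eta x = y.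

Definition ylift d (E : mod_seq d.+1 N M) (phi : M -> cJ c d.+1) : Prop :=
  exists g : {linear projT1 E -> cJ c 0},
    [/\ forall x, cT (g x), forall x, g ((projT2 E).1 x) = eta x
      & lifts (projT2 E).2 g phi].

Lemma ylift_exists d (E : yoneda_ext P d.+1 M N) :
  exists2 phi : {linear M -> cJ c d.+1}, forall y, cT (phi y) & ylift E phi.
Proof.
case: E => [[X [p t]] [/= PX tP] [/= pI tE]].
have [//|x /pI ->|g [gE gT]] := good_ext cP (p := p) (f := eta) PX.
  exact: linear0.
have [_ [x <-]|phi phiT phiP] := lifts_exists cP PM tP tE gT; first by rewrite gE.
by exists phi => //; exists g.
Qed.

Lemma ylift_uniq d (E : yoneda_ext P d.+1 M N) (phi phi' : M -> cJ c d.+1) :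
  ylift E phi -> ylift E phi' ->
  exists2 psi : {linear M -> cJ c d}, forall y, cT (psi y) &
    forall y, phi y - phi' y = cd c d (psi y).
Proof.
case: E => [[X [p t]] [/= PX tP] [/= pI tE]] [g [/= gT gE gl]] [g' [/= gT' gE' gl']].
apply: (lifts_uniq (g := g \- g') cP PM tP tE) => [x|_ [x <-]|] /=.
- exact: submodB (good_sub cP 0) _ _.
- by rewrite gE gE' subrr.
- exact: lifts_sub cP gl gl'.
Qed.

Lemma ylift_mor d (E E' : yoneda_ext P d.+1 M N) (phi : M -> cJ c d.+1) :
  yext_mor E E' -> ylift E' phi -> ylift E phi.
Proof.
move=> [psi [psiE pmor]] [g [gT gE gl]].
exists (g \o psi); split=> [x|x|]; first exact: gT.
  by rewrite /= psiE gE.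
exact: lifts_mor pmor (fun=> erefl) gl.
Qed.

(** A cocycle is determined by its sequence up to coboundaries, and a morphism of sequences pulls a
    lift of its target back to its source; a zigzag of morphisms therefore changes the cocycle by a
    coboundary only. *)
Lemma ylift_equiv d (E E' : yoneda_ext P d.+1 M N) (phi phi' : M -> cJ c d.+1) :
  yext_equiv E E' -> ylift E phi -> ylift E' phi' ->
  exists2 psi : {linear M -> cJ c d}, forall y, cT (psi y) &
    forall y, phi y - phi' y = cd c d (psi y).
Proof.
move=> EE'; elim: EE' phi phi' => {E E'} [E E' mor|E|E E' _ IH|E E' E'' _ IH1 _ IH2] phi phi' Ep Ep'.
- exact: ylift_uniq Ep (ylift_mor mor Ep').
- exact: ylift_uniq Ep Ep'.
- have [psi psiT psiE] := IH _ _ Ep' Ep.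
  exists (-%R \o psi) => [y|y] /=; first exact: submodN (good_sub cP d) _.
  by rewrite linearN -psiE opprB.
- have [phi'' _ Ep''] := ylift_exists E'.
  have [psi psiT psiE] := IH1 _ _ Ep Ep''; have [psi' psiT' psiE'] := IH2 _ _ Ep'' Ep'.
  exists (psi \+ psi') => [y|y] /=; first exact: submodD (good_sub cP d) _ _.
  by rewrite linearD -psiE -psiE' addrA subrK.
Qed.

Variable small : forall X : lmodType A, (X -> Prop) -> Prop.
Hypotheses (smallP : small_axioms P small) (c_small : small_closed P small M c) (PN : P N).

Lemma ylift_realize d (phi : {linear M -> cJ c d.+1}) (I : finType)
    (E : I -> yoneda_ext P d.+1 M N) :
  (forall y, cT (phi y)) -> (forall y, cd c d.+1 (phi y) = 0) ->
  (forall j, ylift (E j) phi) ->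
  exists E' : yoneda_ext P d.+1 M N, ylift E' phi /\ forall j, yext_mor (E j) E'.
Proof.
move=> phiT phid El.
pose X j : lmodType A := projT1 (E j : mod_seq d.+1 N M).
pose p j : {linear N -> X j} := (projT2 (E j : mod_seq d.+1 N M)).1.
pose t j : mod_seq d (X j) M := (projT2 (E j : mod_seq d.+1 N M)).2.
have /all_sig[g gP] : forall j, {g : {linear X j -> cJ c 0} |
    [/\ forall x, cT (g x), forall x, g (p j x) = eta x & lifts (t j) g phi]}.
  by move=> j; apply: cid; apply: El.
pose K j y := exists x, p j x = y.
have imP := submod_im eta (@submodT _ N).
have [| | | | | | | | |D [DP [s [[Ds DT imD] [sP sE sl smor]]]]] :=
   realize smallP PM (s := t) (f := g) (K := K) (E := fun y => exists2 x, True & eta x = y)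
     cP c_small phiT phid.
- by move=> j; have [] := gP j.
- by move=> j; have [] := yext_in (E j).
- by move=> j; have [] := yext_in (E j).
- by move=> j; have [] := yext_exact (E j).
- by move=> j; have [] := gP j.
- exact: imP.
- by apply: (small_im smallP); apply: (small_P smallP).
- by move=> _ [x _ <-].
- by move=> _ [x _ <-].
pose inl : {linear N -> (cJ c 0 * M)%type} := mk_linear (@inl_linear _ (cJ c 0) M) \o eta.
have [x|q qE] := @sm_lift _ _ _ DP _ inl; first by apply: imD; exists x.
pose s' : mod_seq d.+1 N M :=
  existT (fun Y : lmodType A => ({linear N -> Y} * mod_seq d Y M)%type)
    (smod DP : lmodType A) (q, s).
have s'P : seq_in P s' by split=> //; apply: c_small Ds DT.
have s'E : exact_from (fun x => x = 0) s'.
  split=> [x|] /=.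
    split=> [qx|->]; last exact: linear0.
    by apply: eta_inj; have := qE x; rewrite qx => /(congr1 fst).
  apply: exact_from_ext sE => z; split=> [[z2 dz]|[x <-]]; last by rewrite qE /= d_eta.
  have [x xE] := eta_exact (DT _ (sm_prop z)) dz.
  by exists x; apply: sm_inj; rewrite qE /= xE -z2 -surjective_pairing.
exists (YonedaExt s'P s'E); split.
  have fst_lin : linear (fun z : smod DP => (sm_val z).1) by [].
  exists (mk_linear fst_lin); split=> //= z; last by rewrite qE.
  by apply: DT; apply: sm_prop.
move=> j; have [psi [psi1 psi2 psimor]] := smor j.
exists psi; split=> // x; apply: sm_inj; rewrite [RHS]qE [LHS]surjective_pairing /=.
have [_ gE _] := gP j.
by rewrite psi1 [X in (X, _)]gE psi2 //; exists x.
Qed.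

Lemma ylift_same d (E E' : yoneda_ext P d.+1 M N) (phi : {linear M -> cJ c d.+1}) :
  (forall y, cT (phi y)) -> (forall y, cd c d.+1 (phi y) = 0) ->
  ylift E phi -> ylift E' phi -> yext_equiv E E'.
Proof.
move=> phiT phid El El'.
have [[]//|E'' [_ EE'']] := ylift_realize (E := fun b : bool => if b then E else E') phiT phid.
apply: (rst_trans _ _ _ E''); first exact: rst_step (EE'' true).
exact/rst_sym/rst_step/(EE'' false).
Qed.

Lemma Ext_vanish d : (forall x : cJ c d.+1, cT x -> x = 0) -> ~ Ext_neq0 P d.+1 M N.
Proof.
move=> c0 [E [E' nEE']]; apply: nEE'.
have lift0 (F : yoneda_ext P d.+1 M N) : ylift F (\0 : {linear M -> cJ c d.+1}).
  have [phi phiT phiE] := @ylift_exists d F.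
  have E0 : (phi : M -> cJ c d.+1) = (\0 : {linear M -> cJ c d.+1}).
    by apply: funext => y; apply: c0.
  by rewrite -E0.
have T0 : cT (0 : cJ c d.+1) by case: (good_sub cP d.+1).
by apply: (@ylift_same _ _ _ (\0 : {linear M -> cJ c d.+1})) => // y; rewrite /= linear0.
Qed.

(** Realization over the empty family turns a cocycle into a sequence. By [ylift_equiv] the two
    sequences are inequivalent as soon as [phi] is not a coboundary. *)
Lemma Ext_nonzero d (phi : {linear M -> cJ c d.+1}) :
  (forall y, cT (phi y)) -> (forall y, cd c d.+1 (phi y) = 0) ->
  exists E E0 : yoneda_ext P d.+1 M N, ylift E phi /\ ylift E0 (fun=> 0).
Proof.
move=> phiT phid.
have [|E [Ephi _]] := @ylift_realize d phi void (fun j : void => match j with end) phiT phid; first by case.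
have T0 : cT (0 : cJ c d.+1) by case: (good_sub cP d.+1).
have [|||E0 [E00 _]] := @ylift_realize d \0 void (fun j : void => match j with end).
- by [].
- by move=> y; rewrite /= linear0.
- by case.
by exists E, E0.
Qed.

End YonedaClasses.

(** * The Chevalley-Eilenberg complex *)

Section ChevalleyEilenberg.
Variables (K : numFieldType) (L : lmodType K) (br : L -> L -> L).
Hypotheses (br_linl : forall c x y z, br (c *: x + y) z = c *: br x z + br y z)
  (br_linr : forall c x y z, br z (c *: x + y) = c *: br z x + br z y)
  (brxx : forall x, br x x = 0)
  (br_jac : forall x y z, br x (br y z) = br (br x y) z + br y (br x z)).
Variables (A : algType K) (M : lmodType A) (rho : L -> M -> M).
Hypotheses (rho_lin : forall x, linear (rho x))
  (rho_linl : forall (c : K) x y m, rho (c *: x + y) m = c%:A *: rho x m + rho y m)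
  (rho_br : forall x y m, rho (br x y) m = rho x (rho y m) - rho y (rho x m)).

(* Cochains are curried: an (i+1)-cochain is a map from L to i-cochains. *)
Fixpoint ML (i : nat) : lmodType A :=
  if i is i'.+1 then (L -> ML i') : lmodType A else M.

Fixpoint lie i (x : L) : ML i -> ML i :=
  match i with
  | 0 => rho x
  | i'.+1 => fun f y => lie x (f y : ML i') - f (br x y)
  end.

(* Cartan's formula  d f x = lie x f - d (f x)  taken as a definition. *)
Fixpoint dCE i : ML i -> ML i.+1 :=
  match i with
  | 0 => fun m x => rho x m
  | i'.+1 => fun f x => lie x (f : ML i'.+1) - dCE (f x : ML i')
  end.

(** Alternation in the first two arguments; imposed at every level of [alt], it makes a cochain
    alternating in all arguments. *)
Definition alt2 i : (L -> ML i) -> Prop :=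
  match i with
  | 0 => fun _ => True
  | i'.+1 => fun f => forall x, f x x = 0
  end.

Fixpoint alt i : ML i -> Prop :=
  match i with
  | 0 => fun _ => True
  | i'.+1 => fun f => [/\ forall x, alt (f x : ML i'),
      forall (c : K) x y, f (c *: x + y) = c%:A *: f x + f y & alt2 f]
  end.

Lemma lie_linear i x : linear (@lie i x).
Proof.
elim: i => [|i IH] a f g /=; first exact: rho_lin.
by apply: funext => y; rewrite /= IH opprD addrACA scalerBr.
Qed.

Lemma lieD i x (f g : ML i) : lie x (f + g) = lie x f + lie x g.
Proof. by rewrite -[f]scale1r lie_linear !scale1r. Qed.

Lemma lie0 i x : lie x (0 : ML i) = 0.
Proof. by have := lie_linear (i := i) x (-1) 0 0; rewrite scaler0 addr0 scaleN1r addNr. Qed.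

Lemma lieZ i x a (f : ML i) : lie x (a *: f) = a *: lie x f.
Proof. by rewrite -[_ *: f]addr0 lie_linear lie0 addr0. Qed.

Lemma lieN i x (f : ML i) : lie x (- f) = - lie x f.
Proof. by rewrite -scaleN1r lieZ scaleN1r. Qed.

Lemma dCE_linear i : linear (@dCE i).
Proof.
elim: i => [|i IH] a f g /=; apply: funext => x /=; first exact: rho_lin.
change (lie x (a *: f + g) - dCE (a *: f x + g x) =
  a *: (lie x f - dCE (f x)) + (lie x g - dCE (g x))).
by rewrite lie_linear IH opprD addrACA scalerBr.
Qed.

Lemma alt_submod i : submod (@alt i).
Proof.
elim: i => [|i [IH0 IH]] //; split=> [|a f g [f1 f2 f3] [g1 g2 g3]].
  by split=> // [c x y|]; [rewrite scaler0 addr0|clear; case: i].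
split=> [x|c x y|]; first exact: (IH a _ _ (f1 x) (g1 x)).
  change (a *: f (c *: x + y) + g (c *: x + y) = c%:A *: (a *: f x + g x) + (a *: f y + g y)).
  rewrite f2 g2 !scalerDr !scalerA -addrA (addrCA (a *: f y)) addrA.
  by rewrite mulr_algl mulr_algr -addrA.
case: i f g {IH0 IH f1 f2 g1 g2} f3 g3 => [|i] f g //= f3 g3 x.
by change (a *: f x x + g x x = 0); rewrite f3 g3 scaler0 addr0.
Qed.

Lemma alt_lin i (f : ML i.+1) (c : K) x y : alt f -> f (c *: x + y) = c%:A *: f x + f y.
Proof. by case. Qed.

Lemma altD i (f : ML i.+1) x y : alt f -> f (x + y) = f x + f y.
Proof. by move=> fP; rewrite -[x]scale1r alt_lin // !scale1r. Qed.

Lemma alt0 i (f : ML i.+1) : alt f -> f 0 = 0.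
Proof. by move=> fP; have := alt_lin (-1) 0 0 fP; rewrite scaler0 addr0 !scaleN1r addNr. Qed.

Lemma altZ i (f : ML i.+1) (c : K) x : alt f -> f (c *: x) = c%:A *: f x.
Proof. by move=> fP; rewrite -[_ *: x]addr0 alt_lin // alt0 // addr0. Qed.

Lemma alt_sum i (f : ML i.+1) I (r : seq I) (P : pred I) (F : I -> L) : alt f ->
  f (\sum_(j <- r | P j) F j) = \sum_(j <- r | P j) f (F j).
Proof.
move=> fP; elim/big_rec2: _ => [|j u v _ <-]; first exact: alt0.
by rewrite altD.
Qed.

Lemma altC i (f : ML i.+2) x y : alt f -> f x y = - f y x.
Proof.
move=> fP; have [f1 f2 f3] := fP.
apply/eqP; rewrite -addr_eq0; have := f3 (x + y); rewrite (altD x y fP).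
change ((f x (x + y) + f y (x + y) = 0) -> f x y + f y x == 0).
by rewrite !(altD x y (f1 _)) !f3 add0r addr0 => ->.
Qed.

Lemma lie_linl i (f : ML i) (c : K) x y : alt f ->
  lie (c *: x + y) f = c%:A *: lie x f + lie y f.
Proof.
elim: i f => [|i IH] f fP /=; first exact: rho_linl.
apply: funext => z; have [f1 _ _] := fP.
change (lie (c *: x + y) (f z) - f (br (c *: x + y) z) =
  c%:A *: (lie x (f z) - f (br x z)) + (lie y (f z) - f (br y z))).
by rewrite (IH _ (f1 z)) br_linl (alt_lin _ _ _ fP) opprD addrACA scalerBr.
Qed.

Lemma alt_lie i x (f : ML i) : alt f -> alt (lie x f).
Proof.
elim: i f => [|i IH] f // fP; have [f1 f2 f3] := fP; split=> [y|c y z|].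
- exact: (submodB (alt_submod i) (IH _ (f1 y)) (f1 _)).
- change (lie x (f (c *: y + z)) - f (br x (c *: y + z)) =
    c%:A *: (lie x (f y) - f (br x y)) + (lie x (f z) - f (br x z))).
  by rewrite br_linr !alt_lin // lie_linear opprD addrACA scalerBr.
case: i f {IH f1 f2} fP f3 => [|i] f fP //= f3 y.
change (lie x (f y y : ML i) - f y (br x y) - f (br x y) y = 0).
by rewrite f3 lie0 sub0r (altC _ y fP) opprK addrC subrr.
Qed.

Lemma lie_br i x y (f : ML i) : alt f ->
  lie (br x y) f = lie x (lie y f) - lie y (lie x f).
Proof.
elim: i f => [|i IH] f fP /=; first exact: rho_br.
apply: funext => z; have [f1 _ _] := fP.
change (lie (br x y) (f z) - f (br (br x y) z) =
  lie x (lie y (f z) - f (br y z)) - (lie y (f (br x z)) - f (br y (br x z))) -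
  (lie y (lie x (f z) - f (br x z)) - (lie x (f (br y z)) - f (br x (br y z))))).
rewrite (IH _ (f1 z)) (br_jac x y z) (altD _ _ fP) !lieD !lieN.
by rewrite !opprB addrACA subrKA [X in _ = _ + X]subrKA opprD [_ + (- _ - _)]addrA subrKA addrAC.
Qed.

Lemma dCE0 i : dCE (0 : ML i) = 0.
Proof. by have := dCE_linear (i := i) (-1) 0 0; rewrite scaler0 addr0 scaleN1r addNr. Qed.

Lemma dCEB i (f g : ML i) : dCE (f - g) = dCE f - dCE g.
Proof. by rewrite addrC -scaleN1r dCE_linear scaleN1r addrC. Qed.

Lemma lie_dCE i x (f : ML i) : alt f -> lie x (dCE f) = dCE (lie x f).
Proof.
elim: i f => [|i IH] f fP.
  by apply: funext => y; rewrite /= rho_br opprB addrC subrK.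
apply: funext => y; have [f1 _ _] := fP.
change (lie x (lie y f - dCE (f y)) - (lie (br x y) f - dCE (f (br x y))) =
  lie y (lie x f) - dCE (lie x (f y) - f (br x y))).
rewrite lieD lieN (lie_br _ _ fP) (IH _ (f1 y)).
rewrite dCEB.
have zm (V : zmodType) (a b u v : V) : a - u - (a - b - v) = b - (u - v).
  by rewrite !opprB addrC addrA -(addrA v) subrK addrA (addrC b).
exact: zm.
Qed.

(** Contracted with [x], the claim says that [lie x (dCE f) - dCE (lie x f) + dCE (dCE (f x))]
    vanishes: [lie_dCE] and induction. *)
Lemma dCE_dCE i (f : ML i) : alt f -> dCE (dCE f) = 0.
Proof.
elim: i f => [|i IH] f fP; apply: funext => x.
  change (lie x (dCE f) - dCE (rho x f : ML 0) = 0).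
  by rewrite (lie_dCE x fP) subrr.
have [f1 _ _] := fP.
change (lie x (dCE f) - dCE (lie x f - dCE (f x)) = 0).
rewrite dCEB.
by rewrite (IH _ (f1 x)) subr0 (lie_dCE _ fP) subrr.
Qed.

Lemma alt_dCE i (f : ML i) : alt f -> alt (dCE f).
Proof.
elim: i f => [|i IH] f fP; first by split=> // c x y; apply: rho_linl.
have [f1 f2 f3] := fP; split=> [x|c x y|x].
- change (alt (lie x f - dCE (f x))).
  exact: (submodB (alt_submod i.+1) (alt_lie x fP) (IH _ (f1 x))).
- change (lie (c *: x + y) f - dCE (f (c *: x + y)) =
    c%:A *: (lie x f - dCE (f x)) + (lie y f - dCE (f y))).
  by rewrite lie_linl // f2 dCE_linear opprD addrACA -scalerBr.
case: i f {IH f1 f2} fP f3 => [|i] f fP f3.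
  change (rho x (f x) - f (br x x) - rho x (f x) = 0).
  by rewrite brxx alt0 // subr0 subrr.
change (lie x (f x : ML i.+1) - f (br x x) - (lie x (f x : ML i.+1) - dCE (f x x : ML i)) = 0).
by rewrite brxx alt0 // f3 dCE0 !subr0 subrr.
Qed.

Section Wedge.
Variable xi : L -> K.
Hypothesis xi_lin : forall c x y, xi (c *: x + y) = c * xi x + xi y.

(** Exterior multiplication by the linear form [xi], defined through the antiderivation rule for
    contraction with [x]. *)
Fixpoint wedge i : ML i -> ML i.+1 :=
  match i with
  | 0 => fun m x => (xi x)%:A *: m
  | i'.+1 => fun f x => (xi x)%:A *: (f : ML i'.+1) - wedge (f x : ML i')
  end.

Lemma wedge_linear i : linear (@wedge i).
Proof.
elim: i => [|i IH] a f g; apply: funext => x /=.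
  change ((xi x)%:A *: (a *: f + g) = a *: ((xi x)%:A *: f) + (xi x)%:A *: g).
  by rewrite scalerDr !scalerA mulr_algl mulr_algr.
change ((xi x)%:A *: (a *: f + g) - wedge (a *: f x + g x) =
  a *: ((xi x)%:A *: f - wedge (f x)) + ((xi x)%:A *: g - wedge (g x))).
by rewrite IH scalerDr scalerBr opprD addrACA !scalerA mulr_algl mulr_algr.
Qed.

Lemma wedge0 i : wedge (0 : ML i) = 0.
Proof. by have := wedge_linear (i := i) (-1) 0 0; rewrite scaler0 addr0 scaleN1r addNr. Qed.

Lemma alt_wedge i (f : ML i) : alt f -> alt (wedge f).
Proof.
elim: i f => [|i IH] f fP.
  split=> // c x y; change ((xi (c *: x + y))%:A *: f = c%:A *: ((xi x)%:A *: f) + (xi y)%:A *: f).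
  by rewrite xi_lin scalerDl scalerDl scalerA -scalerAl mul1r scalerA.
have [f1 f2 f3] := fP; split=> [x|c x y|x].
- exact: (submodB (alt_submod i.+1) (submodZ _ (alt_submod i.+1) fP) (IH _ (f1 x))).
- change ((xi (c *: x + y))%:A *: f - wedge (f (c *: x + y)) =
    c%:A *: ((xi x)%:A *: f - wedge (f x)) + ((xi y)%:A *: f - wedge (f y))).
  rewrite f2 wedge_linear xi_lin scalerDl scalerDl opprD addrACA scalerBr.
  by rewrite scalerA -scalerAl mul1r scalerA.
case: i f {IH f1 f2} fP f3 => [|i] f fP f3.
  by change ((xi x)%:A *: f x - (xi x)%:A *: f x = 0); rewrite subrr.
change ((xi x)%:A *: f x - ((xi x)%:A *: f x - wedge (f x x : ML i)) = 0).
by rewrite f3 wedge0 subr0 subrr.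
Qed.

End Wedge.

Section Coordinates.
Variables (D : nat) (e : 'I_D -> L) (xi : 'I_D -> L -> K).
Hypotheses (xi_lin : forall j c x y, xi j (c *: x + y) = c * xi j x + xi j y)
  (coordE : forall x, x = \sum_j xi j x *: e j)
  (xi_e : forall j l, xi j (e l) = (j == l)%:R).

Lemma altE i (f : ML i.+1) x : alt f -> f x = \sum_j (xi j x)%:A *: f (e j).
Proof.
move=> fP; rewrite {1}(coordE x) alt_sum //; apply: eq_bigr => j _; exact: altZ.
Qed.

Lemma ML_sumE i I (r : seq I) (P : pred I) (F : I -> ML i.+1) x :
  (\sum_(j <- r | P j) F j) x = \sum_(j <- r | P j) (F j x : ML i).
Proof. by elim/big_rec2: _ => // j u v _ <-. Qed.

Lemma wedgeN (xi' : L -> K) i (f : ML i) : wedge xi' (- f) = - wedge xi' f.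
Proof. by rewrite -scaleN1r -[_ *: f]addr0 wedge_linear wedge0 addr0 scaleN1r. Qed.

(** Euler's identity in the exterior algebra: contracting and multiplying back gives the degree of
    the form. *)
Lemma wedge_contract i (f : ML i.+1) : alt f ->
  \sum_j wedge (xi j) (f (e j) : ML i) = i.+1%:R *: f.
Proof.
elim: i f => [|i IH] f fP; apply: funext => x; rewrite ML_sumE.
  by change (\sum_j (xi j x)%:A *: f (e j) = 1 *: f x); rewrite scale1r -(altE x fP).
have [f1 _ _] := fP.
transitivity (\sum_j ((xi j x)%:A *: f (e j) + wedge (xi j) (f x (e j) : ML i))).
  apply: eq_bigr => j _; rewrite (altC x (e j) fP) wedgeN; by [].
rewrite big_split /= -(altE x fP) (IH _ (f1 x)) -[X in X + _]scale1r -scalerDl.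
by rewrite -[1]/(1%:R) -natrD add1n.
Qed.

(** Companion of [wedge_contract]: for each [j] the two compositions add up to the identity because
    [xi j (e j) = 1], so the two sums add up to [D]. *)
Lemma contract_wedge i (f : ML i) : alt f ->
  \sum_j (wedge (xi j) f (e j) : ML i) = (D%:R - i%:R) *: f.
Proof.
case: i f => [|i] f fP.
  transitivity (\sum_(j < D) f); last by rewrite sumr_const card_ord subr0 scaler_nat.
  by apply: eq_bigr => j _; rewrite /= xi_e eqxx scale1r scale1r.
transitivity (\sum_(j < D) (f - wedge (xi j) (f (e j) : ML i))).
  by apply: eq_bigr => j _; rewrite /= xi_e eqxx scale1r scale1r.
by rewrite big_split /= sumrN wedge_contract // sumr_const card_ord scalerBl !scaler_nat.
Qed.

(** [s] lists basis vectors already known to kill [f]; each contraction adds one more, and nothing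
    is left once all [D] are listed. *)
Lemma alt_eq0 i (f : ML i.+1) (s : seq 'I_D) : alt f -> uniq s ->
  (forall j, j \in s -> f (e j) = 0) -> (D < i.+1 + size s)%N -> f = 0.
Proof.
elim: i f s => [|i IH] f s fP us fs lt_D; apply: funext => x.
  rewrite altE // big1 // => j _; rewrite fs ?scaler0 //.
  have /subset_cardP/(_ (subset_predT _)) -> // : #|s| = #|predT : pred 'I_D|.
  apply/eqP; rewrite eqn_leq max_card /= cardT size_enum_ord (card_uniqP us).
  by rewrite add1n ltnS in lt_D.
have [f1 _ f3] := fP.
rewrite altE // big1 // => j _.
have [js|js] := boolP (j \in s); first by rewrite fs ?scaler0.
rewrite (IH (f (e j)) (j :: s)) ?scaler0 //=; [by rewrite js| |by rewrite addnS -addSn].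
move=> l; rewrite inE => /predU1P[->|ls]; first exact: f3.
by rewrite (altC _ _ fP) fs // oppr0.
Qed.

Lemma alt_top i (f : ML i) : (D < i)%N -> alt f -> f = 0.
Proof. by case: i f => // i f lt_D fP; apply: (alt_eq0 (s := [::])); rewrite ?addn0. Qed.

(** The coefficients [f a (e j)] extend by induction, and [wedge_contract] reassembles the form up
    to the factor [i.+1], which is invertible in characteristic 0. *)
Lemma baer_alt i : baer (fun _ : M => True) -> baer (@alt i).
Proof.
move=> Mb; elim: i => [|i IH] //= I f IP f_lin fR.
have /all_sig2[u uP uE] : forall j, {u : ML i | alt u & forall a, I a -> f a (e j) = a *: u}.
  move=> j; apply: cid2; apply: (IH I (fun a => f a (e j))) => //.
    by move=> a x y Ix Iy; rewrite f_lin.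
  by move=> a /fR[].
pose c : K := (i.+1%:R)^-1.
exists (c%:A *: \sum_j wedge (xi j) (u j)).
  apply: submodZ (alt_submod i.+1) _; apply: submod_sum (alt_submod i.+1) _ => j _.
  exact: alt_wedge.
move=> a Ia; rewrite scalerA mulr_algr -mulr_algl -scalerA scaler_sumr.
transitivity (c%:A *: \sum_j wedge (xi j) (f a (e j) : ML i)); last first.
  congr (_ *: _); apply: eq_bigr => j _; rewrite uE //.
  by rewrite -[_ *: u j]addr0 wedge_linear wedge0 addr0.
rewrite wedge_contract; last exact: fR.
have -> : i.+1%:R = (i.+1%:R : K)%:A :> A by rewrite scaler_nat.
by rewrite scalerA -scalerAl mul1r scalerA mulVf ?Num.Theory.pnatr_eq0 // scale1r scale1r.
Qed.

(** * Invariant forms of top degree *)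

Section TopForms.
Hypothesis unimod : forall x, \sum_k xi k (br x (e k)) = 0.

Fixpoint coef0 i : ML i -> Prop :=
  match i with
  | 0 => fun m => forall x, rho x m = 0
  | i'.+1 => fun f => forall x, coef0 (f x : ML i')
  end.

Lemma wedge_coef0 (xi' : L -> K) k (h : ML k) : coef0 h -> coef0 (wedge xi' h).
Proof.
have coef0B k' (u v : ML k') (c : A) : coef0 u -> coef0 v -> coef0 (c *: u - v).
  elim: k' u v => [|k' IH] u v u0 v0 x; last exact: (IH (u x) (v x)).
  change (lie x (c *: u - v : ML 0) = 0); rewrite lieD lieZ lieN /=.
  by rewrite [rho x u]u0 [rho x v]v0 scaler0 subr0.
elim: k h => [|k IH] h h0 x; last exact: (coef0B _ _ _ _ h0 (IH _ (h0 x))).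
move=> y; change (lie y ((xi' x)%:A *: h : ML 0) = 0).
by rewrite lieZ /= [rho y h]h0 scaler0.
Qed.

Lemma lie_coef0 i x (w : ML i.+1) : alt w -> coef0 w ->
  lie x w = - \sum_k wedge (xi k) (w (br x (e k)) : ML i).
Proof.
have brE y : br x y = \sum_k xi k y *: br x (e k).
  rewrite {1}(coordE y); elim/big_rec2: _ => [|k u v _ <-]; last exact: br_linr.
  by rewrite -[X in br _ X](addNr x) -scaleN1r br_linr brxx scaler0 addr0.
have wE i' (w' : ML i'.+1) y : alt w' ->
    w' (br x y) = \sum_k (xi k y)%:A *: w' (br x (e k)).
  by move=> w'P; rewrite brE alt_sum //; apply: eq_bigr => k _; apply: altZ.
elim: i w => [|i IH] w wP w0; apply: funext => y.
  change (rho x (w y) - w (br x y) = - ((\sum_k wedge (xi k) (w (br x (e k)) : ML 0)) y)).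
  by rewrite w0 sub0r ML_sumE wE.
change (lie x (w y : ML i.+1) - w (br x y) =
  - ((\sum_k wedge (xi k) (w (br x (e k)) : ML i.+1)) y)).
have [w1 _ _] := wP.
rewrite (IH _ (w1 y)) // ML_sumE wE // -opprD -big_split /=; congr (- _).
apply: eq_bigr => k _; rewrite (altC _ _ wP) wedgeN addrC.
by [].
Qed.

(** A form of degree [D - 1] is the sum of the contractions of the top forms [wedge (xi j) f] with
    the [e j]. By Cartan's formula [dCE] of such a contraction is the Lie derivative of a top form,
    and on invariant coefficients this is multiplication by minus the trace of [br x], which is
    0. *)
Lemma top_closed i (f : ML i) : D = i.+1 -> alt f -> coef0 f -> dCE f = 0.
Proof.
move=> Di fP f0.
have lie_top x (w : ML i.+1) : alt w -> coef0 w -> lie x w = 0.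
  move=> wP w0; rewrite lie_coef0 //.
  have Ew k : wedge (xi k) w = 0.
    by apply: alt_top; [rewrite Di|apply: alt_wedge].
  transitivity (- \sum_k (xi k (br x (e k)))%:A *: w).
    congr (- _); apply: eq_bigr => k _.
    have := congr1 (fun g => g (br x (e k))) (Ew k).
    by move=> /= /subr0_eq.
  by rewrite -scaler_suml -scaler_suml unimod scale0r scale0r oppr0.
have -> : f = \sum_j (wedge (xi j) f (e j) : ML i).
  by rewrite contract_wedge // Di -natrB // subSnn scale1r.
have dsum I (r : seq I) (F : I -> ML i) : dCE (\sum_(j <- r) F j) = \sum_(j <- r) dCE (F j).
  elim/big_rec2: _ => [|j u v _ <-]; first exact: dCE0.
  by rewrite -[F j]scale1r dCE_linear !scale1r.
rewrite dsum big1 // => j _.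
have wP := alt_wedge (xi_lin j) fP.
have : dCE (wedge (xi j) f) = 0 by apply: alt_top; [rewrite Di|apply: alt_dCE].
move=> /(congr1 (fun g => g (e j))) /= /eqP; rewrite subr_eq0 => /eqP <-.
by apply: lie_top => //; apply: wedge_coef0.
Qed.

Lemma top_form (m : M) : (forall x, rho x m = 0) -> m != 0 ->
  exists w : ML D, [/\ alt w, coef0 w & w <> 0].
Proof.
move=> m0 nzm.
suff [w [wP w0 nzw _]] : exists w : ML D, [/\ alt w, coef0 w, w <> 0 & True] by exists w.
(* The form is [m] multiplied successively by [xi 0], ..., [xi (k-1)]. Being killed by the later
   [e l], it is recovered from the next form by contraction with [e j], whence nonvanishing; in
   degree 0 there is nothing to contract. *)
have main k : (k <= D)%N -> exists w : ML k, [/\ alt w, coef0 w, w <> 0 &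
    match k return ML k -> Prop with 0 => fun _ => True
    | k'.+1 => fun w => forall l : 'I_D, (k <= l)%N -> w (e l) = 0 end w].
  elim: k => [|k IH] ltkD.
    by exists m; split=> //; apply/eqP.
  have [w [wP w0 nzw wl]] := IH (ltnW ltkD).
  pose j := Ordinal ltkD.
  have we (l : 'I_D) : (k <= l)%N -> wedge (xi j) w (e l) = (j == l)%:R%:A *: w.
    move=> le_kl; case: k w {IH wP w0 nzw} ltkD @j wl le_kl => [|k] w ltkD j wl le_kl /=; rewrite xi_e //.
    by rewrite wl // wedge0 subr0.
  exists (wedge (xi j) w); split.
  - exact: alt_wedge.
  - exact: wedge_coef0.
  - move=> /(congr1 (fun g => g (e j))); rewrite we // eqxx scale1r scale1r.
    exact: nzw.
  - move=> l lt_kl; rewrite we; last exact: ltnW.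
    by rewrite -val_eqE /= ltn_eqF // scale0r scale0r.
by have [w [wP w0 nzw _]] := main D (leqnn D); exists w.
Qed.

End TopForms.

(** * A contracting homotopy for filtered coefficients *)

Section Acyclicity.
Variables (F : nat -> M -> Prop) (del : 'I_D -> M -> M).
Hypotheses (F0 : forall m, F 0 m) (Fz : forall p, F p 0) (FS : forall p m, F p.+1 m -> F p m)
  (F_sub : forall p c m m', F p m -> F p m' -> F p (c%:A *: m + m'))
  (del_lin : forall j (c : K) m m', del j (c%:A *: m + m') = c%:A *: del j m + del j m')
  (del_F : forall j p m, F p m -> F p.+1 (del j m))
  (del_rho : forall j x p m, F p m ->
    F p.+1 (rho x (del j m) - del j (rho x m) + (xi j x)%:A *: m))
  (del_euler : forall p m, F p m -> F p.+1 (\sum_j del j (rho (e j) m) + p%:R *: m))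
  (rho_F : forall x p m, F p.+1 m -> F p (rho x m))
  (F_complete : forall s : nat -> M, (forall p, F p.+1 (s p.+1 - s p)) ->
    exists m, forall p, F p.+1 (m - s p))
  (F_sep : forall m, (forall p, F p m) -> m = 0).

Fixpoint FV i p : ML i -> Prop :=
  match i with
  | 0 => F p
  | i'.+1 => fun f => forall x, FV p (f x : ML i')
  end.

Fixpoint delV i j : ML i -> ML i :=
  match i with
  | 0 => del j
  | i'.+1 => fun f x => delV j (f x : ML i')
  end.

Lemma FV_lin i p (c : K) (f g : ML i) : FV p f -> FV p g -> FV p (c%:A *: f + g).
Proof.
elim: i f g => [|i IH] f g fP gP; first exact: F_sub.
by move=> x; apply: (IH (f x) (g x)).
Qed.

Lemma FV_D i p (f g : ML i) : FV p f -> FV p g -> FV p (f + g).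
Proof. by move=> fP gP; rewrite -[f]scale1r -[1](scale1r 1); apply: FV_lin. Qed.

Lemma FV_0 i p : FV p (0 : ML i).
Proof. by elim: i => [|i IH]; [apply: Fz|move=> x; apply: IH]. Qed.

Lemma FV_Z i p (c : K) (f : ML i) : FV p f -> FV p (c%:A *: f).
Proof. by move=> fP; rewrite -[_ *: f]addr0; apply: FV_lin => //; apply: FV_0. Qed.

Lemma FV_N i p (f : ML i) : FV p f -> FV p (- f).
Proof. by move=> fP; rewrite -scaleN1r -[-1](scaleN1r 1); apply: FV_Z. Qed.

Lemma FV_B i p (f g : ML i) : FV p f -> FV p g -> FV p (f - g).
Proof. by move=> fP gP; apply: FV_D => //; apply: FV_N. Qed.

Lemma FV_sum i p I (r : seq I) (f : I -> ML i) :
  (forall j, FV p (f j)) -> FV p (\sum_(j <- r) f j).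
Proof. by move=> fP; elim/big_ind: _ => //; [apply: FV_0|move=> *; apply: FV_D]. Qed.

Lemma FV_le i p q (f : ML i) : (p <= q)%N -> FV q f -> FV p f.
Proof.
elim: i f => [|i IH] f; last by move=> le_pq fP x; apply: IH le_pq (fP x).
by move=> /subnK <-; elim: (q - p)%N => [//|k IH] /FS.
Qed.

Lemma FV_sep i (f : ML i) : (forall p, FV p f) -> f = 0.
Proof.
elim: i f => [|i IH] f fP; first exact: F_sep.
by apply: funext => x; apply: IH => p; apply: fP.
Qed.

Lemma FV_all i (f : ML i) : FV 0 f.
Proof. by elim: i f => [|i IH] f //= x; apply: IH. Qed.

Lemma FV_lie i x p (f : ML i) : FV p.+1 f -> FV p (lie x f).
Proof.
elim: i f => [|i IH] f fP; first exact: rho_F.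
by move=> y; apply: FV_B; [apply/IH/fP|apply: FV_le (leqnSn p) (fP _)].
Qed.

Lemma FV_dCE i p (f : ML i) : FV p.+1 f -> FV p (dCE f).
Proof.
elim: i f => [|i IH] f fP; first by move=> x; apply: rho_F.
by move=> x; apply: FV_B; [apply: FV_lie|apply/IH/fP].
Qed.

Lemma delV_lin i j (c : K) (f g : ML i) : delV j (c%:A *: f + g) = c%:A *: delV j f + delV j g.
Proof.
elim: i f g => [|i IH] f g; first exact: del_lin.
by apply: funext => x; apply: (IH (f x) (g x)).
Qed.

Lemma delV0 i j : delV j (0 : ML i) = 0.
Proof.
have := delV_lin (i := i) j (-1) 0 0.
by rewrite scaleN1r !scaleN1r oppr0 addr0 addNr.
Qed.

Lemma delVB i j (f g : ML i) : delV j (f - g) = delV j f - delV j g.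
Proof. by rewrite -[f - g]addrC -[- g]scaleN1r -[-1](scaleN1r 1) delV_lin scaleN1r scaleN1r addrC. Qed.

Lemma FV_delV i j p (f : ML i) : FV p f -> FV p.+1 (delV j f).
Proof.
elim: i f => [|i IH] f fP; first exact: del_F.
by move=> x; apply: (IH (f x)); apply: fP.
Qed.

Lemma alt_delV i j (f : ML i) : alt f -> alt (delV j f).
Proof.
elim: i f => [|i IH] f fP //; have [f1 f2 f3] := fP; split=> [x|c x y|].
- exact: (IH _ (f1 x)).
- by change (delV j (f (c *: x + y)) = c%:A *: delV j (f x) + delV j (f y)); rewrite f2 delV_lin.
case: i f {IH f1 f2} fP f3 => [|i] f fP f3 // x.
by change (delV j (f x x : ML i) = 0); rewrite f3 delV0.
Qed.

Lemma lie_delV i j x p (f : ML i) : FV p f ->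
  FV p.+1 (lie x (delV j f) - delV j (lie x f) + (xi j x)%:A *: f).
Proof.
elim: i f => [|i IH] f fP; first exact: del_rho.
move=> y; change (FV p.+1 (lie x (delV j (f y)) - delV j (f (br x y)) -
  delV j (lie x (f y) - f (br x y)) + (xi j x)%:A *: f y)).
have zm (V : zmodType) (a b c d : V) : a - b - (c - b) + d = a - c + d.
  by rewrite opprB subrKA.
rewrite delVB zm; exact: (IH (f y) (fP y)).
Qed.

Lemma dCE_delV i j p (f : ML i) : FV p f ->
  FV p.+1 (dCE (delV j f) - delV j (dCE f) + wedge (xi j) f).
Proof.
elim: i f => [|i IH] f fP; first by move=> x; apply: del_rho.
move=> y; change (FV p.+1 (lie y (delV j f) - dCE (delV j (f y)) -
  delV j (lie y f - dCE (f y)) + ((xi j y)%:A *: f - wedge (xi j) (f y)))).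
have zm (V : zmodType) (a b c d u v : V) :
    a - b - (c - d) + (u - v) = (a - c + u) - (b - d + v).
  by rewrite !opprD !opprK [RHS]addrACA; congr (_ + _); rewrite addrACA.
rewrite delVB zm; apply: FV_B; first exact: lie_delV.
exact: (IH (f y) (fP y)).
Qed.

Lemma euler_lie i p (f : ML i) : FV p f ->
  FV p.+1 (\sum_j delV j (lie (e j) f) + p%:R *: f).
Proof.
elim: i f => [|i IH] f fP; first exact: del_euler.
move=> y; change (FV p.+1 ((\sum_j delV j (lie (e j) f)) y + p%:R *: f y)).
rewrite ML_sumE.
change (FV p.+1 (\sum_j delV j (lie (e j) (f y) - f (br (e j) y)) + p%:R *: f y)).
rewrite (eq_bigr (fun j => delV j (lie (e j) (f y)) - delV j (f (br (e j) y)))); last first.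
  by move=> j _; apply: delVB.
rewrite big_split /= addrAC; apply: FV_D; first exact: (IH (f y) (fP y)).
apply: FV_sum => j; apply: FV_N; apply: FV_delV; exact: fP.
Qed.

(** In the intended case the leading terms of the coefficients are formal power series, dual to
    polynomials: [rho] is a derivation up to sign, being dual to multiplication, and [del j] is
    multiplication by a coordinate. Then this operator is contraction with the Euler field, as in
    the Poincare lemma. *)
Definition hom_op i (f : ML i.+1) : ML i := \sum_j delV j (f (e j) : ML i).

Lemma alt_hom i (f : ML i.+1) : alt f -> alt (hom_op f).
Proof.
case=> f1 _ _; apply: submod_sum (alt_submod i) _ => j _; exact: (alt_delV j (f1 (e j))).
Qed.

Lemma FV_hom i p (f : ML i.+1) : FV p f -> FV p.+1 (hom_op f).
Proof. by move=> fP; apply: FV_sum => j; apply: (@FV_delV i j p (f (e j)) (fP (e j))). Qed.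

Lemma dCE_sum i I (r : seq I) (f : I -> ML i) :
  dCE (\sum_(j <- r) f j) = \sum_(j <- r) dCE (f j).
Proof.
elim/big_rec2: _ => [|j u v _ <-]; first exact: dCE0.
by rewrite -[f j]scale1r dCE_linear !scale1r.
Qed.

(** Cartan's formula for the Euler field, up to terms of higher filtration: on closed forms [dCE]
    after the homotopy is minus the total degree, [p] from the coefficients and [i.+1] from the
    form. *)
Lemma dCE_hom i p (f : ML i.+1) : alt f -> dCE f = 0 -> FV p f ->
  FV p.+1 (dCE (hom_op f) + (p + i.+1)%:R *: f).
Proof.
move=> fP df fF.
have E1 : \sum_j delV j (lie (e j) f) = \sum_j delV j (dCE (f (e j) : ML i)).
  apply: eq_bigr => j _; congr delV.
  by have := congr1 (fun g => g (e j)) df => /= /subr0_eq.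
have := euler_lie fF; rewrite E1 => H1.
have H2 : FV p.+1 (\sum_j (dCE (delV j (f (e j) : ML i)) - delV j (dCE (f (e j) : ML i))
    + wedge (xi j) (f (e j) : ML i))).
  by apply: FV_sum => j; apply: (dCE_delV j (fF (e j))).
have E2 : \sum_j (dCE (delV j (f (e j) : ML i)) - delV j (dCE (f (e j) : ML i))
    + wedge (xi j) (f (e j) : ML i)) = dCE (hom_op f) -
    \sum_j delV j (dCE (f (e j) : ML i)) + i.+1%:R *: f.
  by rewrite !big_split /= sumrN wedge_contract // -dCE_sum.
rewrite E2 in H2.
have := FV_D H2 H1; set a := dCE _; set b := \sum_j _.
have zm (V : zmodType) (x y z t : V) : x - y + z + (y + t) = x + (t + z).
  by rewrite addrAC addrA subrK -addrA.
by rewrite zm -scalerDl -natrD.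
Qed.

Lemma FV_complete i (s : nat -> ML i) : (forall p, FV p.+1 (s p.+1 - s p)) ->
  exists f : ML i, forall p, FV p.+1 (f - s p).
Proof.
elim: i s => [|i IH] s sP; first exact: F_complete.
have /choice[f fP] : forall x, exists g : ML i, forall p, FV p.+1 (g - (s p x : ML i)).
  by move=> x; apply: IH => p; apply: sP.
by exists f => p x; apply: fP.
Qed.

Lemma alt_closed i (s : nat -> ML i) f : (forall p, alt (s p)) ->
  (forall p, FV p.+1 (f - s p)) -> alt f.
Proof.
elim: i s f => [|i IH] s f sP fs //; split=> [x|c x y|].
- have s1 p : alt (s p x : ML i) by have [h _ _] := sP p; apply: h.
  exact: (IH (fun p => s p x) (f x) s1 (fun p => fs p x)).
- apply/subr0_eq/FV_sep => p; apply: FV_le (leqnSn p) _.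
  have -> : f (c *: x + y) - (c%:A *: f x + f y) = (f - s p) (c *: x + y) -
      (c%:A *: (f - s p) x + (f - s p) y).
    change (f (c *: x + y) - (c%:A *: f x + f y) = f (c *: x + y) - s p (c *: x + y) -
      (c%:A *: (f x - s p x) + (f y - s p y))).
    rewrite (alt_lin _ _ _ (sP p)) scalerBr addrACA -opprD.
    have zm (V : zmodType) (a b c' : V) : a - b = a - c' - (b - c').
      by rewrite opprB subrKA.
    exact: zm.
  exact: (FV_B (fs p _) (FV_lin c (fs p x) (fs p y))).
case: i s f {IH} sP fs => [|i] s f sP fs // x.
apply/FV_sep => p; apply: FV_le (leqnSn p) _.
have -> : f x x = (f - s p) x x; last exact: fs.
by have [_ _ s3] := sP p; change (f x x = f x x - s p x x); rewrite s3 subr0.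
Qed.

(** The homotopy is right on leading terms only, so a primitive is approached by successive
    corrections, each pushing the error one step up the filtration. Completeness gives the limit,
    separation shows that it is a primitive. *)
Theorem dCE_exact i (f : ML i.+1) : alt f -> dCE f = 0 ->
  exists2 g : ML i, alt g & dCE g = f.
Proof.
move=> fP df.
(* Minus the inverse of the factor in [dCE_hom], which is nonzero even for [p = 0] because the form
   has positive degree. *)
pose c p : K := - ((p + i.+1)%:R)^-1.
pose step p (g : ML i) : ML i := g + (c p)%:A *: hom_op (f - dCE g).
pose s := fix s p : ML i := if p is p'.+1 then step p' (s p') else 0.
have sP p : alt (s p) /\ FV p (f - dCE (s p)).
  elim: p => [|p [sA sF]]; first by split; [case: (alt_submod i)|apply: FV_all].
  have rA : alt (f - dCE (s p)) by apply: submodB (alt_submod i.+1) _ _ => //; apply: alt_dCE.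
  have rd : dCE (f - dCE (s p)) = 0.
    by rewrite dCEB df dCE_dCE // subr0.
  split; first by apply: submodD (alt_submod i) _ _ => //; apply: submodZ (alt_submod i) _; apply: alt_hom.
  have := dCE_hom rA rd sF; set r := f - _ in rA rd sF * => H.
  have -> : f - dCE (s p.+1) = (- c p)%:A *: (dCE (hom_op r) + (p + i.+1)%:R *: r).
    have -> : dCE (s p.+1) = (c p)%:A *: dCE (hom_op r) + dCE (s p).
      by rewrite -dCE_linear addrC.
    rewrite opprD addrCA -/r scalerDr; congr (_ + _); first by rewrite !scaleNr.
    have -> : (p + i.+1)%:R = (p + i.+1)%:R%:A :> A by rewrite scaler_nat.
    rewrite opprK scalerA -scalerAl mul1r scalerA mulVf ?scale1r ?scale1r //.
  exact: FV_Z.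
have [p|g gP] := FV_complete (s := s).
  rewrite /= /step addrAC subrr add0r; apply: FV_Z; apply: FV_hom.
  by have [] := sP p.
have gA : alt g by apply: alt_closed gP => p; have [] := sP p.
exists g => //; apply/subr0_eq/FV_sep => p.
have -> : dCE g - f = dCE (g - s p) - (f - dCE (s p)).
  by rewrite dCEB opprB subrKA.
by apply: FV_B; [apply: FV_dCE|have [] := sP p].
Qed.

End Acyclicity.
End Coordinates.
End ChevalleyEilenberg.

(** * Almost commutative algebras and the PBW theorem *)

Local Notation mnm := multinom.
Local Notation "{ 'poly' K ; D }" := (mpoly D K) (at level 0, format "{ 'poly'  K ;  D }").
Local Notation "''XX_' j" := (mpolyX _ (mnm1 j)) (at level 8, j at level 2, format "''XX_' j").
Local Notation "p @^ m" := (mcoeff m p) (at level 3, format "p @^ m").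
Local Notation msize p := (@mmeasure _ _ (Measure.clone _ (@mdeg _) _) p).

Section Dickson.

(** Pick each time an index at which [u] attains its minimum over the remaining tail. *)
Lemma nondecreasing_subseq (u : nat -> nat) : exists phi : nat -> nat,
  (forall i, (phi i < phi i.+1)%N) /\ forall i, (u (phi i) <= u (phi i.+1))%N.
Proof.
have /choice[nx nxP] : forall i, exists j, (i <= j)%N /\ forall k, (i <= k)%N -> (u j <= u k)%N.
  move=> i; have [v [[j [le_ij uj]] vmin]] :
      exists v, (exists j, (i <= j)%N /\ u j = v) /\ forall k, (i <= k)%N -> (v <= u k)%N.
    have ex : exists v, `[< exists j, (i <= j)%N /\ u j = v >].
      by exists (u i); apply/asboolP; exists i.
    case: (ex_minnP ex) => v /asboolP vP vmin; exists v; split=> // k le_ik.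
    by apply: vmin; apply/asboolP; exists k.
  by exists j; split=> // k /vmin; rewrite uj.
pose phi := fix phi i := if i is i'.+1 then nx (phi i').+1 else nx 0%N.
exists phi; split=> i /=; have [le1 min1] := nxP (phi i).+1; first exact: le1.
case: i le1 min1 => [|i] le1 min1 /=.
  by have [_ h] := nxP 0%N; apply: h.
have [le2 min2] := nxP (phi i).+1; apply: min2.
exact: leq_trans (leq_trans le2 (leqnSn _)) le1.
Qed.

Lemma dickson_subseq n (a : nat -> mnm n) (js : seq 'I_n) : exists phi : nat -> nat,
  (forall i, (phi i < phi i.+1)%N) /\
  forall j, j \in js -> forall i, (a (phi i) j <= a (phi i.+1) j)%N.
Proof.
elim: js => [|j js [phi [phi_inc phiP]]]; first by exists id.
have [psi [psi_inc psiP]] := nondecreasing_subseq (fun i => a (phi i) j).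
exists (phi \o psi); split=> [i|l] /=.
  have phi_mono : {homo phi : x y / (x < y)%N} by apply: homo_ltn => //; apply: ltn_trans.
  exact: phi_mono.
rewrite inE => /predU1P[->//|ljs] i.
have mono : {homo (fun i => a (phi i) l) : x y / (x <= y)%N}.
  by apply: homo_leq => //; [apply: leq_trans|apply: phiP].
exact/mono/ltnW.
Qed.

(** A set without a finite basis yields a sequence in which no term dominates an earlier one; a
    subsequence nondecreasing in every coordinate contradicts this. *)
Lemma dickson n (E : mnm n -> Prop) : exists s : seq (mnm n),
  (forall m, m \in s -> E m) /\ forall m, E m -> exists2 b, b \in s & lem b m.
Proof.
apply: contrapT => nE.
have /choice[nx nxP] : forall s : seq (mnm n), exists m, (forall b, b \in s -> E b) ->
    E m /\ forall b, b \in s -> ~~ lem b m.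
  move=> s; have [sE|nsE] := pselect (forall b, b \in s -> E b); last by exists mnm0.
  apply: contrapT => nm; apply: nE; exists s; split=> // m Em.
  apply: contrapT => nb; apply: nm; exists m => _; split=> // b bs.
  by apply/negP => bm; apply: nb; exists b.
pose s := fix s k := if k is k'.+1 then nx (s k') :: s k' else [::].
have sE k b : b \in s k -> E b.
  elim: k b => [//|k IH] b /=; rewrite inE => /predU1P[->|/IH//].
  by have [] := nxP (s k) IH.
have s_in i k : (i < k)%N -> nx (s i) \in s k.
  elim: k => [//|k IH]; rewrite ltnS leq_eqVlt => /predU1P[->|/IH ik] /=.
    exact: mem_head.
  by rewrite inE ik orbT.
have [phi [phi_inc phiP]] := dickson_subseq (fun k => nx (s k)) (enum 'I_n).
have [_ /(_ _ (s_in _ _ (phi_inc 0%N)))/negP[]] := nxP (s (phi 1%N)) (@sE _).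
by apply/mnm_lepP => j; apply: phiP; rewrite mem_enum.
Qed.

End Dickson.

Fact ord_map_key : unit. Proof. exact: tt. Qed.

Section AlmostCommutative.
Variables (K : fieldType) (A : algType K) (D : nat) (x : 'I_D -> A).
Hypothesis x_comm : forall i j, exists c : 'I_D -> K, x i * x j - x j * x i = \sum_l c l *: x l.
Hypothesis x_gen : forall Q : A -> Prop, (forall c : K, Q c%:A) -> (forall j, Q (x j)) ->
  (forall u v, Q u -> Q v -> Q (u + v)) -> (forall u v, Q u -> Q v -> Q (u * v)) ->
  forall u, Q u.

(** Linear but not multiplicative: a monomial goes to the product of powers of the [x j] in
    increasing order of the indices. It is locked to keep it from being unfolded. *)
Definition ord_map (f : mpoly D K) : A := locked_with ord_map_key (mmap (in_alg A) x f).
Local Notation q := ord_map.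

Lemma ord_mapE f : q f = mmap (in_alg A) x f.
Proof. by rewrite /ord_map unlock. Qed.

Lemma ord_map_linear : linear q.
Proof. by move=> c f g; rewrite !ord_mapE mmapD mmapZ /= mulr_algl. Qed.
HB.instance Definition _ := GRing.isLinear.Build K (mpoly D K) A *:%R q ord_map_linear.

Lemma ord_map_sum I (r : seq I) (P : pred I) (F : I -> mpoly D K) :
  q (\sum_(i <- r | P i) F i) = \sum_(i <- r | P i) q (F i).
Proof. exact: (linear_sum (ord_map : {linear mpoly D K -> A})). Qed.

Lemma ord_mapZ c f : q (c *: f) = c *: q f.
Proof. exact: linearZ. Qed.

Lemma ord_mapD f g : q (f + g) = q f + q g.
Proof. exact: linearD. Qed.

Lemma ord_mapB f g : q (f - g) = q f - q g.
Proof. exact: linearB. Qed.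

Lemma ord_map0 : q 0 = 0.
Proof. exact: linear0. Qed.

(** [msize] exceeds the degree by one, so [fil p] is spanned by the ordered monomials of degree less
    than [p], and [fil 0] is zero. *)
Definition fil (p : nat) (u : A) : Prop := exists2 f : mpoly D K, (msize f <= p)%N & u = q f.

Lemma fil_lin p (c : K) u v : fil p u -> fil p v -> fil p (c *: u + v).
Proof.
move=> [f fp ->] [g gp ->]; exists (c *: f + g); last by rewrite linearP.
apply: leq_trans (msizeD_le _ _) _; rewrite geq_max gp andbT.
exact: leq_trans (msizeZ_le _ _) fp.
Qed.

Lemma fil0 p : fil p 0. Proof. by exists 0; rewrite ?msize0 ?ord_map0. Qed.

Lemma filD p u v : fil p u -> fil p v -> fil p (u + v).
Proof. by move=> up vp; rewrite -[u]scale1r; apply: fil_lin. Qed.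

Lemma filZ p (c : K) u : fil p u -> fil p (c *: u).
Proof. by move=> up; rewrite -[_ *: u]addr0; apply: fil_lin => //; apply: fil0. Qed.

Lemma filB p u v : fil p u -> fil p v -> fil p (u - v).
Proof. by move=> up vp; rewrite addrC -scaleN1r; apply: fil_lin. Qed.

Lemma fil_sum p I (r : seq I) (P : pred I) (F : I -> A) :
  (forall i, P i -> fil p (F i)) -> fil p (\sum_(i <- r | P i) F i).
Proof. by move=> FP; elim/big_ind: _ => //; [apply: fil0|apply: filD]. Qed.

Lemma fil_le p p' u : (p <= p')%N -> fil p u -> fil p' u.
Proof. by move=> le_pp' [f fp ->]; exists f => //; apply: leq_trans le_pp'. Qed.

Definition word (s : seq 'I_D) : A := \prod_(j <- s) x j.
Definition cnt (s : seq 'I_D) : mnm D := foldr (fun j m => mnm_add (mnm1 j) m) mnm0 s.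
Definition std (m : mnm D) : seq 'I_D := flatten [seq nseq (m j) j | j <- enum 'I_D].

Lemma cntE s j : cnt s j = count_mem j s.
Proof. by elim: s => [|l s IH] /=; rewrite ?mnm0E // mnmDE mnm1E IH. Qed.

Lemma mdeg_cnt s : mdeg (cnt s) = size s.
Proof. by elim: s => [|l s IH] /=; rewrite ?mdeg0 // mdegD mdeg1 IH add1n. Qed.

Lemma word_std m : q (mpolyX _ m) = word (std m).
Proof.
rewrite ord_mapE mmapX /mmap1 /word /std big_flatten big_map.
rewrite [index_enum _]unlock -enumT.
by apply: eq_bigr => j _; rewrite big_nseq iter_mulr_1.
Qed.

Lemma cnt_std m : cnt (std m) = m.
Proof.
apply/mnmP => j; rewrite cntE count_flatten -map_comp sumnE big_map big_enum /=.
rewrite (bigD1 j) //= big1 ?addn0 ?count_nseq /= ?eqxx ?mul1n // => l lj.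
by rewrite count_nseq /= (negPf lj).
Qed.

Lemma perm_std s : perm_eq s (std (cnt s)).
Proof. by apply/allP => j _ /=; rewrite -!cntE cnt_std. Qed.

Lemma word_cat s t : word (s ++ t) = word s * word t.
Proof. exact: big_cat. Qed.

Lemma word_cons j s : word (j :: s) = x j * word s.
Proof. exact: big_cons. Qed.

(** Exchanging two adjacent letters costs a commutator, a combination of words one letter shorter;
    those are in the filtration by induction on the length. *)
Lemma word_sort s : fil (size s) (word s - q (mpolyX _ (cnt s))).
Proof.
have [l] := ubnP (size s); elim: l s => // l IH s; rewrite ltnS => le_sl.
have IHf t : (size t < size s)%N -> fil (size s) (word t).
  move=> lt_ts; rewrite -[word t](subrK (q (mpolyX _ (cnt t)))).
  apply: filD; first by apply: fil_le (ltnW lt_ts) _; apply: IH; apply: leq_trans le_sl.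
  by exists (mpolyX _ (cnt t)) => //; rewrite msizeX mdeg_cnt.
have swap s1 s2 i j : (size s1 + size s2).+2 = size s ->
    fil (size s) (word (s1 ++ i :: j :: s2) - word (s1 ++ j :: i :: s2)).
  move=> sz; have [c cE] := x_comm i j.
  rewrite !word_cat !word_cons !mulrA -[_ * x i * x j]mulrA -[_ * x j * x i]mulrA.
  rewrite -mulrBl -mulrBr cE mulr_sumr mulr_suml; apply: fil_sum => k _.
  rewrite -scalerAr -scalerAl -mulrA -word_cons -word_cat; apply/filZ/IHf.
  by rewrite size_cat /= addnS -sz ltnS.
have move_in a p s1 s2 : (size p + size s1 + size s2).+1 = size s ->
    fil (size s) (word (p ++ a :: s1 ++ s2) - word (p ++ s1 ++ a :: s2)).
  elim: s1 p => [|b s1 IHs] p sz; first by rewrite subrr; apply: fil0.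
  rewrite -[word (p ++ a :: _)](subrK (word (p ++ b :: a :: s1 ++ s2))) -addrA.
  apply: filD; first by apply: swap; rewrite size_cat addnA -sz /= addnS.
  have := IHs (rcons p b); rewrite !cat_rcons; apply.
  by rewrite size_rcons -sz /= addnS.
have permP p s1 t : perm_eq s1 t -> (size p + size s1)%N = size s ->
    fil (size s) (word (p ++ s1) - word (p ++ t)).
  elim: s1 p t => [|a s1 IHs] p t st sz.
    by move: st; rewrite perm_sym => /perm_nilP ->; rewrite subrr; apply: fil0.
  have at_ : a \in t by rewrite -(perm_mem st) mem_head.
  case/splitPr: t / at_ st => t1 t2 st.
  rewrite -[word (p ++ a :: s1)](subrK (word (p ++ a :: t1 ++ t2))) -addrA.
  have st' : perm_eq s1 (t1 ++ t2).
    by rewrite -(perm_cons a) (perm_trans st) // perm_catC /= perm_cons perm_catC.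
  apply: filD; last first.
    apply: move_in; rewrite -sz /= -addnA addnS; congr (_ + _).+1.
    by rewrite (perm_size st') size_cat.
  by have := IHs (rcons p a) _ st'; rewrite !cat_rcons; apply; rewrite size_rcons -sz addSnnS.
rewrite word_std; apply: (permP [::]) => //; exact: perm_std.
Qed.

Lemma mul_ord_map j f : fil (msize f) (x j * q f - q ('XX_j * f)).
Proof.
have -> : x j * q f - q ('XX_j * f) = \sum_(m <- msupp f)
    (x j * q (f@^m *: mpolyX _ m) - q ('XX_j * (f@^m *: mpolyX _ m))).
  transitivity (x j * q (\sum_(m <- msupp f) f@^m *: mpolyX _ m) -
      q ('XX_j * \sum_(m <- msupp f) f@^m *: mpolyX _ m)); first by rewrite -mpolyE.
  by rewrite mulr_sumr !ord_map_sum mulr_sumr -sumrB.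
rewrite big_seq_cond; apply: fil_sum => m; rewrite andbT => mf.
rewrite -scalerAr !ord_mapZ -scalerAr -scalerBr; apply: filZ.
rewrite word_std -word_cons -mpolyXD.
have := word_sort (j :: std m); rewrite /= cnt_std; apply: fil_le.
by rewrite -mdeg_cnt cnt_std; apply: msize_mdeg_lt.
Qed.

Lemma ord_map_surj u : exists f, u = q f.
Proof.
suff H : forall v, (exists g, v = q g) -> exists f, u * v = q f.
  rewrite -[u]mulr1; apply: H; exists (mpolyX _ mnm0).
  by rewrite word_std /std /word -[RHS]/(word _) -word_std ord_mapE mmapX mmap11.
elim/x_gen: u => [c|j|u v Hu Hv|u v Hu Hv] w wP.
- by have [g ->] := wP; exists (c *: g); rewrite mulr_algl ord_mapZ.
- have [g ->] := wP; have [f _ fE] := mul_ord_map j g.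
  by exists (f + 'XX_j * g); rewrite ord_mapD -fE subrK.
- have [f fE] := Hu _ wP; have [g gE] := Hv _ wP.
  by exists (f + g); rewrite mulrDl fE gE ord_mapD.
- by rewrite -mulrA; apply/Hu/Hv.
Qed.

(** A Groebner basis argument in place of the associated graded ring: left multiplication by [x j]
    shifts leading exponents as for polynomials, Dickson's lemma yields finitely many minimal
    leading exponents of [I], and multiples of the corresponding elements cancel the leading term of
    any element of [I]. *)
Lemma almost_comm_noeth : noeth_ring A.
Proof.
move=> I [I0 IP].
pose E (m : mnm D) := exists f, [/\ f != 0, mlead f = m & I (q f)].
have mulX j f : f != 0 -> exists g, [/\ g != 0, mlead g = mnm_add (mnm1 j) (mlead f) &
    q g = x j * q f].
  move=> nzf; have [r rf rE] := mul_ord_map j f.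
  have nzX : mpolyX K (mnm1 j) != 0 :> mpoly D K.
    by rewrite -msize_poly_eq0 msizeX.
  have leadX : mlead ('XX_j * f) = mnm_add (mnm1 j) (mlead f).
    by rewrite mleadM // mleadXm.
  have lead_g : mlead (r + 'XX_j * f) = mnm_add (mnm1 j) (mlead f).
    have [->|nzr] := eqVneq r 0; first by rewrite add0r.
    rewrite mleadDr // leadX; apply: lt_mdeg_ltmc.
    by rewrite mdegD mdeg1 add1n ltnS -ltnS mlead_deg // mlead_deg.
  exists (r + 'XX_j * f); split=> //; last by rewrite ord_mapD -rE subrK.
  apply/eqP => g0; have := congr1 (@mdeg D) lead_g.
  by rewrite g0 mlead0 mdeg0 mdegD mdeg1.
have mulXs k f : f != 0 -> exists g, [/\ g != 0, mlead g = mnm_add k (mlead f) &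
    exists a, q g = a * q f].
  move=> nzf; rewrite -[k]cnt_std; elim: (std k) => [|j s [g [nzg lg [a gE]]]] /=.
    by exists f; split=> //; [apply/mnmP => i; rewrite mnmDE mnm0E|exists 1; rewrite mul1r].
  have [h [nzh lh hE]] := mulX j g nzg; exists h; split=> //.
    by rewrite lh lg; apply/mnmP => i; rewrite !mnmDE addnA.
  by exists (x j * a); rewrite hE gE mulrA.
have [B [BE BP]] := dickson E.
have /choice[g gP] : forall m, exists f, m \in B -> [/\ f != 0, mlead f = m & I (q f)].
  move=> m; have [/BE[f fP]|] := boolP (m \in B); first by exists f.
  by exists 0.
pose s : seq A^o := [seq q (g b) | b <- B].
exists s; split=> [_ /mapP[b /gP[_ _ ?] ->] //|u Iu].
have [f fE] := ord_map_surj u; rewrite {}fE in Iu *.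
elim/mleadrect: f Iu => f IH If.
have [->|nzf] := eqVneq f 0; first by rewrite ord_map0; case: (spnP s).
have [b bB bf] := BP (mlead f) (ex_intro _ f (And3 nzf erefl If)).
have [nzgb lgb Igb] := gP b bB.
have [h [nzh lh [a hE]]] := mulXs (mnm_sub (mlead f) b) (g b) nzgb.
rewrite lgb in lh; have {}lh : mlead h = mlead f by rewrite lh submK.
pose c := f@^(mlead f) / h@^(mlead f).
have nzc : h@^(mlead f) != 0 by rewrite -lh mleadc_eq0.
have sh : spn s (q h : A^o).
  rewrite hE; apply: (@submodZ A A^o _ a _ (spnP s)); apply: spn_mem.
  exact: map_f.
have Ih : I (q h) by rewrite hE -[_ * _]addr0; apply: IP.
have sZ : spn s (q (c *: h) : A^o).
  by rewrite ord_mapZ -mulr_algl; apply: (@submodZ A A^o _ (c%:A) _ (spnP s)).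
rewrite -[f](subrK (c *: h)) ord_mapD; apply: (submodD (spnP s)) => //.
have [->|nz] := eqVneq (f - c *: h) 0; first by rewrite ord_map0; case: (spnP s).
apply: IH.
  have le1 : (mlead (f - c *: h) <= mlead f)%O.
    apply: Order.POrderTheory.le_trans (mleadB_le _ _) _.
    rewrite Order.JoinTheory.leUx Order.POrderTheory.lexx /= -lh; exact: mleadZ_le.
  rewrite Order.POrderTheory.lt_neqAle le1 andbT; apply/eqP => lE.
  move: nz; rewrite -mleadc_eq0 lE mcoeffB mcoeffZ divfK ?subrr ?eqxx //.
by rewrite ord_mapB ord_mapZ addrC -mulr_algl -mulNr; apply: IP.
Qed.

End AlmostCommutative.

(** * The PBW theorem for gl_n *)

Section PBW.
Variables (K : fieldType) (n D : nat) (b : 'I_D -> 'M[K]_n) (xi : 'I_D -> 'M[K]_n -> K).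
Hypotheses (xi_lin : forall j c x y, xi j (c *: x + y) = c * xi j x + xi j y)
  (coordE : forall x, x = \sum_j xi j x *: b j)
  (xi_b : forall j l, xi j (b l) = (j == l)%:R).
Local Notation P := (mpoly D K).
Local Notation U := (Ugl K n).
Local Notation gen := (env_gen (@mx_bracket K n)).
Local Notation q := (ord_map (fun j => gen (b j))).

Definition lin (y : 'M[K]_n) : P := \sum_j xi j y *: 'XX_j.

Lemma lin_linear c x y : lin (c *: x + y) = c *: lin x + lin y.
Proof.
rewrite /lin scaler_sumr -big_split /=; apply: eq_bigr => j _.
by rewrite xi_lin scalerDl scalerA.
Qed.

Lemma linB x y : lin (x - y) = lin x - lin y.
Proof. by rewrite addrC -scaleN1r lin_linear scaleN1r addrC. Qed.

Lemma lin_b j : lin (b j) = 'XX_j.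
Proof.
rewrite /lin (bigD1 j) //= big1 ?addr0 ?xi_b ?eqxx ?scale1r // => l lj.
by rewrite xi_b (negPf lj) scale0r.
Qed.

(* The derivation of P extending left multiplication by y. *)
Definition der (y : 'M[K]_n) (p : P) : P := \sum_j lin (y *m b j) * mderiv j p.

(** The associative product of matrices makes this a representation of gl_n:
    [der x (lin y) - der y (lin x)] is [lin] of the bracket, the operators of multiplication
    commute, and [der] respects brackets. *)
Definition gl_act (y : 'M[K]_n) (p : P) : P := lin y * p + der y p.

Lemma derD y p r : der y (p + r) = der y p + der y r.
Proof.
by rewrite /der -big_split; apply: eq_bigr => j _ /=; rewrite mderivD mulrDr.
Qed.

Lemma derZ y c p : der y (c *: p) = c *: der y p.
Proof.
by rewrite /der scaler_sumr; apply: eq_bigr => j _; rewrite mderivZ scalerAr.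
Qed.

Lemma derM y p r : der y (p * r) = der y p * r + p * der y r.
Proof.
rewrite /der mulr_suml mulr_sumr -big_split; apply: eq_bigr => j _ /=.
by rewrite mderivM; ring.
Qed.

Lemma der_sum y I (s : seq I) (F : I -> P) :
  der y (\sum_(i <- s) F i) = \sum_(i <- s) der y (F i).
Proof.
elim/big_rec2: _ => [|i u v _ <-]; last by rewrite derD.
by rewrite /der big1 // => j _; rewrite mderiv0 mulr0.
Qed.

Lemma der_lin y x : der y (lin x) = lin (y *m x).
Proof.
have E z : lin (y *m z) = \sum_j xi j z *: lin (y *m b j).
  rewrite {1}(coordE z) mulmx_sumr.
  elim/big_rec2: _ => [|j u v _ <-].
    by rewrite /lin big1 // => j _; have := xi_lin j (-1) 0 0;
      rewrite scaler0 addr0 mulN1r addNr => ->; rewrite scale0r.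
  by rewrite -scalemxAr lin_linear.
rewrite E /lin der_sum; apply: eq_bigr => j _; rewrite derZ; congr (_ *: _).
rewrite /der (bigD1 j) //= big1 ?addr0.
  have -> : mderiv j 'XX_j = 1 :> P.
    rewrite mderivX mnm1E eqxx scale1r -[RHS]mpolyX0; congr (mpolyX _ _).
    by apply/mnmP => i; rewrite mnmBE subnn mnm0E.
  by rewrite mulr1.
by move=> l lj; rewrite mderivX mnm1E eq_sym (negPf lj) scale0r mulr0.
Qed.

Lemma der_comm x y p : der x (der y p) - der y (der x p) = der (mx_bracket x y) p.
Proof.
have E u v : der u (der v p) = der (u *m v) p +
    \sum_j \sum_l lin (v *m b j) * (lin (u *m b l) * mderiv l (mderiv j p)).
  rewrite {2}/der der_sum -big_split /=; apply: eq_bigr => j _.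
  rewrite derM der_lin mulmxA; congr (_ + _).
  by rewrite /der mulr_sumr.
rewrite !E [X in _ + X - _]exchange_big /=.
set A := \sum_j _; set B := \sum_j _.
have -> : A = B.
  apply: eq_bigr => j _; apply: eq_bigr => l _.
  by rewrite mulrCA mderiv_comm.
rewrite opprD addrACA subrr addr0 /der -sumrB; apply: eq_bigr => j _.
by rewrite -mulrBl -linB /mx_bracket mulmxBl.
Qed.

Lemma gl_act_br x y p :
  gl_act x (gl_act y p) = gl_act y (gl_act x p) + gl_act (mx_bracket x y) p.
Proof.
have E u v : gl_act u (gl_act v p) =
   (lin u * lin v * p + (lin u * der v p + lin v * der u p)) + (lin (u *m v) * p + der u (der v p)).
  rewrite /gl_act derD derM der_lin mulrDr mulrA -!addrA; congr (_ + (_ + _)).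
  by rewrite addrCA.
rewrite !E [gl_act (mx_bracket x y) p]/gl_act -der_comm /mx_bracket linB; ring.
Qed.

Fixpoint ev (t : env_term K 'M[K]_n) (p : P) : P :=
  match t with
  | EGen y => gl_act y p
  | EConst a => a *: p
  | EAdd s t => ev s p + ev t p
  | EMul s t => ev s (ev t p)
  end.

Lemma ev_linear t c p r : ev t (c *: p + r) = c *: ev t p + ev t r.
Proof.
elim: t p r => [y|a|s IHs t IHt|s IHs t IHt] p r /=.
- by rewrite /gl_act derD derZ mulrDr -scalerAr scalerDr addrACA.
- by rewrite scalerDr !scalerA mulrC.
- by rewrite IHs IHt scalerDr addrACA.
- by rewrite IHt IHs.
Qed.

Lemma ev_eq s t : env_eq (@mx_bracket K n) s t -> forall p, ev s p = ev t p.
Proof.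
have evD u p r : ev u (p + r) = ev u p + ev u r.
  by rewrite -[p]scale1r ev_linear !scale1r.
have evZ u c p : ev u (c *: p) = c *: ev u p.
  have := ev_linear u c p 0; rewrite addr0 => ->.
  have := ev_linear u (-1) 0 0; rewrite scaler0 addr0 scaleN1r addNr => ->.
  by rewrite addr0.
elim=> {s t} /=.
- by [].
- by move=> s t _ IH p.
- by move=> s t u _ IH1 _ IH2 p; rewrite IH1.
- by move=> s s' t t' _ IH1 _ IH2 p; rewrite IH1 IH2.
- by move=> s s' t t' _ IH1 _ IH2 p; rewrite IH2 IH1.
- by move=> s t u p; rewrite addrA.
- by move=> s t p; rewrite addrC.
- by move=> t p; rewrite scale0r add0r.
- by move=> t p; rewrite scaleN1r addNr scale0r.
- by [].
- by move=> t p; rewrite scale1r.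
- by [].
- by move=> s t u p; rewrite evD.
- by move=> a c p; rewrite scalerDl.
- by move=> a c p; rewrite scalerA.
- by move=> a t p; rewrite evZ.
- move=> x y p; rewrite /gl_act -[x in lin (x + _)]scale1r lin_linear scale1r mulrDl.
  rewrite addrACA; congr (_ + _); rewrite /der -big_split; apply: eq_bigr => j _ /=.
  by rewrite mulmxDl -[x *m _]scale1r lin_linear !scale1r mulrDl.
- move=> a x p; have linZ z : lin (a *: z) = a *: lin z.
    have := lin_linear a z 0; rewrite addr0 => ->.
    have := lin_linear (-1) 0 0; rewrite scaler0 addr0 scaleN1r addNr => ->.
    by rewrite addr0.
  rewrite /gl_act linZ scalerDr scalerAl; congr (_ + _).
  by rewrite /der scaler_sumr; apply: eq_bigr => j _; rewrite -scalemxAl linZ scalerAl.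
- by move=> x y p; rewrite gl_act_br.
Qed.

Lemma gen_lin c x y : gen (c *: x + y) = c *: gen x + gen y.
Proof. by have [-> _] := env_gen_lie_hom (@mx_bracket K n). Qed.

Lemma gen_br x y : gen (mx_bracket x y) = gen x * gen y - gen y * gen x.
Proof. by have [_ ->] := env_gen_lie_hom (@mx_bracket K n). Qed.

Lemma gen0 : gen 0 = 0.
Proof. by have := gen_lin (-1) 0 0; rewrite scaler0 addr0 scaleN1r addNr. Qed.

Lemma gen_coord x : gen x = \sum_j xi j x *: gen (b j).
Proof.
rewrite {1}(coordE x); elim/big_rec2: _ => [|j u v _ <-]; first exact: gen0.
by rewrite gen_lin.
Qed.

Lemma U_comm i j : exists c : 'I_D -> K,
  gen (b i) * gen (b j) - gen (b j) * gen (b i) = \sum_l c l *: gen (b l).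
Proof. by exists (fun l => xi l (mx_bracket (b i) (b j))); rewrite -gen_coord gen_br. Qed.

Lemma U_ind (Q : U -> Prop) : (forall c : K, Q c%:A) -> (forall j, Q (gen (b j))) ->
  (forall u v, Q u -> Q v -> Q (u + v)) -> (forall u v, Q u -> Q v -> Q (u * v)) ->
  forall u, Q u.
Proof.
move=> QC Qg QD QM; elim/env_ind; elim=> [y|a|s IHs t IHt|s IHs t IHt].
- rewrite -[env_class _ _]/(gen y) gen_coord; elim/big_ind: _ => // [|j _].
    by rewrite -(scale0r 1); apply: QC.
  by rewrite -mulr_algl; apply: QM.
- by rewrite env_classC.
- by rewrite env_classD; apply: QD.
- by rewrite env_classM; apply: QM.
Qed.

Definition symbol (u : U) : P := ev (repr u) 1.

Lemma symbolE t : symbol (env_class (@mx_bracket K n) t) = ev t 1.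
Proof. by apply: ev_eq; apply: env_reprK. Qed.

Lemma symbol_linear : linear symbol.
Proof.
move=> c; elim/env_ind=> s; elim/env_ind=> t.
by rewrite -mulr_algl -env_classC -env_classM -env_classD !symbolE.
Qed.
HB.instance Definition _ := GRing.isLinear.Build K U P *:%R symbol symbol_linear.

Lemma symbol_gen y u : symbol (gen y * u) = gl_act y (symbol u).
Proof. by elim/env_ind: u => t; rewrite -env_classM !symbolE. Qed.

Lemma symbol1 : symbol 1 = 1.
Proof. by rewrite -[1 in LHS]scale1r -env_classC symbolE /= scale1r. Qed.

Lemma msizeD_leq (p r : P) k : (msize p <= k)%N -> (msize r <= k)%N -> (msize (p + r) <= k)%N.
Proof. by move=> pk rk; apply: leq_trans (msizeD_le _ _) _; rewrite geq_max pk. Qed.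

Lemma msize_sum_leq I (s : seq I) (Q : pred I) (F : I -> P) k :
  (forall i, Q i -> (msize (F i) <= k)%N) -> (msize (\sum_(i <- s | Q i) F i) <= k)%N.
Proof.
by move=> Fk; elim/big_ind: _ => //; [rewrite msize0|move=> *; apply: msizeD_leq].
Qed.

Lemma msize_mderiv j (p : P) k : (msize p <= k.+1)%N -> (msize (mderiv j p) <= k)%N.
Proof.
move=> pk; rewrite msizeE; apply/bigmax_leqP_seq => m mp _.
rewrite -ltnS; apply: leq_trans pk.
rewrite mcoeff_msupp mcoeff_deriv in mp.
have : mnm_add m (mnm1 j) \in msupp p.
  by rewrite mcoeff_msupp; apply: contra mp => /eqP ->; rewrite mul0rn.
by move/msize_mdeg_lt; rewrite mdegD mdeg1 addn1.
Qed.

Lemma msize_linM y (p : P) k : (msize p <= k)%N -> (msize (lin y * p) <= k.+1)%N.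
Proof.
move=> pk; have ly : (msize (lin y) <= 2)%N.
  apply: msize_sum_leq => j _; apply: leq_trans (msizeZ_le _ _) _.
  by rewrite msizeX mdeg1.
have [->|nzp] := eqVneq p 0; first by rewrite mulr0 msize0.
have [->|nzy] := eqVneq (lin y) 0; first by rewrite mul0r msize0.
rewrite msizeM // -ltnS prednK; last by rewrite addn_gt0 lt0n msize_poly_eq0 nzy.
exact: leq_trans (leq_add ly pk) _.
Qed.

Lemma msize_der y (p : P) k : (msize p <= k)%N -> (msize (der y p) <= k)%N.
Proof.
case: k => [|k] pk.
  move: pk; rewrite leqn0 msize_poly_eq0 => /eqP ->.
  by rewrite /der big1 ?msize0 // => j _; rewrite mderiv0 mulr0.
by apply: msize_sum_leq => j _; apply/msize_linM/msize_mderiv.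
Qed.

(** Only the summand [lin y * p] of [gl_act y p] raises the degree. *)
Lemma symbol_word s :
  (msize (symbol (word (fun j => gen (b j)) s) - mpolyX _ (cnt s)) <= size s)%N.
Proof.
elim: s => [|j s IH].
  by rewrite /word big_nil symbol1 /= mpolyX0 subrr msize0.
rewrite word_cons symbol_gen /gl_act lin_b /=.
set p := symbol _ in IH *; rewrite mpolyXD.
have -> : 'XX_j * p + der (b j) p - 'XX_j * mpolyX K (cnt s) =
    'XX_j * (p - mpolyX K (cnt s)) + der (b j) p by ring.
apply: msizeD_leq; first by rewrite -lin_b; apply: msize_linM.
apply: msize_der; rewrite -[p](subrK (mpolyX K (cnt s))).
apply: msizeD_leq; first exact: leq_trans IH (leqnSn _).
by rewrite msizeX mdeg_cnt.
Qed.

(** [symbol] recovers [f] from [q f] up to lower degree, so a nonzero [f] cannot be sent to 0. *)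
Lemma pbw_inj f : q f = 0 -> f = 0.
Proof.
move=> qf; apply/eqP; rewrite -msize_poly_eq0; apply/eqP.
have H : (msize (symbol (q f) - f) < msize f)%N || (f == 0).
  case: eqVneq => [->|nzf]; first by rewrite orbT.
  rewrite orbF; have sz : (0 < msize f)%N by rewrite lt0n msize_poly_eq0.
  have -> : symbol (q f) - f = \sum_(m <- msupp f) f@^m *: (symbol (q (mpolyX _ m)) - mpolyX _ m).
    transitivity (symbol (q (\sum_(m <- msupp f) f@^m *: mpolyX _ m)) -
       \sum_(m <- msupp f) f@^m *: mpolyX _ m); first by rewrite -mpolyE.
    rewrite ord_map_sum linear_sum -sumrB; apply: eq_bigr => m _.
    by rewrite ord_mapZ linearZ scalerBr.
  rewrite -(prednK sz) ltnS big_seq_cond; apply: msize_sum_leq => m.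
  rewrite andbT => mf; apply: leq_trans (msizeZ_le _ _) _.
  rewrite word_std -{2}[m]cnt_std; apply: leq_trans (symbol_word _) _.
  by rewrite -mdeg_cnt cnt_std -ltnS (prednK sz); apply: msize_mdeg_lt.
case/orP: H => [|/eqP->]; last exact: msize0.
by rewrite qf linear0 sub0r msizeN ltnn.
Qed.

Definition pbw_coord (u : U) : P := projT1 (cid (ord_map_surj U_comm U_ind u)).

Lemma pbw_coordK u : q (pbw_coord u) = u.
Proof. by rewrite /pbw_coord; case: cid. Qed.

Lemma ord_mapK f : pbw_coord (q f) = f.
Proof. by apply/subr0_eq/pbw_inj; rewrite ord_mapB pbw_coordK subrr. Qed.

Lemma pbw_coord_linear : linear pbw_coord.
Proof. by move=> c u v; rewrite -{1}[u]pbw_coordK -{1}[v]pbw_coordK -ord_mapZ -ord_mapD ord_mapK. Qed.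
HB.instance Definition _ := GRing.isLinear.Build K U P *:%R pbw_coord pbw_coord_linear.

Lemma mon_extend (N : lmodType K) (h : multinom D -> N) :
  exists F : {linear P -> N}, forall m, F (mpolyX _ m) = h m.
Proof.
pose F (p : P) := \sum_(m <- msupp p) p@^m *: h m.
(* Over a finite index set that does not depend on the polynomial the sum is visibly linear. *)
have FE k p : (msize p <= k)%N -> F p = \sum_(m : bmultinom D k) p@^m *: h m.
  move=> le_pk; rewrite /F (big_mksub (bmultinom D k)) ?msupp_uniq //=; last first.
    by move=> x /msize_mdeg_lt /leq_trans; apply.
  rewrite big_rmcond //= => j /memN_msupp_eq0 ->.
  by rewrite scale0r.
have Flin : linear F.
  move=> c p r; pose k := maxn (msize p) (msize r).
  have pk : (msize p <= k)%N by exact: leq_maxl.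
  have rk : (msize r <= k)%N by exact: leq_maxr.
  rewrite !(FE k) //; last first.
    by apply: msizeD_leq => //; apply: leq_trans (msizeZ_le _ _) _.
  rewrite scaler_sumr -big_split; apply: eq_bigr => m _ /=.
  by rewrite mcoeffD mcoeffZ scalerDl scalerA.
exists (mk_linear Flin) => m /=.
by rewrite /F msuppX big_seq1 mcoeffX eqxx scale1r.
Qed.

Lemma pbw_extend (N : lmodType K) (h : multinom D -> N) :
  exists F : {linear U -> N}, forall m, F (q (mpolyX _ m)) = h m.
Proof.
have [F FE] := mon_extend h; exists (F \o pbw_coord) => m.
by rewrite /= ord_mapK.
Qed.

Lemma pbw_ext (N : lmodType K) (F G : {linear U -> N}) :
  (forall m, F (q (mpolyX _ m)) = G (q (mpolyX _ m))) -> F =1 G.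
Proof.
move=> FG u; rewrite -[u]pbw_coordK [pbw_coord u]mpolyE ord_map_sum !linear_sum.
by apply: eq_bigr => m _; rewrite ord_mapZ !linearZ FG.
Qed.

End PBW.

Lemma baer_field (K : fieldType) (J : lmodType K) : baer (fun _ : J => True).
Proof.
move=> I f [I0 IP] f_lin _.
have [[c Ic nzc]|nI] := pselect (exists2 c, I c & c != 0).
  exists (c^-1 *: f c) => // a Ia.
  have := f_lin (a / c) c 0 Ic I0.
  have f0 : f 0 = 0 by have := f_lin (-1) 0 0 I0 I0; rewrite mulr0 addr0 scaleN1r addNr.
  by rewrite addr0 divfK // f0 addr0 => ->; rewrite scalerA.
exists 0 => // a Ia; rewrite scaler0.
have [->|nza] := eqVneq a 0; last by case: nI; exists a.
by have := f_lin (-1) 0 0 I0 I0; rewrite mulr0 addr0 scaleN1r addNr.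
Qed.

Lemma dual_basis (K : fieldType) (V : vectType K) (D : nat) (X : D.-tuple V) :
  basis_of fullv X -> exists xi : 'I_D -> V -> K,
  [/\ forall j c x y, xi j (c *: x + y) = c * xi j x + xi j y,
      forall x, x = \sum_j xi j x *: tnth X j & forall j l, xi j (tnth X l) = (j == l)%:R].
Proof.
move=> bX; exists (fun j => coord X j); split=> [j c x y|x|j l].
- by rewrite linearP.
- rewrite {1}(coord_basis bX (memvf x)); apply: eq_bigr => j _.
  by rewrite (tnth_nth 0).
- by rewrite (tnth_nth 0) (coord_free _ _ (basis_free bX)) eq_sym.
Qed.

(** * U(gl_n) as a module over U(gl_k) *)

Section Corner.
Variables (K : fieldType) (k n : nat).
Hypothesis le_kn : (k <= n)%N.
Local Notation genk := (env_gen (@mx_bracket K k)).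
Local Notation genn := (env_gen (@mx_bracket K n)).

Lemma corner_props : [/\ linear (@Ugl_corner K k n), @Ugl_corner K k n 1 = 1,
   {morph @Ugl_corner K k n : u v / u * v} &
   forall x, @Ugl_corner K k n (genk x) = genn (gl_corner n x)].
Proof. by have [] := env_lift_universal (@gl_corner_lie_hom K k n le_kn). Qed.

Lemma corner_linear : linear (@Ugl_corner K k n).
Proof. by case: corner_props. Qed.

Fact corner_zmod : zmod_morphism (@Ugl_corner K k n).
Proof. by move=> u v; rewrite addrC -scaleN1r corner_linear scaleN1r addrC. Qed.

Fact corner_monoid : monoid_morphism (@Ugl_corner K k n).
Proof. by case: corner_props. Qed.

Definition corner : {rmorphism Ugl K k -> Ugl K n} :=
  HB.pack (@Ugl_corner K k n)
    (GRing.isZmodMorphism.Build _ _ _ corner_zmod)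
    (GRing.isMonoidMorphism.Build _ _ _ corner_monoid).

Lemma corner_gen x : corner (genk x) = genn (gl_corner n x).
Proof. by have [_ _ _ h] := corner_props; exact: h. Qed.

Lemma cornerZ (c : K) u : corner (c *: u) = c *: corner u.
Proof.
have c0 : Ugl_corner n (0 : Ugl K k) = 0 := rmorph0 corner.
by have := corner_linear c u 0; rewrite c0 !addr0.
Qed.

Lemma corner_alg (c : K) : corner c%:A = c%:A.
Proof. by rewrite cornerZ rmorph1. Qed.

Lemma gl_corner_linear : linear (@gl_corner K k n).
Proof.
by move=> a x y; rewrite /gl_corner mulmxDr mulmxDl -scalemxAr -scalemxAl.
Qed.

Lemma gl_corner_inj x : gl_corner n x = 0 -> x = 0 :> 'M[K]_k.
Proof.
have E : (pid_mx k : 'M[K]_(k, n)) *m pid_mx k = 1%:M by rewrite pid_mx_id // pid_mx_1.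
move=> /(congr1 (fun y => (pid_mx k : 'M_(k, n)) *m y *m (pid_mx k : 'M_(n, k)))); rewrite /= mulmx0 mul0mx.
by rewrite /gl_corner !mulmxA E mul1mx -mulmxA E mulmx1.
Qed.

(** The complement of the corner comes first, so an ordered monomial is a monomial in the complement
    followed by the image of an ordered monomial of U(gl_k). *)
Lemma corner_basis : exists (a c : nat) (bk : c.-tuple 'M[K]_k) (bn : (a + c).-tuple 'M[K]_n),
  [/\ basis_of fullv bk, basis_of fullv bn &
      forall j, tnth bn (rshift a j) = gl_corner n (tnth bk j)].
Proof.
pose f : 'Hom('M[K]_k, 'M[K]_n) := linfun (mk_linear gl_corner_linear).
have fE x : f x = gl_corner n x by rewrite lfunE.
pose X := vbasis (fullv : {vspace 'M[K]_k}).
pose W := (f @: fullv)%VS.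
have bX : basis_of fullv X := vbasisP _.
have kf : (fullv :&: lker f = 0)%VS.
  apply/eqP; rewrite -subv0; apply/subvP => x; rewrite memv_cap memv_ker fE memv0 => /andP[_ /eqP/gl_corner_inj ->].
  by rewrite eqxx.
have bW : basis_of W (map f X) by apply: limg_basis_of.
pose Y := vbasis (W^C)%VS.
have bY : basis_of (W^C)%VS Y := vbasisP _.
have dir : directv (W^C + W).
  by apply/directv_addP; rewrite capvC capv_compl.
have bn : basis_of fullv (Y ++ map f X).
  have -> : fullv = (W^C + W)%VS by rewrite addvC addv_complf.
  exact: cat_basis.
exists _, _, X, (cat_tuple Y (map_tuple f X)); split=> // j.
by rewrite tnth_rshift tnth_map fE.
Qed.

(* U(gl_n) is free as a right U(gl_k)-module. *)
Theorem corner_free : exists (T : Type) (w : T -> Ugl K n),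
  (forall (N : lmodType K) (g : T -> {linear Ugl K k -> N}),
     exists F : {linear Ugl K n -> N}, forall t u, F (w t * corner u) = g t u) /\
  (forall (N : lmodType K) (F G : {linear Ugl K n -> N}),
     (forall t u, F (w t * corner u) = G (w t * corner u)) -> F =1 G).
Proof.
have [a [c [bk [bn [bkP bnP bnk]]]]] := corner_basis.
have [xik [xik_lin coordk xik_b]] := dual_basis bkP.
have [xin [xin_lin coordn xin_b]] := dual_basis bnP.
pose qk := ord_map (fun j => genk (tnth bk j)).
pose qn := ord_map (fun j => genn (tnth bn j)).
pose w (m : multinom a) : Ugl K n := \prod_(i < a) genn (tnth bn (lshift c i)) ^+ m i.
pose ml (m : multinom (a + c)) : multinom a := Multinom [tuple m (lshift c i) | i < a].
pose mr (m : multinom (a + c)) : multinom c := Multinom [tuple m (rshift a i) | i < c].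
pose join (m1 : multinom a) (m2 : multinom c) : multinom (a + c) :=
  Multinom [tuple match fintype.split i with inl i1 => m1 i1 | inr i2 => m2 i2 end | i < a + c].
have qnE m : qn (mpolyX K m) = w (ml m) * corner (qk (mpolyX K (mr m))).
  rewrite /qn /qk !ord_mapE !mmapX /mmap1 big_split_ord rmorph_prod; congr (_ * _).
    by apply: eq_bigr => i _; rewrite mnmE.
  by apply: eq_bigr => i _; rewrite rmorphXn corner_gen -bnk mnmE.
have mlj m1 m2 : ml (join m1 m2) = m1.
  by apply/mnmP => i; rewrite !mnmE -[lshift c i]/(unsplit (inl i)) unsplitK.
have mrj m1 m2 : mr (join m1 m2) = m2.
  by apply/mnmP => i; rewrite !mnmE -[rshift a i]/(unsplit (inr i)) unsplitK.
exists (multinom a), w; split=> [N g|N F G FG].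
  have [F FE] := pbw_extend xin_lin coordn xin_b (fun m => g (ml m) (qk (mpolyX K (mr m)))).
  exists F => t u.
  have Hlin : linear (fun u => F (w t * corner u)).
    by move=> d x y; rewrite [corner _]corner_linear mulrDr -scalerAr linearP.
  suff H : mk_linear Hlin =1 g t by exact: (H u).
  apply: (pbw_ext coordk) => m.
  by have := FE (join t m); rewrite -/(qn _) qnE mlj mrj.
apply: (pbw_ext coordn) => m.
by rewrite -/(qn _) qnE FG.
Qed.

(** By freeness, sending [y * corner v] to [y *: f v] for [v] in [I] is well defined on the left
    ideal generated by the image of [I], and Baer's criterion over U(gl_n) applies there. *)
Lemma baer_restrict (E : lmodType (Ugl K n)) (R : E -> Prop) : submod R ->
  baer R -> @baer _ (resm corner E) R.
Proof.
move=> RP Rb I f [I0 IP] f_lin fR.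
have [T [w [wF wE]]] := corner_free.
pose N : lmodType K := resm (in_alg (Ugl K n)) E.
have Isub : @submod K (Ugl K k) I.
  by split=> // c u v Iu Iv; rewrite -mulr_algl; apply: IP.
(* A [K]-linear extension of [f] beyond [I], so that [F] can be prescribed on a whole free module;
   on products with elements of [I] the choice disappears. *)
have [||ft [ftE _]] := @baer_extend K (Ugl K k) N I (fun=> True) f Isub (@submodT _ _) (@baer_field _ _).
- move=> c u v Iu Iv; rewrite -mulr_algl f_lin //.
  change (corner c%:A *: (f u : E) + f v = c%:A *: (f u : E) + f v).
  by rewrite corner_alg.
- by [].
have glin t : linear (fun u => w t *: (ft u : E) : N).
  move=> c u v; rewrite linearP; change (w t *: (c%:A *: (ft u : E) + (ft v : E)) = c%:A *: (w t *: (ft u : E)) + w t *: (ft v : E)).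
  by rewrite scalerDr !scalerA mulr_algl mulr_algr.
have [F FE] := wF N (fun t => mk_linear (glin t)).
have FI y v : I v -> F (y * corner v) = y *: (f v : E).
  move=> Iv.
  have H1 : linear (fun y => F (y * corner v)).
    by move=> c x z; rewrite mulrDl -scalerAl linearP.
  have H2 : linear (fun y => y *: (f v : E) : N).
    by move=> c x z; rewrite scalerDl -mulr_algl -scalerA.
  suff H : mk_linear H1 =1 mk_linear H2 by exact: (H y).
  apply: wE => t u.
  change (F (w t * corner u * corner v) = (w t * corner u) *: (f v : E)).
  rewrite -mulrA -rmorphM FE; change (w t *: (ft (u * v) : E) = (w t * corner u) *: (f v : E)).
  rewrite ftE; last by rewrite -[u * v]addr0; apply: IP.
  rewrite -scalerA; congr (_ *: _).
  by have := f_lin u v 0 Iv I0; rewrite addr0 -[f 0]ftE // linear0 addr0.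
(* The left ideal generated by the image of [I], as an intersection: to prove something on it,
   exhibit a left ideal such as [L0]. *)
pose I' (y : Ugl K n) := forall L : Ugl K n -> Prop, left_ideal L ->
  (forall v, I v -> L (corner v)) -> L y.
have I'P : left_ideal I'.
  split=> [L [L0 _] //|x y z Iy Iz L LP LI].
  by apply LP.2; [apply: Iy|apply: Iz].
have F1 v : I v -> F (corner v) = f v by move=> Iv; rewrite -[corner v]mul1r FI // scale1r.
pose L0 y := (forall x, F (x * y) = x *: (F y : E)) /\ R (F y).
have L0P : left_ideal L0.
  split=> [|x y z [yE Ry] [zE Rz]].
    by split=> [x|]; rewrite ?mulr0 linear0 ?scaler0 //; case: RP.
  split=> [u|]; last by rewrite linearD yE; apply: (RP.2).
  by rewrite mulrDr !linearD mulrA !yE zE scalerDr scalerA.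
have L0I v : I v -> L0 (corner v).
  by move=> Iv; split=> [x|]; rewrite F1 ?FI //; apply: fR.
have [|y Iy|e Re eE] := Rb I' F I'P.
- move=> x y z /(_ L0 L0P L0I)[yE _] _; by rewrite linearD yE.
- by have [] := Iy L0 L0P L0I.
by exists e => // v Iv; rewrite -F1 // eE // => L _ LI; apply: LI.
Qed.

End Corner.

(** * Unitary families and the centers *)

Section HermitianMatrices.
Variable C : numClosedFieldType.
Local Notation "A ^*t" := (map_mx Num.conj A^T) (at level 2, format "A ^*t").

Lemma adjM m p r (A : 'M[C]_(m, p)) (B : 'M[C]_(p, r)) : (A *m B)^*t = B^*t *m A^*t.
Proof. by rewrite trmx_mul map_mxM. Qed.

Lemma adjB m p (A B : 'M[C]_(m, p)) : (A - B)^*t = A^*t - B^*t.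
Proof. by apply/matrixP => i j; rewrite !mxE rmorphB. Qed.

Lemma row_norm0 m (v : 'rV[C]_m) : v *m v^*t = 0 -> v = 0.
Proof.
move=> /matrixP/(_ ord0 ord0); rewrite !mxE => E.
apply/rowP => j; rewrite mxE; apply/eqP; rewrite -Num.Theory.normr_eq0 -sqrf_eq0; apply/eqP.
have /Num.Theory.psumr_eq0P : \sum_j `|v ord0 j| ^+ 2 = 0.
  by rewrite -[RHS]E; apply: eq_bigr => k _; rewrite !mxE Num.Theory.normCK.
by apply=> // k _; rewrite Num.Theory.exprn_ge0.
Qed.

Lemma mx_norm0 p m (v : 'M[C]_(p, m)) : v *m v^*t = 0 -> v = 0.
Proof.
move=> E; apply/row_matrixP => i; rewrite row0; apply: row_norm0.
have := congr1 (fun M => (delta_mx 0 i : 'rV[C]_p) *m M *m (delta_mx 0 i : 'rV[C]_p)^*t) E.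
by rewrite /= mulmx0 mul0mx mulmxA -rowE -mulmxA -adjM -rowE.
Qed.

(** Orthogonal projection to the row space of [S]. The normal equations are solvable because
    positivity gives the Gram matrix of the rows the same rank as [S]. *)
Lemma ortho_decomp p m (S : 'M[C]_(p, m)) (f : 'rV[C]_m) :
  exists u : 'rV_p, (f - u *m S) *m S^*t = 0.
Proof.
have kerE : (kermx (S *m S^*t) <= kermx S)%MS.
  apply/sub_kermxP/mx_norm0; rewrite adjM -mulmxA (mulmxA S).
  by rewrite mulmxA mulmx_ker mul0mx.
have rkE : \rank (S *m S^*t) = \rank S.
  apply/eqP; rewrite eqn_leq mxrankM_maxl /=.
  by have := mxrankS kerE; rewrite !mxrank_ker; have := rank_leq_row S;
     have := rank_leq_row (S *m S^*t); lia.
have sub : (S^*t <= S *m S^*t)%MS.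
  have := mxrank_leqif_sup (submxMl S S^*t).
  by case=> _ <-; rewrite rkE mxrank_map mxrank_tr.
have /submxP[u uE] : (f *m S^*t <= S *m S^*t)%MS by apply: submx_trans (submxMl _ _) sub.
by exists u; rewrite mulmxBl uE mulmxA subrr.
Qed.

(** Take a matrix of maximal rank whose row space lies in [Q]. *)
Lemma subspace_mx m (Q : 'rV[C]_m -> Prop) : submod Q ->
  exists S : 'M[C]_m, forall v, Q v <-> (v <= S)%MS.
Proof.
move=> QP; pose good r := `[< exists S : 'M[C]_m, \rank S = r /\ forall v, (v <= S)%MS -> Q v >].
have ex : exists r, good r.
  exists 0%N; apply/asboolP; exists 0; split; first exact: mxrank0.
  by move=> v; rewrite submx0 => /eqP ->; case: QP.
have ub r : good r -> (r <= m)%N by move=> /asboolP[S [<- _]]; apply: rank_leq_row.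
have [r /asboolP[S [rS SQ]] rmax] := ex_maxnP ex ub.
exists S => v; split=> [Qv|/SQ//]; apply/negPn/negP => nv.
have : good (\rank (S + v)%MS).
  apply/asboolP; exists (S + v)%MS; split=> // w /sub_addsmxP[[u1 u2] /= ->].
  apply: submodD => //; first by apply: SQ; apply: submxMl.
  by rewrite [u2]mx11_scalar mul_scalar_mx; apply: submodZ.
move=> /rmax; rewrite -rS => le.
have /leq_trans/(_ le) : (\rank S < \rank (S + v)%MS)%N.
  rewrite (ltn_leqif (mxrank_leqif_sup (addsmxSl S v))).
  by apply: contra nv => /(submx_trans (addsmxSr S v)).
by rewrite ltnn.
Qed.

Section UnitaryFamilies.
Variables (k : nat) (H : lmodType C) (X : 'I_k -> 'I_k -> H -> H).
Hypothesis X_lin : forall i j, linear (X i j).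

(* A finite family spanning an X-stable space on which X j i acts by the
   conjugate transpose of the matrix of X i j. *)
Definition ufam (I : finType) (h : I -> H) (r : 'I_k -> 'I_k -> I -> I -> C) : Prop :=
  (forall i j a, X i j (h a) = \sum_b r i j a b *: h b) /\
  forall i j a b, r j i a b = Num.conj (r i j b a).

Definition inspan (I : finType) (h : I -> H) (y : H) : Prop :=
  exists c : I -> C, y = \sum_a c a *: h a.

(** No independence of the family is asked: its span is a linear image of a unitary representation
    on row vectors, and sums and tensor products of families need no choice of bases. *)
Definition ufin (y : H) : Prop :=
  exists (I : finType) (h : I -> H) (r : 'I_k -> 'I_k -> I -> I -> C), ufam h r /\ inspan h y.

Lemma inspan_submod (I : finType) (h : I -> H) : submod (inspan h).
Proof.
split=> [|a _ _ [c ->] [d ->]]; first by exists (fun=> 0); rewrite big1 // => i _; rewrite scale0r.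
exists (fun i => a * c i + d i); rewrite scaler_sumr -big_split; apply: eq_bigr => i _ /=.
by rewrite scalerDl scalerA.
Qed.

Lemma inspan_mem (I : finType) (h : I -> H) a : inspan h (h a).
Proof.
exists (fun b => (b == a)%:R); rewrite (bigD1 a) //= big1 ?addr0 ?eqxx ?scale1r // => b ba.
by rewrite (negPf ba) scale0r.
Qed.

Lemma ufam_sum (I J : finType) h r h' r' : @ufam I h r -> @ufam J h' r' ->
  exists (s : (I + J)%type -> H) t, [/\ ufam s t, forall y, inspan h y -> inspan s y
    & forall y, inspan h' y -> inspan s y].
Proof.
move=> [hX hc] [hX' hc'].
pose s (a : I + J) := match a with inl a => h a | inr a => h' a end.
pose t i j (a b : I + J) := match a, b with inl a, inl b => r i j a b | inr a, inr b => r' i j a b | _, _ => 0 end.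
exists s, t; split.
- split=> [i j [a|a]|i j [a|a] [b|b]] /=; rewrite ?rmorph0 ?big_sumType //=.
    rewrite hX [X in _ = _ + X]big1 ?addr0 // => b _; exact: scale0r.
  rewrite hX' [X in _ = X + _]big1 ?add0r // => b _; exact: scale0r.
- move=> _ [c ->]; apply: submod_sum (inspan_submod s) _ => a _.
  by apply: submodZ (inspan_submod s) _; apply: (inspan_mem s (inl a)).
- move=> _ [c ->]; apply: submod_sum (inspan_submod s) _ => a _.
  by apply: submodZ (inspan_submod s) _; apply: (inspan_mem s (inr a)).
Qed.

Lemma ufam_common (J : eqType) (z : J -> H) (l : seq J) : (forall j, ufin (z j)) ->
  exists (I : finType) h r, @ufam I h r /\ forall j, j \in l -> inspan h (z j).
Proof.
move=> zu; elim: l => [|j l [I [h [r [hr hl]]]]].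
  by exists void, (fun=> 0), (fun _ _ _ _ => 0); split=> //; split; case.
have [I' [h' [r' [hr' hj]]]] := zu j.
have [s [t [st sh sh']]] := ufam_sum hr hr'.
exists (I + I')%type, s, t; split=> // i; rewrite inE => /predU1P[->|/hl]; auto.
Qed.

Lemma ufinD y z : ufin y -> ufin z -> ufin (y + z).
Proof.
move=> [I [h [r [hr hy]]]] [I' [h' [r' [hr' hz]]]].
have [s [t [st sh sh']]] := ufam_sum hr hr'.
by exists (I + I')%type, s, t; split=> //; apply: submodD (inspan_submod s) _ _; auto.
Qed.

Section Matrices.
Variables (I : finType) (h : I -> H) (r : 'I_k -> 'I_k -> I -> I -> C).
Hypothesis hr : ufam h r.
Let m := #|I|.
Let evl (v : 'rV[C]_m) : H := \sum_a v 0 a *: h (enum_val a).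
Let R i j : 'M[C]_m := \matrix_(a, b) r i j (enum_val a) (enum_val b).

Let evl_lin : linear evl.
Proof.
move=> c u v; rewrite /evl scaler_sumr -big_split; apply: eq_bigr => a _ /=.
by rewrite !mxE scalerDl scalerA.
Qed.

Let evl_sum (T : Type) (s : seq T) (P : pred T) (F : T -> 'rV[C]_m) :
  evl (\sum_(t <- s | P t) F t) = \sum_(t <- s | P t) evl (F t).
Proof. exact: (linear_sum (mk_linear evl_lin)). Qed.

Let evl0 : evl 0 = 0. Proof. exact: (linear0 (mk_linear evl_lin)). Qed.
Let evlD u v : evl (u + v) = evl u + evl v. Proof. exact: (linearD (mk_linear evl_lin)). Qed.
Let evlB u v : evl (u - v) = evl u - evl v. Proof. exact: (linearB (mk_linear evl_lin)). Qed.

Let X_sum i j (T : Type) (s : seq T) (P : pred T) (F : T -> H) :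
  X i j (\sum_(t <- s | P t) F t) = \sum_(t <- s | P t) X i j (F t).
Proof. exact: (linear_sum (mk_linear (X_lin i j))). Qed.

Let X_Z i j c y : X i j (c *: y) = c *: X i j y.
Proof. exact: (linearZ_LR (mk_linear (X_lin i j))). Qed.

Let evlR i j v : evl (v *m R i j) = X i j (evl v).
Proof.
rewrite /evl X_sum.
transitivity (\sum_b \sum_a (v 0 a * R i j a b) *: h (enum_val b)).
  by apply: eq_bigr => b _; rewrite mxE scaler_suml.
rewrite exchange_big; apply: eq_bigr => a _ /=.
rewrite X_Z hr.1 scaler_sumr.
rewrite (reindex (fun b : 'I_m => enum_val b)) /=; last exact/onW_bij/enum_val_bij.
by apply: eq_bigr => b _; rewrite mxE scalerA.
Qed.

Let R_adj i j : R j i = (R i j)^*t.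
Proof. by apply/matrixP => a b; rewrite !mxE hr.2. Qed.

Let evl_onto y : inspan h y -> exists v, y = evl v.
Proof.
move=> [c ->]; exists (\row_a c (enum_val a)); rewrite /evl.
rewrite (reindex (fun b : 'I_m => enum_val b)) /=; last exact/onW_bij/enum_val_bij.
by apply: eq_bigr => a _; rewrite mxE.
Qed.

(** On row vectors, the orthogonal complement of the sum of the images of the [R i j] is the common
    kernel of their adjoints, which are the [R j i]. *)
Lemma reynolds_fam y : inspan h y -> exists y0 (z : 'I_k -> 'I_k -> H),
  (forall i j, X i j y0 = 0) /\ y = y0 + \sum_i \sum_j X i j (z i j).
Proof.
move=> /evl_onto[f ->].
pose Q v := exists c : 'I_k -> 'I_k -> 'rV[C]_m, v = \sum_i \sum_j c i j *m R i j.
have QP : submod Q.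
  split=> [|a _ _ [c ->] [d ->]].
    by exists (fun _ _ => 0); rewrite big1 // => i _; rewrite big1 // => j _; rewrite mul0mx.
  exists (fun i j => a *: c i j + d i j).
  rewrite scaler_sumr -big_split; apply: eq_bigr => i _ /=.
  rewrite scaler_sumr -big_split; apply: eq_bigr => j _ /=.
  by rewrite mulmxDl scalemxAl.
have [S SE] := subspace_mx QP.
have [u uS] := ortho_decomp S f.
have RS i j : (R i j <= S)%MS.
  apply/row_subP => a; apply/SE; exists (fun i' j' => if (i' == i) && (j' == j) then delta_mx 0 a else 0).
  rewrite (bigD1 i) //= (bigD1 j) //= !eqxx /= -rowE.
  rewrite big1 ?addr0 => [|j' /negPf ->]; last by rewrite mul0mx.
  rewrite big1 ?addr0 // => i' /negPf ->; rewrite big1 // => j' _; exact: mul0mx.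
have [c cE] : Q (u *m S) by apply/SE; apply: submxMl.
exists (evl (f - u *m S)), (fun i j => evl (c i j)); split.
  move=> i j; rewrite -evlR; have /submxP[B BE] := RS j i.
  rewrite R_adj BE adjM mulmxA uS mul0mx.
  exact: evl0.
transitivity (evl (f - u *m S) + evl (u *m S)).
  by rewrite -evlD subrK.
congr (_ + _); rewrite cE evl_sum; apply: eq_bigr => i _.
by rewrite evl_sum; apply: eq_bigr => j _; apply: evlR.
Qed.

(** Since the family may be dependent, a row vector over an invariant need not be invariant. The
    component [g] of [f] orthogonal to the kernel of [evl] is: [g *m R i j] lies in that kernel and
    in its orthogonal complement. Then [g] is orthogonal to all images, hence to itself. *)
Lemma invariant_fam (z : 'I_k -> 'I_k -> H) : (forall i j, inspan h (z i j)) ->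
  let y := \sum_i \sum_j X i j (z i j) in (forall i j, X i j y = 0) -> y = 0.
Proof.
move=> zh y y0.
have /choice[c cE] : forall ij : 'I_k * 'I_k, exists v, z ij.1 ij.2 = evl v by move=> ij; apply: evl_onto.
pose f := \sum_i \sum_j c (i, j) *m R i j.
have fE : evl f = y.
  rewrite evl_sum; apply: eq_bigr => i _.
  rewrite evl_sum; apply: eq_bigr => j _.
  by rewrite [LHS]evlR -(cE (i, j)).
have QP : submod (fun v => evl v = 0).
  split=> [|a u v u0 v0]; first exact: evl0.
  by rewrite evl_lin u0 v0 scaler0 addr0.
have [S SE] := subspace_mx QP.
have [u uS] := ortho_decomp S f.
set g := f - u *m S in uS.
have gE : evl g = y.
  rewrite evlB fE.
  have -> : evl (u *m S) = 0 by apply/SE; apply: submxMl.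
  by rewrite subr0.
have gR i j : g *m R i j = 0.
  have : evl (g *m R i j) = 0 by rewrite evlR gE y0.
  move=> /SE/submxP[t tE]; apply: row_norm0.
  rewrite {2}tE adjM mulmxA.
  have /submxP[B BE] : (S *m R j i <= S)%MS.
    apply/row_subP => a; apply/SE; rewrite row_mul evlR.
    have -> : evl (row a S) = 0 by apply/SE; apply: row_sub.
    exact: (linear0 (mk_linear (X_lin j i))).
  by rewrite (R_adj j i) -(mulmxA g) -adjM BE adjM mulmxA uS !mul0mx.
have g0 : g = 0.
  apply: row_norm0; rewrite {2}/g adjB adjM mulmxBr mulmxA uS mul0mx subr0.
  have -> : f^*t = \sum_i \sum_j (c (i, j) *m R i j)^*t.
    rewrite linear_sum map_mx_sum; apply: eq_bigr => i _.
    by rewrite linear_sum map_mx_sum.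
  rewrite mulmx_sumr big1 // => i _; rewrite mulmx_sumr big1 // => j _.
  by rewrite adjM -R_adj mulmxA gR mul0mx.
by rewrite -gE g0; apply: evl0.
Qed.

End Matrices.

Lemma reynolds y : ufin y -> exists y0 (z : 'I_k -> 'I_k -> H),
  (forall i j, X i j y0 = 0) /\ y = y0 + \sum_i \sum_j X i j (z i j).
Proof. by move=> [I [h [r [hr hy]]]]; apply: reynolds_fam hr _ hy. Qed.

Lemma invariant_image (z : 'I_k -> 'I_k -> H) : (forall i j, ufin (z i j)) ->
  let y := \sum_i \sum_j X i j (z i j) in (forall i j, X i j y = 0) -> y = 0.
Proof.
move=> zu.
have [I [h [r [hr hz]]]] := @ufam_common _ (fun ij => z ij.1 ij.2) (enum {: 'I_k * 'I_k}) (fun ij => zu _ _).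
apply: (invariant_fam hr) => i j.
by apply: (hz (i, j)); rewrite mem_enum.
Qed.

End UnitaryFamilies.
End HermitianMatrices.

(** * Unitarity of the adjoint action *)

Section AdjointAction.
Variables (C : numClosedFieldType) (k n : nat) (x : 'I_k -> 'I_k -> 'M[C]_n).
Local Notation U := (Ugl C n).
Local Notation gen := (env_gen (@mx_bracket C n)).
Local Notation I := ('I_n * 'I_n)%type.
Hypothesis x_adj : forall i j, x j i = map_mx Num.conj (x i j)^T.

Definition adg i j (u : U) : U := gen (x i j) * u - u * gen (x i j).
Definition elem (a : I) : 'M[C]_n := delta_mx a.1 a.2.
Definition adm i j (a b : I) : C := mx_bracket (x i j) (elem a) b.1 b.2.

Lemma adg_linear i j : linear (adg i j).
Proof.
move=> c u v; rewrite /adg mulrDr mulrDl opprD addrACA -scalerAr -scalerAl -scalerBr.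
by [].
Qed.

Lemma adg_sum i j J (s : seq J) (F : J -> U) :
  adg i j (\sum_(t <- s) F t) = \sum_(t <- s) adg i j (F t).
Proof. exact: (linear_sum (mk_linear (adg_linear i j))). Qed.

Lemma adgM i j u v : adg i j (u * v) = adg i j u * v + u * adg i j v.
Proof. by rewrite /adg mulrBl mulrBr !mulrA addrA subrK. Qed.

Lemma mx_elem (y : 'M[C]_n) : y = \sum_a y a.1 a.2 *: elem a.
Proof. by rewrite {1}[y]matrix_sum_delta pair_bigA. Qed.

Lemma gen_elem y : gen y = \sum_a y a.1 a.2 *: gen (elem a).
Proof.
rewrite {1}(mx_elem y).
elim/big_rec2: _ => [|a u v _ <-]; last by rewrite gen_lin.
by have := gen_lin (K := C) (-1) (0 : 'M[C]_n) 0; rewrite scaler0 addr0 scaleN1r addNr.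
Qed.

Lemma adg_elem i j a : adg i j (gen (elem a)) = \sum_b adm i j a b *: gen (elem b).
Proof. by rewrite /adg -gen_br gen_elem. Qed.

Lemma adm_conj i j a b : adm j i a b = Num.conj (adm i j b a).
Proof.
have E y (a' b' : I) : mx_bracket y (elem a') b'.1 b'.2 =
    y b'.1 a'.1 * (a'.2 == b'.2)%:R - (a'.1 == b'.1)%:R * y a'.2 b'.2.
  rewrite /mx_bracket !mxE; congr (_ - _).
    rewrite (bigD1 a'.1) //= mxE eqxx /= big1 ?addr0 1?eq_sym // => l /negPf la.
    by rewrite mxE la /= mulr0.
  rewrite (bigD1 a'.2) //= mxE eqxx andbT big1 ?addr0 1?eq_sym // => l /negPf la.
  by rewrite mxE la andbF mul0r.
rewrite /adm !E x_adj !mxE rmorphB !rmorphM !rmorph_nat.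
by rewrite (eq_sym a.2) (eq_sym a.1).
Qed.

(** By induction on expressions: elementary matrices form a unitary family by [adm_conj], and a
    product is handled by the tensor product of two families. *)
Lemma adg_ufin u : ufin adg u.
Proof.
elim/env_ind: u; elim=> [y|c|s IHs t IHt|s IHs t IHt].
- exists I, (fun a => gen (elem a)), adm; split; last first.
    by exists (fun a => y a.1 a.2); rewrite -gen_elem.
  by split=> [i j a|i j a b]; [apply: adg_elem|apply: adm_conj].
- exists unit, (fun=> 1), (fun _ _ _ _ => 0); split; last first.
    by exists (fun=> c); rewrite env_classC big_const card_unit /= addr0.
  split=> [i j _|*]; last by rewrite rmorph0.
  by rewrite /adg mulr1 mul1r subrr big1 // => b _; rewrite scale0r.
- by rewrite env_classD; apply: ufinD.
rewrite env_classM.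
have [J [h [r [[hX hc] [c ->]]]]] := IHs; have [J' [h' [r' [[hX' hc'] [c' ->]]]]] := IHt.
exists (J * J')%type, (fun a => h a.1 * h' a.2),
  (fun i j a b => r i j a.1 b.1 * (a.2 == b.2)%:R + (a.1 == b.1)%:R * r' i j a.2 b.2).
split; last first.
  exists (fun a => c a.1 * c' a.2); rewrite mulr_suml -(pair_bigA _ (fun a b => (c a * c' b) *: (h a * h' b))) /=.
  apply: eq_bigr => a _; rewrite mulr_sumr; apply: eq_bigr => b _.
  by rewrite -scalerAl -scalerAr scalerA.
split=> [i j [a a'] /=|i j [a a'] [b b'] /=]; last first.
  by rewrite rmorphD !rmorphM !rmorph_nat hc hc' (eq_sym a') (eq_sym a).
rewrite adgM hX hX'.
rewrite -(pair_bigA _ (fun b b' => (r i j a b * (a' == b')%:R + (a == b)%:R * r' i j a' b') *: (h b * h' b'))) /=.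
rewrite [RHS](eq_bigr (fun b => \sum_b' ((r i j a b * (a' == b')%:R) *: (h b * h' b')) +
   \sum_b' (((a == b)%:R * r' i j a' b') *: (h b * h' b')))); last first.
  by move=> b _; rewrite -big_split; apply: eq_bigr => b' _; rewrite scalerDl.
rewrite big_split /=; congr (_ + _).
  rewrite mulr_suml; apply: eq_bigr => b _.
  rewrite (bigD1 a') //= eqxx mulr1 big1 ?addr0 -?scalerAl // => b' /negPf ba.
  by rewrite eq_sym ba mulr0 scale0r.
rewrite [RHS](bigD1 a) //= [X in _ = _ + X]big1 ?addr0 => [|b /negPf ba].
  by rewrite mulr_sumr; apply: eq_bigr => b' _; rewrite eqxx mul1r scalerAr.
by apply: big1 => b' _; rewrite eq_sym ba mul0r scale0r.
Qed.

(* The action on Hom(gl_n, U), in coordinates. *)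
Definition adh i j (h : I -> U) : I -> U :=
  fun a => adg i j (h a) - \sum_b adm i j a b *: h b.

Lemma adh_linear i j : linear (adh i j).
Proof.
move=> c h h'; apply: funext => a; rewrite /adh.
change (adg i j (c *: h a + h' a) - \sum_b adm i j a b *: (c *: h b + h' b) =
  c *: (adg i j (h a) - \sum_b adm i j a b *: h b) + (adg i j (h' a) - \sum_b adm i j a b *: h' b)).
rewrite adg_linear [c *: (adg i j (h a) - _)]scalerBr scaler_sumr addrACA -opprD -big_split; congr (_ - _).
by apply: eq_bigr => b _; rewrite scalerDr !scalerA mulrC.
Qed.

Lemma adh_sum i j J (s : seq J) (F : J -> I -> U) :
  adh i j (\sum_(t <- s) F t) = \sum_(t <- s) adh i j (F t).
Proof. exact: (linear_sum (mk_linear (adh_linear i j))). Qed.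

Lemma adhB i j (f g : I -> U) : adh i j (f - g) = adh i j f - adh i j g.
Proof. exact: (linearB (mk_linear (adh_linear i j))). Qed.

Definition inj (a : I) (u : U) : I -> U := fun b => if b == a then u else 0.

Lemma inj_sum (h : I -> U) : h = \sum_a inj a (h a).
Proof.
apply: funext => b.
have -> : (\sum_a inj a (h a)) b = \sum_a inj a (h a) b.
  by elim/big_rec2: _ => // a u v _ <-.
by rewrite (bigD1 b) //= /inj eqxx big1 ?addr0 // => a /negPf ab; rewrite eq_sym ab.
Qed.

Lemma inj_linear a : linear (inj a).
Proof.
move=> c u v; apply: funext => b; rewrite /inj.
change ((if b == a then c *: u + v else 0) = c *: (if b == a then u else 0) + (if b == a then v else 0)).
by case: eqP => // _; rewrite scaler0 addr0.
Qed.

Lemma inj_big a J (s : seq J) (F : J -> U) : inj a (\sum_(t <- s) F t) = \sum_(t <- s) inj a (F t).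
Proof. exact: (linear_sum (mk_linear (inj_linear a))). Qed.

Lemma injZ a (c : C) u : inj a (c *: u) = c *: inj a u.
Proof. exact: (linearZ_LR (mk_linear (inj_linear a))). Qed.

Lemma adh_inj i j a u : adh i j (inj a u) = inj a (adg i j u) - \sum_b adm i j b a *: inj b u.
Proof.
apply: funext => c.
have -> : (inj a (adg i j u) - \sum_b adm i j b a *: inj b u) c =
    inj a (adg i j u) c - \sum_b adm i j b a *: inj b u c.
  change (inj a (adg i j u) c - (\sum_b adm i j b a *: inj b u) c = inj a (adg i j u) c - \sum_b adm i j b a *: inj b u c).
  by congr (_ - _); elim/big_rec2: _ => // b v w _ <-.
rewrite /adh; congr (_ - _).
  rewrite /inj; case: eqP => // _.
  by rewrite /adg mulr0 mul0r subrr.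
rewrite (bigD1 a) //= [RHS](bigD1 c) //= /inj !eqxx !big1 ?addr0 // => b /negPf ba.
  by rewrite eq_sym ba scaler0.
by rewrite ba scaler0.
Qed.

(** Hom(gl_n, U) is the tensor product of U with the dual of gl_n, and the dual of a unitary family
    is again unitary. *)
Lemma adh_ufin h : ufin adh h.
Proof.
have inj_ufin a u : ufin adh (inj a u).
  have [J [f [r [[fX fc] [c ->]]]]] := adg_ufin u.
  exists (I * J)%type, (fun p => inj p.1 (f p.2)),
    (fun i j p q => (p.1 == q.1)%:R * r i j p.2 q.2 - (p.2 == q.2)%:R * adm i j q.1 p.1).
  split; last first.
    exists (fun p => (p.1 == a)%:R * c p.2).
    rewrite -(pair_bigA _ (fun b t => ((b == a)%:R * c t) *: inj b (f t))) /=.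
    rewrite [RHS](bigD1 a) //= [X in _ = _ + X]big1 ?addr0 => [|b /negPf ba].
      rewrite inj_big; apply: eq_bigr => t _.
      by rewrite injZ eqxx mul1r.
    by apply: big1 => t _; rewrite ba mul0r scale0r.
  split=> [i j [b t] /=|i j [b t] [b' t'] /=]; last first.
    by rewrite rmorphB !rmorphM !rmorph_nat fc (adm_conj i j) (eq_sym b') (eq_sym t').
  rewrite adh_inj fX.
  rewrite -(pair_bigA _ (fun b' t' => ((b == b')%:R * r i j t t' - (t == t')%:R * adm i j b' b) *: inj b' (f t'))) /=.
  rewrite [RHS](eq_bigr (fun b' => \sum_t' (((b == b')%:R * r i j t t') *: inj b' (f t')) -
     \sum_t' (((t == t')%:R * adm i j b' b) *: inj b' (f t')))); last first.
    by move=> b' _; rewrite -sumrB; apply: eq_bigr => t' _; rewrite scalerBl.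
  rewrite sumrB; congr (_ - _).
    rewrite [RHS](bigD1 b) //= [X in _ = _ + X]big1 ?addr0 => [|b' /negPf ba].
      rewrite inj_big; apply: eq_bigr => t' _.
      by rewrite injZ eqxx mul1r.
    by apply: big1 => t' _; rewrite eq_sym ba mul0r scale0r.
  apply: eq_bigr => b' _; rewrite (bigD1 t) //= eqxx mul1r big1 ?addr0 // => t' /negPf ba.
  by rewrite eq_sym ba mul0r scale0r.
rewrite (inj_sum h); elim/big_ind: _ => // [|u v]; last exact: ufinD.
exists void, (fun=> 0), (fun _ _ _ _ => 0); split; first by split=> // i j [].
by exists (fun=> 0); rewrite big1 // => -[].
Qed.

End AdjointAction.

(** The opposite algebra, so that right noetherianity of U becomes left noetherianity of its
    opposite. *)
HB.instance Definition _ (K : fieldType) (A : algType K) := GRing.Lmodule.on (A^c)%type.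
HB.instance Definition _ (K : fieldType) (A : algType K) :=
  GRing.Lmodule_isLalgebra.Build K (A^c)%type (fun a (u v : A) => scalerAr a v u).
HB.instance Definition _ (K : fieldType) (A : algType K) :=
  GRing.Lalgebra_isAlgebra.Build K (A^c)%type (fun a (u v : A) => scalerAl a v u).

Section Noetherian.
Variables (K : fieldType) (n : nat).
Local Notation U := (Ugl K n).
Local Notation gen := (env_gen (@mx_bracket K n)).

Lemma Ugl_basis : exists (D : nat) (b : 'I_D -> 'M[K]_n) (xi : 'I_D -> 'M[K]_n -> K),
  [/\ D = \dim {: 'M[K]_n},
      forall j c x y, xi j (c *: x + y) = c * xi j x + xi j y,
      forall x, x = \sum_j xi j x *: b j & forall j l, xi j (b l) = (j == l)%:R].
Proof.
have [xi [h1 h2 h3]] := dual_basis (vbasisP {: 'M[K]_n}).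
by exists _, (tnth (vbasis {: 'M[K]_n})), xi.
Qed.

Lemma Ugl_noeth : noeth_ring U.
Proof.
have [D [b [xi [_ h1 h2 h3]]]] := Ugl_basis.
exact: almost_comm_noeth (U_comm h2) (U_ind h2).
Qed.

Lemma Ugl_noeth_op : noeth_ring (U^c)%type.
Proof.
have [D [b [xi [_ h1 h2 h3]]]] := Ugl_basis.
apply: (@almost_comm_noeth K (U^c)%type D (fun j => gen (b j))) => [i j|Q QC Qb QD QM].
  have [c cE] := U_comm h2 j i; exists c; exact: cE.
by apply: (U_ind h2) => // u v Qu Qv; apply: (QM v u).
Qed.

End Noetherian.

(** The generators are taken among the [v t] themselves, which keeps the property [Q] of their
    indices. *)
Lemma fg_family (A : pzRingType) (M : lmodType A) (S : M -> Prop) (T : eqType)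
    (v : T -> M) (Q : T -> Prop) : noeth S -> submod S -> (forall t, Q t -> S (v t)) ->
  exists s : seq T, (forall t, t \in s -> Q t) /\ forall t, Q t -> spn (map v s) (v t).
Proof.
move=> Sn SP QS.
pose D h := exists s : seq T, (forall t, t \in s -> Q t) /\ spn (map v s) h.
have DP : submod D.
  split=> [|a h h' [s [sQ hs]] [s' [sQ' hs']]]; first by exists [::].
  exists (s ++ s'); split=> [t|]; first by rewrite mem_cat => /orP[/sQ|/sQ'].
  rewrite map_cat; apply (spnP (map v s ++ map v s')).2.
    by apply: spn_sub hs => t ts; rewrite mem_cat ts.
  by apply: spn_sub hs' => t ts; rewrite mem_cat ts orbT.
have DS h : D h -> S h.
  by move=> [s [sQ]]; apply: spn_min => // _ /mapP[t /sQ/QS St ->].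
have [e eP] := Sn D DP DS.
have [s [sQ se]] : exists s, (forall t, t \in s -> Q t) /\ forall h, h \in e -> spn (map v s) h.
  have : forall h, h \in e -> D h by move=> h /spn_mem /eP.
  elim: e {eP} => [|h e IH] eD; first by exists [::].
  have [|s [sQ se]] := IH; first by move=> g ge; apply: eD; rewrite inE ge orbT.
  have [s' [sQ' sh]] := eD h (mem_head _ _).
  exists (s' ++ s); split=> [t|g]; first by rewrite mem_cat => /orP[/sQ'|/sQ].
  rewrite inE map_cat => /predU1P[->|/se gs].
    by apply: spn_sub sh => t ts; rewrite mem_cat ts.
  by apply: spn_sub gs => t ts; rewrite mem_cat ts orbT.
exists s; split=> // t Qt; apply: (spn_min (spnP _) se); apply/eP.
by exists [:: t]; split=> [u|]; [rewrite inE => /eqP ->|apply: spn_mem; rewrite mem_head].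
Qed.

Lemma spn_map (A : pzRingType) (M : lmodType A) (T : Type) (v : T -> M) (s : seq T) x :
  spn (map v s) x -> exists a : 'I_(size s) -> A, x = \sum_i a i *: v (tnth (in_tuple s) i).
Proof.
elim: s x => [|e s IH] x /=; first by move->; exists (fun=> 0); rewrite big_ord0.
case=> a [y [/IH[b ->] ->]].
exists (fun i => oapp b a (unlift ord0 i)); rewrite big_ord_recl unlift_none /= (tnth_nth e) /=.
by congr (_ + _); apply: eq_bigr => i _; rewrite liftK /= !(tnth_nth e).
Qed.

(** * The center of U(gl_k) *)

Section Center.
Variables (C : numClosedFieldType) (k : nat).
Local Notation U := (Ugl C k).
Local Notation gen := (env_gen (@mx_bracket C k)).
Local Notation E := (fun i j : 'I_k => delta_mx i j : 'M[C]_k).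
Local Notation "[ad i j ] u" := (adg (fun i j => delta_mx i j : 'M[C]_k) i j u) (at level 10, i, j at level 0, u at level 9).

Lemma E_adj i j : E j i = map_mx Num.conj (E i j)^T.
Proof. by rewrite trmx_delta map_delta_mx. Qed.

Lemma centralP (z : U) : (forall i j, [ad i j] z = 0) -> in_center z.
Proof.
move=> zP u; apply/esym; elim/env_ind: u; elim=> [y|c|s IHs t IHt|s IHs t IHt].
- rewrite -[env_class _ _]/(gen y) gen_elem mulr_suml mulr_sumr; apply: eq_bigr => a _.
  by rewrite -scalerAl -scalerAr; congr (_ *: _); apply/subr0_eq; apply: zP.
- by rewrite env_classC mulr_algl mulr_algr.
- by rewrite env_classD mulrDl mulrDr IHs IHt.
- by rewrite env_classM -mulrA IHt mulrA IHs mulrA.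
Qed.

Lemma ad_central (z : U) i j : in_center z -> [ad i j] z = 0.
Proof. by move=> zc; rewrite /adg zc subrr. Qed.

(** The invariants of the adjoint action are the center, so this is the Reynolds decomposition of
    [u]. *)
Lemma center_dec (u : U) : exists (z : U) (w : 'I_k -> 'I_k -> U),
  in_center z /\ u = z + \sum_i \sum_j [ad i j] (w i j).
Proof.
have [z [w [zP uE]]] := reynolds (@adg_linear C k k E) (adg_ufin E_adj u).
by exists z, w; split=> //; apply: centralP.
Qed.

Lemma in_center_submod : @submod C U (@in_center U).
Proof.
split=> [a|c u v uz vz a]; first by rewrite mul0r mulr0.
by rewrite mulrDl mulrDr -scalerAl -scalerAr uz vz.
Qed.

Lemma in_centerM (u v : U) : in_center u -> in_center v -> in_center (u * v).
Proof. by move=> uz vz a; rewrite -mulrA vz mulrA uz mulrA. Qed.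

(* Hilbert's argument: the part in the center of a left ideal of U generated by central
   elements is recovered by center_dec. *)
Lemma center_noeth (Q : U -> Prop) : (forall z, Q z -> in_center z) ->
  exists s : seq U, (forall z, z \in s -> Q z) /\
  forall z, Q z -> exists c : 'I_(size s) -> U,
    (forall i, in_center (c i)) /\ z = \sum_i c i * tnth (in_tuple s) i.
Proof.
move=> Qz.
have Un : @noeth U (U^o)%type (fun _ => True).
  move=> D DP _; apply: (noeth_spn (s := [:: (1 : U^o)]) (@Ugl_noeth C k) DP) => u _ /=.
  by exists u, 0; rewrite addr0; split=> //; rewrite /GRing.scale /= mulr1.
have [s [sQ sE]] := @fg_family U (U^o)%type (fun _ => True) U id Q Un (@submodT _ _) (fun _ _ => Logic.I).
exists s; split=> // z Qz'; have [a zE] := spn_map (sE z Qz').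
have /choice[c /choice[w cw]] : forall i, exists (c : U) (w : 'I_k -> 'I_k -> U),
    in_center c /\ a i = c + \sum_j \sum_l [ad j l] (w j l).
  by move=> i; apply: center_dec.
exists c; split=> [i|]; first by have [] := cw i.
have sz i : in_center (tnth (in_tuple s) i) by apply/Qz/sQ/mem_tnth.
apply/subr0_eq; set y := _ - _.
(* As the generators are central, the discarded parts of the [a i] contribute only commutators. But
   [y] is also central, which by [invariant_image] leaves [y = 0]. *)
have yE : y = \sum_j \sum_l [ad j l] (\sum_i w i j l * tnth (in_tuple s) i).
  rewrite /y zE -sumrB.
  transitivity (\sum_i \sum_j \sum_l [ad j l] (w i j l) * tnth (in_tuple s) i).
    apply: eq_bigr => i _; have [_ ->] := cw i.
    rewrite -[_ *: _]/(_ * _) mulrDl addrAC subrr add0r mulr_suml; apply: eq_bigr => j _.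
    by rewrite mulr_suml.
  rewrite exchange_big; apply: eq_bigr => j _; rewrite exchange_big; apply: eq_bigr => l _ /=.
  rewrite adg_sum; apply: eq_bigr => i _.
  by rewrite adgM (ad_central _ _ (sz i)) mulr0 addr0.
rewrite yE; apply: (invariant_image (@adg_linear C k k E)) => j l; first exact: adg_ufin E_adj _.
rewrite -yE; apply: ad_central; rewrite /y; have [_ cP] := in_center_submod.
have zc := Qz _ Qz'.
rewrite addrC -scaleN1r; apply: cP => //.
elim/big_ind: _ => [|u v uc vc|i _]; first exact: in_center_submod.1.
  by rewrite -[u]scale1r; apply: in_center_submod.2.
by apply: in_centerM => //; have [] := cw i.
Qed.

End Center.

(** * Moving the center of U(gl_k) across gl_n *)

Section HarishChandra.
Variables (C : numClosedFieldType) (k n : nat).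
Hypothesis le_kn : (k <= n)%N.
Local Notation Uk := (Ugl C k).
Local Notation U := (Ugl C n).
Local Notation genk := (env_gen (@mx_bracket C k)).
Local Notation gen := (env_gen (@mx_bracket C n)).
Local Notation phi := (corner C le_kn).
Local Notation I := ('I_n * 'I_n)%type.
Let x (i j : 'I_k) : 'M[C]_n := gl_corner n (delta_mx i j).

Let x_adj i j : x j i = map_mx Num.conj (x i j)^T.
Proof.
rewrite /x /gl_corner !trmx_mul !map_mxM !tr_pid_mx !map_pid_mx mulmxA.
by rewrite -E_adj.
Qed.

Let l (a : I) : U := gen (elem C a).

(** gl_n is stable under brackets with the corner, so elements of U(gl_k) pass to the right of gl_n
    one generator at a time. *)
Lemma corner_in_span (u : Uk) a : exists v : I -> Uk, phi u * l a = \sum_b l b * phi (v b).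
Proof.
elim/env_ind: u a; elim=> [y|c|s IHs t IHt|s IHs t IHt] a.
- rewrite -[env_class _ _]/(genk y) corner_gen.
  pose Y := gl_corner n y.
  exists (fun b => (b == a)%:R * genk y + (mx_bracket Y (elem C a) b.1 b.2)%:A).
  rewrite (eq_bigr (fun b => (b == a)%:R * (l b * gen Y) + mx_bracket Y (elem C a) b.1 b.2 *: l b)).
    rewrite big_split -gen_elem gen_br (bigD1 a) //= eqxx mul1r big1 ?addr0 => [|b /negPf ->].
      by rewrite addrC subrK.
    by rewrite mul0r.
  move=> b _; rewrite rmorphD rmorphM rmorph_nat corner_gen corner_alg mulrDr mulr_algr.
  by congr (_ + _); case: eqP => _; rewrite ?mul1r ?mul0r ?mulr0.
- exists (fun b => (b == a)%:R * c%:A).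
  have -> : phi (env_class _ (EConst c)) = c%:A by rewrite env_classC; apply: corner_alg.
  rewrite mulr_algl (bigD1 a) // eqxx mul1r corner_alg mulr_algr.
  rewrite big1 => [|b /negPf ->]; first exact: esym (addr0 _).
  by rewrite mul0r rmorph0 mulr0.
- have [v vE] := IHs a; have [w wE] := IHt a.
  exists (fun b => v b + w b); rewrite env_classD rmorphD mulrDl vE wE -big_split.
  by apply: eq_bigr => b _; rewrite rmorphD mulrDr.
- have [w wE] := IHt a; have /choice[v vE] := IHs.
  exists (fun b => \sum_d v d b * w d); rewrite env_classM rmorphM -mulrA wE mulr_sumr.
  rewrite (eq_bigr (fun d => \sum_b l b * (phi (v d b) * phi (w d)))); last first.
    by move=> d _; rewrite mulrA vE mulr_suml; apply: eq_bigr => b _; rewrite mulrA.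
  rewrite exchange_big; apply: eq_bigr => b _; rewrite rmorph_sum mulr_sumr.
  by apply: eq_bigr => d _; rewrite rmorphM.
Qed.

Fact corner_op_zmod : zmod_morphism (phi : (Uk^c)%type -> (U^c)%type).
Proof. by move=> u v; exact: (rmorphB phi u v). Qed.

Fact corner_op_monoid : monoid_morphism (phi : (Uk^c)%type -> (U^c)%type).
Proof. by split; [exact: (rmorph1 phi)|move=> u v; exact: (rmorphM phi v u)]. Qed.

Definition corner_op : {rmorphism (Uk^c)%type -> (U^c)%type} :=
  HB.pack (phi : (Uk^c)%type -> (U^c)%type)
    (GRing.isZmodMorphism.Build _ _ _ corner_op_zmod)
    (GRing.isMonoidMorphism.Build _ _ _ corner_op_monoid).

(** The argument of [center_noeth] for Hom(gl_n, U) as a right U(gl_k)-module: the maps [v z] of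
    left multiplication by a central [z] lie in a finitely generated submodule, so finitely many of
    them generate all, with coefficients in U(gl_k). The central parts of the coefficients suffice,
    because the error is both invariant and a sum of images of the action. *)
Theorem center_exchange : exists s : seq Uk, (forall z, z \in s -> in_center z) /\
  forall z, in_center z -> exists c : 'I_(size s) -> Uk, (forall i, in_center (c i)) /\
    forall a, phi z * l a = \sum_i phi (tnth (in_tuple s) i) * l a * phi (c i).
Proof.
pose N : lmodType (Uk^c)%type := resm corner_op ((U^c)^o)%type.
pose M : lmodType (Uk^c)%type := I -> N.
pose v (z : Uk) : M := fun a => phi z * l a.
pose gens : seq M := [seq (inj p.1 (l p.2) : M) | p <- enum {: I * I}].
have vS z : in_center z -> spn gens (v z).
  move=> _; have /choice[w wE] := corner_in_span z.
  have -> : v z = \sum_a \sum_b (w a b : (Uk^c)%type) *: (inj a (l b) : M).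
    apply: funext => c.
    have sumE (F : I -> M) : (\sum_a F a) c = \sum_a F a c.
      by elim/big_rec2: _ => // a p q _ <-.
    rewrite sumE (bigD1 c) //= sumE [X in _ = _ + X]big1 ?addr0.
      rewrite /v wE; apply: eq_bigr => b _.
      by change (l b * phi (w c b) = inj c (l b) c * phi (w c b)); rewrite /inj eqxx.
    move=> a /negPf ac; rewrite sumE big1 // => b _.
    by change (inj a (l b) c * phi (w a b) = 0); rewrite /inj eq_sym ac mul0r.
  have g0 : spn gens 0 by exact: (spnP gens).1.
  have gD (p p' : M) : spn gens p -> spn gens p' -> spn gens (p + p').
    exact: submodD (spnP gens).
  elim/big_ind: _ => [|p p'|a _]; [exact: g0|exact: gD|].
  elim/big_ind: _ => [|p p'|b _]; [exact: g0|exact: gD|].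
  apply: (submodZ _ (spnP gens)); apply: spn_mem; apply/mapP; exists (a, b) => //.
  by rewrite mem_enum.
have [s [sz sE]] := fg_family (noeth_spn (s := gens) (@Ugl_noeth_op C k)) (spnP gens) vS.
exists s; split=> // z zc; have [a zE] := spn_map (sE z zc).
have sumM (J : finType) (F : J -> I -> U) b : (\sum_i F i) b = \sum_i F i b.
  by elim/big_rec2: _ => // i p q _ <-.
have {}zE b : phi z * l b = \sum_i phi (tnth (in_tuple s) i) * l b * phi (a i : Uk).
  have := congr1 (fun h : M => h b) zE; rewrite /v => ->.
  exact: (sumM _ (fun i b => phi (tnth (in_tuple s) i) * l b * phi (a i : Uk))).
have /choice[c /choice[w cw]] : forall i, exists (c : Uk) (w : 'I_k -> 'I_k -> Uk),
    in_center c /\ (a i : Uk) = c + \sum_j \sum_t adg (fun i j => delta_mx i j : 'M[C]_k) j t (w j t).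
  by move=> i; apply: center_dec.
exists c; split=> [i|b]; first by have [] := cw i.
pose V u u' : I -> U := fun b => phi u * l b * phi u'.
have phi_ad i j u : adg x i j (phi u) = phi (adg (fun i j => delta_mx i j : 'M[C]_k) i j u).
  by rewrite /adg rmorphB !rmorphM corner_gen.
have adl i j b' : adg x i j (l b') = \sum_d adm x i j b' d *: l d by apply: adg_elem.
(* For central [u] the action reaches only the right factor, since the inclusion of gl_n into U is
   itself invariant. *)
have adV i j u u' : in_center u -> adh x i j (V u u') =
    V u (adg (fun i j => delta_mx i j : 'M[C]_k) i j u').
  move=> uc; apply: funext => b'; rewrite /adh /V !adgM phi_ad ad_central // rmorph0 mul0r add0r.
  rewrite phi_ad adl mulr_sumr mulr_suml addrAC -sumrB big1 ?add0r // => d _.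
  by rewrite -scalerAr -scalerAl subrr.
have sc i : in_center (tnth (in_tuple s) i) by apply/sz/mem_tnth.
pose y : I -> U := fun b => phi z * l b - \sum_i V (tnth (in_tuple s) i) (c i) b.
suff y0 : y = 0 by apply/subr0_eq; have := congr1 (fun h => h b) y0.
have yE : y = \sum_j \sum_t adh x j t (\sum_i V (tnth (in_tuple s) i) (w i j t)).
  transitivity (\sum_j \sum_t \sum_i V (tnth (in_tuple s) i)
      (adg (fun i j => delta_mx i j : 'M[C]_k) j t (w i j t))).
    apply: funext => b'; rewrite /y zE -sumrB.
    rewrite sumM; under [RHS]eq_bigr do rewrite sumM; under [RHS]eq_bigr do under eq_bigr do rewrite sumM.
    under [RHS]eq_bigr do rewrite exchange_big.
    rewrite [RHS]exchange_big; apply: eq_bigr => i _; have [_ ->] := cw i.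
    rewrite rmorphD mulrDr /V addrAC subrr add0r rmorph_sum mulr_sumr; apply: eq_bigr => j _.
    by rewrite rmorph_sum mulr_sumr.
  apply: eq_bigr => j _; apply: eq_bigr => t _; rewrite adh_sum; apply: eq_bigr => i _.
  by rewrite adV.
rewrite yE; apply: (invariant_image (@adh_linear C k n x)) => j t; first exact: adh_ufin x_adj _.
rewrite -yE.
have -> : y = V z 1 - \sum_i V (tnth (in_tuple s) i) (c i).
  apply: funext => b'; rewrite /y.
  change (phi z * l b' - \sum_i V (tnth (in_tuple s) i) (c i) b' =
    phi z * l b' * phi 1 - (\sum_i V (tnth (in_tuple s) i) (c i)) b').
  by rewrite rmorph1 mulr1 sumM.
rewrite adhB adV // adh_sum.
have V0 u : V u 0 = 0 by apply: funext => b'; rewrite /V rmorph0 mulr0.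
rewrite ad_central ?V0 => [|u]; last by rewrite mulr1 mul1r.
rewrite big1 ?subrr // => i _; rewrite adV // ad_central ?V0 //.
by have [] := cw i.
Qed.

End HarishChandra.

(** * Torsion over the centers *)

Section TorsionExact.
Variables (B : pzRingType) (J : nat -> lmodType B) (d : forall i, {linear J i -> J i.+1}).
Variables (R t : forall i, J i -> Prop).
Arguments R {i}.
Arguments t {i}.
Hypotheses (RP : forall i, submod (@R i)) (tP : forall i, submod (@t i))
  (dR : forall i (x : J i), R x -> R (d i x))
  (ddR : forall i (x : J i), R x -> d i.+1 (d i x) = 0)
  (d_exact : forall i (x : J i.+1), R x -> d i.+1 x = 0 -> exists2 y, R y & d i y = x)
  (R_baer : forall i, baer (@R i)) (Rt_baer : forall i, baer (fun x : J i => R x /\ t x))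
  (t_ann : forall i j (x : J i) (y : J j), (forall b : B, b *: x = 0 -> b *: y = 0) -> t x -> t y).
Hypothesis t_start : forall x : J 0, R x -> d 0 x = 0 -> t x.

Lemma baer0 (M : lmodType B) : baer (fun x : M => x = 0).
Proof. by move=> I f _ _ f0; exists 0 => // a /f0 ->; rewrite scaler0. Qed.

Lemma baer_dsum (M : lmodType B) (S T : M -> Prop) : submod S -> submod T ->
  baer S -> baer T -> (forall x, S x -> T x -> x = 0) ->
  baer (fun x => exists u v, [/\ S u, T v & x = u + v]).
Proof.
move=> SP TP Sb Tb ST I f IP f_lin fST.
have /choice[g /choice[h gh]] : forall a, exists u v, I a -> [/\ S u, T v & f a = u + v].
  by move=> a; have [/fST[u [v uv]]|] := pselect (I a); [exists u, v|exists 0, 0].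
have uniq u v u' v' : S u -> T v -> S u' -> T v' -> u + v = u' + v' -> u = u' /\ v = v'.
  move=> Su Tv Su' Tv' E.
  have E' : u - u' = v' - v.
    by apply/eqP; rewrite subr_eq addrAC -subr_eq opprK E addrC.
  have uu' : u - u' = 0.
    by apply: ST; [apply: submodB|rewrite E'; apply: submodB].
  by split; apply/subr0_eq => //; rewrite -opprB -E' uu' oppr0.
have gl a x y : I x -> I y ->
    g (a * x + y) = a *: g x + g y /\ h (a * x + y) = a *: h x + h y.
  move=> Ix Iy; have [Sx Tx fx] := gh x Ix; have [Sy Ty fy] := gh y Iy.
  have [Sz Tz fz] := gh _ (IP.2 a _ _ Ix Iy).
  apply: uniq => //; [exact: SP.2|exact: TP.2|].
  by rewrite -fz f_lin // fx fy scalerDr addrACA.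
have [|a Ia|e Se eE] := Sb I g IP.
- by move=> a x y Ix Iy; have [] := gl a x y Ix Iy.
- by have [] := gh a Ia.
have [|a Ia|e' Te' eE'] := Tb I h IP.
- by move=> a x y Ix Iy; have [] := gl a x y Ix Iy.
- by have [] := gh a Ia.
exists (e + e'); first by exists e, e'.
by move=> a Ia; have [_ _ ->] := gh a Ia; rewrite scalerDr eE // eE'.
Qed.

Let good i (F : J i -> Prop) := [/\ submod F, baer F, forall x, F x -> R x /\ d i x = 0,
  forall x, F x -> t x -> x = 0 &
  forall x, R x -> d i x = 0 -> exists u v, [/\ R u, t u, F v & x = u + v]].

(* If ker d splits as its torsion plus an injective F, then so does its cokernel. *)
Let good_step i (F : J i -> Prop) : good F ->
  (exists F', @good i.+1 F') /\
  forall x : J i.+1, R x -> t x -> d i.+1 x = 0 -> exists y, [/\ R y, t y & d i y = x].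
Proof.
move=> [FP Fb FR Ft Fdec].
pose Rt x := @R i x /\ t x.
have RtP : submod Rt by apply: submodI.
pose W x := exists u v, [/\ Rt u, F v & x = u + v].
have WP : submod W by apply: submod_add.
have Wb : baer W.
  by apply: baer_dsum => // x [_ tx] Fx; apply: Ft.
have RtW x : Rt x -> W x by move=> Rx; exists x, 0; rewrite addr0; split=> //; case: FP.
have FW x : F x -> W x by move=> Fx; exists 0, x; rewrite add0r; split=> //; case: RtP.
have WR x : W x -> R x.
  by move=> [u [v [[Ru _] /FR[Rv _] ->]]]; apply: submodD.
(* A retraction onto the injective submodule [W], which contains the cocycles; its kernel [G] in [R]
   is a complement of [W], and [d i] is injective on [G]. *)
have [//|//|rho [rhoW rho_W]] := @baer_extend B _ _ W W id WP WP Wb.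
have cl x : R x -> rho x = 0 -> d i x = 0 -> x = 0.
  move=> Rx rx dx; rewrite -rx rhoW //.
  by have [u [v [Ru tu Fv ->]]] := Fdec x Rx dx; exists u, v.
pose G x := R x /\ rho x = 0.
have GP : submod G.
  split=> [|a u v [Ru ru] [Rv rv]]; first by split; rewrite ?linear0 //; case: (RP i).
  by split; [apply (RP i)|rewrite linearP ru rv scaler0 addr0].
pose F' y := exists2 x, G x & d i x = y.
have proj x : R x -> G (x - rho x).
  move=> Rx; split; first by apply: submodB => //; apply: WR.
  by rewrite linearB (rhoW (rho x)) // subrr.
(* An element of [G] and its image under [d i] have the same annihilator, so [x] is torsion too and
   lies in [W] as well as in [G]. *)
have F't y : F' y -> t y -> y = 0.
  move=> [x [Rx rx] <-] tdx; suff -> : x = 0 by rewrite linear0.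
  have tx : t x.
    apply: t_ann tdx => b bdx; apply: cl; first exact: submodZ.
      by rewrite linearZ /= rx scaler0.
    by rewrite linearZ.
  by rewrite -rx rhoW //; apply: RtW.
have dec x : R x -> exists2 u, Rt u & exists2 y, F' y & d i x = d i u + y.
  move=> Rx; have [u [v [Ru Fv rE]]] := rho_W x.
  exists u => //; exists (d i (x - rho x)); first by exists (x - rho x) => //; apply: proj.
  rewrite linearB rE linearD; have [_ ->] := FR v Fv.
  by rewrite addr0 addrC subrK.
split; last first.
  move=> y Ry ty dy; have [x Rx xE] := d_exact Ry dy.
  have [u [Ru tu] [w F'w wE]] := dec x Rx.
  exists u; split=> //; rewrite -xE wE.
  have -> : w = 0; last by rewrite addr0.
  apply: F't => //.
  have -> : w = y - d i u by rewrite -xE wE addrAC subrr add0r.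
  by apply: submodB => //; apply: t_ann tu => b bu; rewrite -linearZ bu linear0.
exists F'; split.
- exact: submod_im.
(* [d i] identifies [F'] with [G], a direct summand of the injective [R]. *)
- move=> I f IP f_lin fF'.
  have /choice[g gP] : forall a, exists x, I a -> G x /\ d i x = f a.
    by move=> a; have [/fF'[x Gx xE]|] := pselect (I a); [exists x|exists 0].
  have g_lin a x y : I x -> I y -> g (a * x + y) = a *: g x + g y.
    move=> Ix Iy; have [Gx gx] := gP x Ix; have [Gy gy] := gP y Iy.
    have [Gz gz] := gP _ (IP.2 a _ _ Ix Iy).
    apply/subr0_eq; have GG : G (g (a * x + y) - (a *: g x + g y)).
      by apply: submodB => //; apply: GP.2.
    by apply: cl; [exact: GG.1|exact: GG.2|rewrite linearB linearP gz gx gy f_lin // subrr].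
  have [|e Re eE] := R_baer IP g_lin; first by move=> a /gP[[]].
  exists (d i (e - rho e)); first by exists (e - rho e) => //; apply: proj.
  move=> a Ia; have [[_ rg] <-] := gP a Ia.
  by rewrite -linearZ scalerBr -linearZ -eE // rg subr0.
- by move=> _ [x [Rx _] <-]; split; [apply: dR|apply: ddR].
- exact: F't.
- move=> y Ry dy; have [x Rx xE] := d_exact Ry dy.
  have [u [Ru tu] [w F'w wE]] := dec x Rx.
  exists (d i u), w; split=> //; [exact: dR| |by rewrite -xE].
  by apply: t_ann tu => b bu; rewrite -linearZ bu linear0.
Qed.

(** In degree 0 all cocycles are torsion by [t_start], so the induction starts with complement 0;
    what it carries upwards is the injective complement, not exactness. *)
Theorem torsion_exact i (x : J i.+1) : R x -> t x -> d i.+1 x = 0 ->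
  exists y, [/\ R y, t y & d i y = x].
Proof.
suff [F /good_step[_]] : exists F, @good i F by apply.
elim: i x => [|i IH] x; last by have [F /good_step[]] := IH 0.
exists (fun x => x = 0); split=> //; [exact: submod0|exact: baer0| |].
  by move=> _ ->; split; [case: (RP 0)|rewrite linear0].
by move=> y Ry dy; exists y, 0; split=> //; [apply: t_start|rewrite addr0].
Qed.

End TorsionExact.

Lemma noeth_field (K : fieldType) : noeth_ring K.
Proof.
move=> I [I0 IP]; have [[c Ic nzc]|nI] := pselect (exists2 c, I c & c != 0).
  exists [:: (c : K^o)]; split=> [x|x _]; first by rewrite inE => /eqP ->.
  by exists (x / c), 0; rewrite addr0; split=> //; rewrite /GRing.scale /= divfK.
exists [::]; split=> // x Ix /=; apply/eqP/negPn/negP => nzx.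
by apply: nI; exists x.
Qed.

Section CentralTorsion.
Variables (C : numClosedFieldType) (k : nat).
Local Notation B := (Ugl C k).

(* x generates a finite-dimensional module over the center Z_k of B. *)
Definition ztors (E : lmodType B) (x : E) : Prop := exists s : seq B,
  (forall z, z \in s -> in_center z) /\
  forall z, in_center z -> exists2 y, @spn C B s y & z *: x = y *: x.

Lemma ztors_ann (E E' : lmodType B) (x : E) (y : E') :
  (forall b : B, b *: x = 0 -> b *: y = 0) -> ztors x -> ztors y.
Proof.
move=> xy [s [sz sP]]; exists s; split=> // z /sP[u su zu]; exists u => //.
by apply/subr0_eq; rewrite -scalerBl; apply: xy; rewrite scalerBl zu subrr.
Qed.

Section OneModule.
Variable E : lmodType B.
Local Notation N := (resm (in_alg B) E).

Lemma ztors_fin (x : E) :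
  ztors x <-> exists s : seq N, forall z, in_center z -> spn s (z *: x : N).
Proof.
split=> [[s [sz sP]]|[s sP]].
  exists [seq (b *: x : N) | b <- s] => z /sP[y sy ->].
  have f_lin : linear (fun b : B => b *: x : N).
    by move=> c u v; rewrite scalerDl -mulr_algl -scalerA.
  exact: (spn_im (mk_linear f_lin) sy).
have [s' [sz sE]] := @fg_family C N _ _ (fun z : B => z *: x : N) _
  (noeth_spn (s := s) (@noeth_field C)) (spnP s) sP.
exists s'; split=> // z /sE /spn_map[a aE].
exists (\sum_i a i *: tnth (in_tuple s') i).
  elim/big_ind: _ => [|u v|i _]; [exact: (spnP s').1|exact: (submodD (spnP s'))|].
  by apply: (submodZ _ (spnP s')); apply/spn_mem/mem_tnth.
rewrite aE scaler_suml; apply: eq_bigr => i _.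
by rewrite -mulr_algl -scalerA.
Qed.

Lemma ztors_add (x y : E) : ztors x -> ztors y -> ztors (x + y).
Proof.
move=> /ztors_fin[s sP] /ztors_fin[s' sP']; apply/ztors_fin; exists (s ++ s') => z zz.
rewrite scalerDr; apply: (submodD (spnP (s ++ s'))).
  by apply: spn_sub (sP z zz) => u us; rewrite mem_cat us.
by apply: spn_sub (sP' z zz) => u us; rewrite mem_cat us orbT.
Qed.

Lemma ztors0 : ztors (0 : E).
Proof. by exists [::]; split=> // z _; exists 0 => //; rewrite !scaler0. Qed.

Lemma ztors_sum I (r : seq I) (F : I -> E) : (forall i, ztors (F i)) -> ztors (\sum_(i <- r) F i).
Proof. by move=> FP; elim/big_ind: _ => //; [apply: ztors0|apply: ztors_add]. Qed.

Variable s : seq B.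
Hypotheses (sz : forall z, z \in s -> in_center z)
  (s_cofin : exists w : seq B, forall z, in_center z -> exists2 y, @spn C B w y &
     exists c : 'I_(size s) -> B, (forall i, in_center (c i)) /\
       z = y + \sum_i c i * tnth (in_tuple s) i).

(** The ideal generated by [s] has finite codimension in the center, so the center times [x] lies in
    the sum of a finite-dimensional space and the spaces generated by the [p *: x]. *)
Lemma ztors_ideal (x : E) : (forall p, p \in s -> ztors (p *: x)) -> ztors x.
Proof.
move=> sx; have [w wP] := s_cofin.
have /choice[e eP] : forall i : 'I_(size s), exists e : seq N, forall z, in_center z ->
    spn e (z *: (tnth (in_tuple s) i *: x) : N).
  by move=> i; apply/ztors_fin/sx/mem_tnth.
apply/ztors_fin; exists ([seq (b *: x : N) | b <- w] ++ flatten [seq e i | i <- enum 'I_(size s)]).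
move=> z /wP[y wy [c [cz ->]]]; set S := _ ++ _.
rewrite scalerDl; apply: (submodD (spnP S)).
  have f_lin : linear (fun b : B => b *: x : N).
    by move=> a u v; rewrite scalerDl -mulr_algl -scalerA.
  by apply: spn_sub (spn_im (mk_linear f_lin) wy) => u uw; rewrite mem_cat uw.
rewrite scaler_suml; elim/big_ind: _ => [|u v|i _]; first exact: (spnP S).1.
  exact: (submodD (spnP S)).
rewrite -scalerA; apply: spn_sub (eP i (c i) (cz i)) => u ui; rewrite mem_cat; apply/orP; right.
by apply/flattenP; exists (e i) => //; apply: map_f; rewrite mem_enum.
Qed.

(** Induction on the total exponent: passing to [p *: x] lowers the exponent of [p] and, by
    centrality, keeps the others. *)
Lemma ztors_nil (x : E) (mu : B -> nat) : (forall p, p \in s -> p ^+ mu p *: x = 0) -> ztors x.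
Proof.
have [T] := ubnP (\sum_(p <- s) mu p)%N; elim: T x mu => // T IH x mu; rewrite ltnS => leT sx.
apply: ztors_ideal => p ps.
have [mu0|mu_gt] := posnP (mu p).
  have := sx p ps; rewrite mu0 expr0 scale1r => ->; rewrite scaler0; exact: ztors0.
pose mu' q := if q == p then (mu p).-1 else mu q.
apply: (IH _ mu') => [|q qs]; last first.
  rewrite /mu'; case: eqP => [->|_].
    by rewrite scalerA -exprSr prednK // sx.
  rewrite scalerA (_ : q ^+ mu q * p = p * q ^+ mu q) -?scalerA ?sx ?scaler0 //.
  by rewrite (sz ps).
apply: leq_trans leT; rewrite !(big_rem p ps) /= /mu' eqxx -addSn prednK // leq_add2l.
by apply: leq_sum => q _; case: eqP => // ->; apply: leq_pred.
Qed.

End OneModule.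
End CentralTorsion.

(** * The torsion part of an injective module *)

Section TorsionBaer.
Variables (C : numClosedFieldType) (k : nat) (E : lmodType (Ugl C k)) (R : E -> Prop).
Local Notation B := (Ugl C k).
Hypothesis R_baer : baer R.

(* The chain {b | p ^+ j * b \in I} stabilizes, say at m, and f extends by 0 to I + p ^+ m.+1 B. *)
Lemma extend_by_zero (p : B) (I : B -> Prop) (f : B -> E) : in_center p -> left_ideal I ->
  (forall a x y, I x -> I y -> f (a * x + y) = a *: f x + f y) ->
  (forall a, I a -> p *: f a = 0) ->
  exists (m : nat) (I' : B -> Prop) (f' : B -> E),
    [/\ left_ideal I', forall a x y, I' x -> I' y -> f' (a * x + y) = a *: f' x + f' y,
        forall a, I a -> I' a /\ f' a = f a, I' (p ^+ m) /\ f' (p ^+ m) = 0 &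
        forall a, I' a -> exists2 b, I b & f' a = f b].
Proof.
move=> pz IP f_lin fp.
have pX m (b : B) : b * p ^+ m = p ^+ m * b by apply: commrX; apply: esym; apply: pz.
have f0 : f 0 = 0.
  have := f_lin (-1) 0 0 IP.1 IP.1; rewrite mulr0 addr0 => {1}->.
  by rewrite scaleN1r addNr.
pose N j (b : B^o) := I (p ^+ j * b).
have NP j : @submod B B^o (N j).
  split=> [|a u v Nu Nv]; first by rewrite /N mulr0; case: IP.
  by rewrite /N mulrDr mulrA -pX -mulrA; apply: IP.2.
have Un : @noeth B B^o (fun _ => True).
  move=> D DP _; apply: (noeth_spn (s := [:: (1 : B^o)]) (@Ugl_noeth C k) DP) => u _ /=.
  by exists u, 0; rewrite addr0; split=> //; rewrite /GRing.scale /= mulr1.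
have [j b Nb|//|m mP] := acc_stable Un NP.
  by have := IP.2 p _ _ Nb IP.1; rewrite addr0 mulrA -exprS.
pose I' (x : B) := exists a b : B, I a /\ x = a + p ^+ m.+1 * b.
(* Stabilization puts [p ^+ m * b] in [I] once [p ^+ m.+1 * b] is there, and [p] kills its value. *)
have zero b : I (p ^+ m.+1 * b) -> f (p ^+ m.+1 * b) = 0.
  move=> /(mP m.+1 b) Ib; have := f_lin p _ _ Ib IP.1.
  by rewrite f0 !addr0 mulrA -exprS fp.
have uniq a b a' b' : I a -> I a' -> a + p ^+ m.+1 * b = a' + p ^+ m.+1 * b' -> f a = f a'.
  move=> Ia Ia' ab; have aE : a = (p ^+ m.+1 * (b' - b)) + a'.
    by apply/eqP; rewrite mulrBr addrAC -subr_eq opprK ab addrC.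
  have Ib : I (p ^+ m.+1 * (b' - b)).
    have := IP.2 (-1) _ _ Ia' Ia; rewrite {1}aE mulN1r addrC addrK.
    by [].
  by have := f_lin 1 _ _ Ib Ia'; rewrite mul1r scale1r zero // add0r -aE.
have /choice[g gP] : forall x, exists a, I' x -> I a /\ exists b, x = a + p ^+ m.+1 * b.
  move=> x; have [[a [b [Ia xE]]]|] := pselect (I' x); last by exists 0.
  by exists a => _; split=> //; exists b.
exists m.+1, I', (fun x => f (g x)); split.
- split=> [|a x y [u [v [Iu ->]]] [u' [v' [Iu' ->]]]].
    by exists 0, 0; rewrite mulr0 addr0; case: IP.
  exists (a * u + u'), (a * v + v'); split; first exact: IP.2.
  by rewrite !mulrDr addrACA !mulrA pX.
- move=> a x y Ix Iy; have [Igx [u xE]] := gP x Ix; have [Igy [v yE]] := gP y Iy.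
  rewrite -f_lin //.
  have [|Ig [w wE]] := gP (a * x + y).
    exists (a * g x + g y), (a * u + v); split; first exact: IP.2.
    by rewrite [in LHS]xE [in LHS]yE !mulrDr addrACA !mulrA pX.
  apply: (uniq _ w _ (a * u + v)) => //; first exact: IP.2.
  by rewrite -wE [in LHS]xE [in LHS]yE !mulrDr addrACA !mulrA pX.
- move=> a Ia; have Ia' : I' a by exists a, 0; rewrite mulr0 addr0.
  by split=> //; have [Ig [b bE]] := gP a Ia'; apply: (uniq _ b _ 0) => //; rewrite -bE mulr0 addr0.
- have Ip : I' (p ^+ m.+1) by exists 0, 1; rewrite mulr1 add0r; case: IP.
  split=> //; have [Ig [b bE]] := gP _ Ip; rewrite -f0.
  by apply: (uniq _ b _ 1) => //; [case: IP|rewrite -bE mulr1 add0r].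
- by move=> a /gP[Ig _]; exists (g a).
Qed.

Lemma extend_by_zeros (ps : seq B) (I : B -> Prop) (f : B -> E) :
  (forall p, p \in ps -> in_center p) -> left_ideal I ->
  (forall a x y, I x -> I y -> f (a * x + y) = a *: f x + f y) ->
  (forall p a, p \in ps -> I a -> p *: f a = 0) ->
  exists (mu : B -> nat) (I' : B -> Prop) (f' : B -> E),
    [/\ left_ideal I', forall a x y, I' x -> I' y -> f' (a * x + y) = a *: f' x + f' y,
        forall a, I a -> I' a /\ f' a = f a, forall p, p \in ps -> I' (p ^+ mu p) /\ f' (p ^+ mu p) = 0 &
        forall a, I' a -> exists2 b, I b & f' a = f b].
Proof.
move=> psz IP f_lin; elim: ps psz => [|p ps IH] psz fp.
  by exists (fun=> 0%N), I, f; split=> // a Ia; exists a.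
have [|q a qs|mu [I1 [f1 [I1P f1_lin f1E f1p f1R]]]] := IH.
- by move=> q qs; apply: psz; rewrite inE qs orbT.
- by apply: fp; rewrite inE qs orbT.
have [||m [I2 [f2 [I2P f2_lin f2E f2p f2R]]]] := extend_by_zero _ I1P f1_lin (p := p).
- exact/psz/mem_head.
- by move=> a /f1R[b Ib ->]; apply: fp => //; apply: mem_head.
exists (fun q => if q == p then m else mu q), I2, f2; split=> //.
- by move=> a /f1E[/f2E[I2a ->] ->].
- move=> q; rewrite inE; case: eqP => [-> //|_ /= /f1p[/f2E[I2q ->] ->]].
  by split.
- by move=> a /f2R[b /f1R[c Ic ->] ->]; exists c.
Qed.

(** The values [f a] are packed into one vector of a power of [E]; torsion of that vector treats
    them simultaneously. *)
Lemma ztors_uniform (s : seq B) (f : B -> E) : (forall a, a \in s -> ztors (f a)) ->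
  exists w : seq B, (forall z, z \in w -> in_center z) /\
    forall z, in_center z -> exists2 y, @spn C B w y & forall a, a \in s -> (z - y) *: f a = 0.
Proof.
move=> fs; pose M : lmodType B := 'I_(size s) -> E.
pose ij i (u : E) : M := fun j => if j == i then u else 0.
pose X : M := \sum_i ij i (f (tnth (in_tuple s) i)).
have XE j : X j = f (tnth (in_tuple s) j).
  have -> : X j = \sum_i ij i (f (tnth (in_tuple s) i)) j.
    by rewrite /X; elim/big_rec2: _ => // i u v _ <-.
  rewrite (bigD1 j) //= /ij eqxx big1 ?addr0 // => i /negPf ijn.
  by rewrite eq_sym ijn.
have [w [wz wP]] : ztors X.
  apply: ztors_sum => i; apply: ztors_ann (fs _ (mem_tnth i (in_tuple s))) => b.
  move=> bf; apply: funext => j; change (b *: ij i (f (tnth (in_tuple s) i)) j = 0).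
  by rewrite /ij; case: eqP; rewrite ?scaler0.
exists w; split=> // z /wP[y wy zy]; exists y => // a /(tnthP (in_tuple s))[i ->].
rewrite -XE; have /(congr1 (fun h : M => h i)) : (z - y) *: X = 0 by rewrite scalerBl zy subrr.
by [].
Qed.

(** Since [I] is finitely generated, the central elements killing all of [f] on [I] form an ideal of
    finite codimension, generated by a finite list [ps]. After extending [f] by zero to powers of
    the members of [ps], the element given by injectivity of [R] is killed by these powers, hence
    torsion by [ztors_nil]. *)
Theorem baer_ztors : baer (fun x => R x /\ ztors x).
Proof.
move=> I f IP f_lin fR.
have [s sP] : exists s : seq B^o, (forall x, x \in s -> I x) /\ forall x, I x -> @spn B B^o s x.
  by have [s [sI sP]] := @Ugl_noeth C k I IP; exists s.
have [a /sP.1 /fR[] //|w [wz wP]] := @ztors_uniform s f.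
pose Q z := in_center z /\ forall a, a \in s -> z *: f a = 0.
have Qker z : Q z -> forall a, I a -> z *: f a = 0.
  move=> [zz Qz] a /sP.2 sa; suff [] : I a /\ z *: f a = 0 by [].
  apply: (spn_min (D := fun a : B^o => I a /\ z *: f a = 0) _ _ sa) => [|x xs]; last by split; [apply: sP.1|apply: Qz].
  split=> [|c u v [Iu zu] [Iv zv]].
    split; first by case: IP.
    have := f_lin (-1) 0 0 IP.1 IP.1; rewrite mulr0 addr0 => ->.
    by rewrite scaleN1r addNr scaler0.
  by split; [apply: IP.2|rewrite f_lin // scalerDr zv scalerA zz -scalerA zu scaler0 addr0].
have [|ps [psQ psP]] := @center_noeth C k Q; first by move=> z [].
have psz p : p \in ps -> in_center p by case/psQ.
have [|mu [I' [f' [I'P f'_lin f'E f'p f'R]]]] := extend_by_zeros psz IP f_lin.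
  by move=> p a /psQ Qp; apply: Qker.
have [|e Re eE] := R_baer I'P f'_lin; first by move=> a /f'R[b /fR[] Rb _ ->].
exists e; last by move=> a /f'E[I'a <-]; apply: eE.
split=> //; apply: (@ztors_nil C k E ps psz _ e mu).
  exists w => z zz; have [y wy yP] := wP z zz; exists y => //.
  have [|c [cz cE]] := psP (z - y); last by exists c; rewrite -cE addrC subrK.
  split=> //; have yz : in_center y.
    exact: (spn_min (@in_center_submod C k) wz wy).
  by move=> a; rewrite mulrBl mulrBr zz yz.
by move=> p /f'p[Ip <-]; rewrite eE.
Qed.

End TorsionBaer.

Section TorsionSubmodule.
Variables (C : numClosedFieldType) (n : nat).
Local Notation U := (Ugl C n).
Local Notation gen := (env_gen (@mx_bracket C n)).

Definition tors k (le_kn : (k <= n)%N) (M : lmodType U) (x : M) : Prop :=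
  @ztors C k (resm (corner C le_kn) M) x.

Lemma tors_ann k (le_kn : (k <= n)%N) (M M' : lmodType U) (x : M) (y : M') :
  (forall u : U, u *: x = 0 -> u *: y = 0) -> tors le_kn x -> tors le_kn y.
Proof. by move=> xy; apply: ztors_ann => b bx; apply: xy. Qed.

Section Fixed.
Variables (k : nat) (le_kn : (k <= n)%N) (M : lmodType U).
Local Notation phi := (corner C le_kn).
Local Notation E := (resm phi M).
Local Notation N := (resm (in_alg (Ugl C k)) E).

Let scale_lin (u : U) : linear (fun x : N => u *: (x : M) : N).
Proof.
move=> c x y.
change (u *: ((phi c%:A *: (x : M) : M) + (y : M)) = phi c%:A *: (u *: (x : M)) + u *: (y : M)).
by rewrite scalerDr !scalerA corner_alg mulr_algr mulr_algl.
Qed.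

Let tors_gen (x : M) a : tors le_kn x -> tors le_kn (gen (elem C a) *: x).
Proof.
move=> /ztors_fin[s sP]; apply/ztors_fin.
have [w [wz wP]] := center_exchange C le_kn.
exists (flatten [seq [seq ((phi u * gen (elem C a)) *: (y : M) : N) | y <- s] | u <- w]) => z /wP[c [cz cE]].
change (spn (flatten [seq [seq ((phi u * gen (elem C a)) *: (y : M) : N) | y <- s] | u <- w])
  (phi z *: (gen (elem C a) *: x) : N)).
rewrite scalerA cE scaler_suml.
set S := flatten _; elim/big_ind: _ => [|u v|i _]; [exact: (spnP S).1|exact: (submodD (spnP S))|].
rewrite -scalerA.
apply: spn_sub (spn_im (mk_linear (scale_lin _)) (sP _ (cz i))) => y yS.
apply/flattenP; eexists; last exact: yS.
by apply/mapP; exists (tnth (in_tuple w) i) => //; apply: mem_tnth.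
Qed.

(** By [center_exchange], [z] applied to a generator times [x] is a sum of fixed elements of U
    applied to vectors of the finite-dimensional space that the center generates from [x]. *)
Lemma tors_submod : submod (@tors k le_kn M).
Proof.
have add (x y : M) : tors le_kn x -> tors le_kn y -> tors le_kn (x + y) by apply: ztors_add.
have t0 : tors le_kn (0 : M) by exact: (ztors0 E).
have scal c (x : M) : tors le_kn x -> tors le_kn (c%:A *: x).
  by apply: tors_ann => u ux; rewrite scalerA mulr_algr -mulr_algl -scalerA ux scaler0.
split=> // u x y tx ty; apply: (add) => //; clear ty; elim/env_ind: u x tx.
elim=> [m|c|s IHs t IHt|s IHs t IHt] x tx.
- rewrite -[env_class _ _]/(gen m) gen_elem scaler_suml.
  elim/big_ind: _ => [||a _]; [exact: t0|exact: add|rewrite -mulr_algl -scalerA].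
  exact/scal/tors_gen.
- by rewrite env_classC; apply: scal.
- by rewrite env_classD scalerDl; apply: add; [apply: IHs|apply: IHt].
- by rewrite env_classM -scalerA; apply/IHs/IHt.
Qed.

End Fixed.
End TorsionSubmodule.

(** The module structures restricted in one step and in two steps agree pointwise but are not
    convertible. *)
Lemma baer_resm (A B D : pzRingType) (phi : {rmorphism A -> B}) (psi : {rmorphism B -> D})
    (chi : {rmorphism A -> D}) (M : lmodType D) (R : M -> Prop) :
  (forall a, chi a = psi (phi a)) ->
  baer (R : resm phi (resm psi M) -> Prop) -> baer (R : resm chi M -> Prop).
Proof.
move=> chiE Rb I f IP f_lin fR.
have [|e Re eE] := Rb I f IP _ fR.
  move=> a x y Ix Iy; rewrite (f_lin a x y Ix Iy).
  by change (chi a *: (f x : M) + f y = psi (phi a) *: (f x : M) + f y); rewrite chiE.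
by exists e => // a /eE ->; change (psi (phi a) *: (e : M) = chi a *: (e : M)); rewrite chiE.
Qed.

Lemma corner_comp (K : fieldType) (j k n : nat) (jk : (j <= k)%N) (kn : (k <= n)%N) (jn : (j <= n)%N)
  (u : Ugl K j) : corner K jn u = corner K kn (corner K jk u).
Proof.
elim/env_ind: u; elim=> [m|c|s IHs t IHt|s IHs t IHt].
- rewrite -[env_class _ _]/(env_gen (@mx_bracket K j) m) !corner_gen; congr env_gen.
  rewrite /gl_corner !mulmxA mul_pid_mx -[RHS]mulmxA mul_pid_mx.
  by rewrite (minn_idPl jk) (minn_idPr jk) (minn_idPr jk).
- by rewrite env_classC !corner_alg.
- by rewrite env_classD !rmorphD IHs IHt.
- by rewrite env_classM !rmorphM IHs IHt.
Qed.

(** * Descent along the chain of centers *)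

Section Descent.
Variables (C : numClosedFieldType) (n : nat).
Local Notation U := (Ugl C n).
Variables (J : nat -> lmodType U) (d : forall i, {linear J i -> J i.+1})
  (R : forall i, J i -> Prop).
Arguments R {i}.
Hypotheses (RP : forall i, submod (@R i))
  (dR : forall i (x : J i), R x -> R (d i x))
  (ddR : forall i (x : J i), R x -> d i.+1 (d i x) = 0)
  (d_exact : forall i (x : J i.+1), R x -> d i.+1 x = 0 -> exists2 y, R y & d i y = x)
  (R_baer : forall i, baer (@R i))
  (start : forall (x : J 0) k (le_kn : (k <= n)%N), R x -> d 0 x = 0 -> (0 < k)%N -> tors le_kn x).

Definition all_tors k (M : lmodType U) (x : M) : Prop :=
  forall j (le_jn : (j <= n)%N), (k <= j)%N -> tors le_jn x.

Lemma all_tors_submod k M : submod (@all_tors k M).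
Proof.
split=> [j le_jn _|a u v tu tv j le_jn kj]; first by case: (tors_submod le_jn M).
by apply (tors_submod le_jn M).2; [apply: tu|apply: tv].
Qed.

Let Rk k i (x : J i) := R x /\ all_tors k x.

Let RkP k i : submod (@Rk k i).
Proof. by apply: submodI => //; apply: all_tors_submod. Qed.

(** Torsion over Z_k is taken inside the part that is torsion over the larger centers, with scalars
    U_k, over which that part is injective and exact. *)
Let Rk_step k (le_kn : (k <= n)%N) : (0 < k)%N ->
  (forall i, baer (@Rk k.+1 i : resm (corner C le_kn) (J i) -> Prop)) ->
  (forall i (x : J i.+1), Rk k.+1 x -> d i.+1 x = 0 -> exists2 y, Rk k.+1 y & d i y = x) ->
  (forall i, baer (@Rk k i : resm (corner C le_kn) (J i) -> Prop)) /\
  (forall i (x : J i.+1), Rk k x -> d i.+1 x = 0 -> exists2 y, Rk k y & d i y = x).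
Proof.
move=> k_gt0 Rb ex.
have RkS i (x : J i) : Rk k x <-> Rk k.+1 x /\ tors le_kn x.
  split=> [[Rx tx]|[[Rx tx] tkx]].
    by split; [split=> // j le_jn kj; apply: tx; apply: ltnW|apply: tx].
  split=> // j le_jn; rewrite leq_eqVlt => /orP[/eqP kj|]; last exact: tx.
  by case: _ / kj le_jn => le_jn; rewrite (bool_irrelevance le_jn le_kn).
have RkE i : @Rk k i = fun x => Rk k.+1 x /\ tors le_kn x by apply: funext => x; apply/propext/RkS.
have Rtb i : baer (@Rk k i : resm (corner C le_kn) (J i) -> Prop).
  by rewrite RkE; apply: (@baer_ztors C k (resm (corner C le_kn) (J i)) (@Rk k.+1 i) (Rb i)).
split=> // i x Rx dx; have [Rx1 tx] := (RkS _ _).1 Rx.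
have t_ann a b (z : J a) (y : J b) : (forall u : U, u *: z = 0 -> u *: y = 0) ->
  all_tors k.+1 z -> all_tors k.+1 y.
  by move=> zy tz l le_ln kl; apply: tors_ann zy (tz l le_ln kl).
have [||i' z [Rz tz]|i' z [Rz tz]|i' z Rz dz|//||i' j z y zy|z [Rz _] dz|y [Ry ty yE]] := @torsion_exact (Ugl C k)
  (fun i => resm (corner C le_kn) (J i)) (fun i => res_linear (corner C le_kn) (d i)) (@Rk k.+1)
  (fun i => @tors C n k le_kn (J i)) _ _ _ _ _ _ _ _ _ i x Rx1 tx dx.
- by move=> i'; apply: submod_res.
- by move=> i'; apply: submod_res; apply: tors_submod.
- by split; [apply: dR|apply: t_ann tz => u uz; rewrite -[LHS]linearZ uz linear0].
- exact: ddR.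
- exact: ex.
- by move=> i'; have := Rtb i'; rewrite RkE.
- exact: ztors_ann.
- exact: start.
- by exists y => //; apply/RkS.
Qed.

Theorem all_tors_exact i (x : J i.+1) : R x -> all_tors 1 x -> d i.+1 x = 0 ->
  exists y, [/\ R y, all_tors 1 y & d i y = x].
Proof.
(* Injectivity is stated one level below the torsion: the part that is torsion over Z_j for [j >= k]
   is injective over U_(k-1), which is what the next step needs. *)
pose goal k := (forall l (le_ln : (l <= n)%N), k = l.+1 ->
    forall i, baer (@Rk k i : resm (corner C le_ln) (J i) -> Prop)) /\
  (forall i (x : J i.+1), Rk k x -> d i.+1 x = 0 -> exists2 y, Rk k y & d i y = x).
have top k : (n < k)%N -> forall i, @Rk k i = @R i.
  move=> nk j; apply: funext => z; apply/propext; split=> [[]|Rz] //.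
  by split=> // l le_ln kl; have := leq_trans nk (leq_trans kl le_ln); rewrite ltnn.
suff H k : (k <= n)%N -> goal (n - k).+1.
  move=> Rx tx dx; have [_ /(_ i x)] := H n (leqnn n); rewrite subnn => H1.
  by have [y [Ry ty] yE] := H1 (conj Rx tx) dx; exists y.
elim: k => [_|k IH kn].
  (* The corner map of gl_n into itself is the identity but not by conversion, so the base case also
     goes through [baer_restrict]. *)
  rewrite subn0; split=> [l le_ln _|] j; first by rewrite top //; apply: baer_restrict.
  by move=> z; rewrite !top //; apply: d_exact.
have nk : (0 < n - k)%N by rewrite subn_gt0.
have [Rb ex] := IH (ltnW kn).
have le_kn : (n - k <= n)%N by apply: leq_subr.
have [Rb' ex'] := Rk_step nk (Rb _ le_kn erefl) ex.
rewrite subnSK //; split=> [l le_ln kl j|]; last exact: ex'.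
have le_lk : (l <= n - k)%N by rewrite kl.
apply: (@baer_resm _ _ _ (corner C le_lk) (corner C le_kn)) => [u|]; first exact: corner_comp.
by apply: baer_restrict; [exact: (@submod_res _ _ (corner C le_kn) (J j) _ (RkP _ j))|exact: Rb'].
Qed.

End Descent.

(** * Coinduced modules *)

Section Coinduced.
Variables (K : fieldType) (n : nat) (N : lmodType (Ugl K n)).
Local Notation U := (Ugl K n).
Local Notation gen := (env_gen (@mx_bracket K n)).

(** Hom_K(U, N), with U acting through right multiplication of the argument; the action of U on [N]
    enters through [co_act], which commutes with it. *)
Record coind : Type := Coind { cofun :> U -> N;
  cofun_lin : forall (c : K) u v, cofun (c *: u + v) = c%:A *: cofun u + cofun v }.

Lemma coindP (f g : coind) : f =1 g -> f = g.
Proof.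
case: f g => [f fP] [g gP] /= /funext fg; subst g; congr Coind; exact: Prop_irrelevance.
Qed.

Lemma cofun0 (f : coind) : f 0 = 0.
Proof.
by have := cofun_lin f (-1) 0 0; rewrite scaler0 addr0 !scaleN1r addNr.
Qed.

Lemma cofunD (f : coind) u v : f (u + v) = f u + f v.
Proof. by rewrite -[u]scale1r cofun_lin !scale1r. Qed.

Lemma cofunZ (f : coind) (c : K) u : f (c *: u) = c%:A *: f u.
Proof. by rewrite -[c *: u]addr0 cofun_lin cofun0 addr0. Qed.

Lemma cofunB (f : coind) u v : f (u - v) = f u - f v.
Proof. by rewrite -[- v]scaleN1r cofunD cofunZ !scaleN1r. Qed.

Lemma cofun_sum (f : coind) I (r : seq I) (F : I -> U) : f (\sum_(i <- r) F i) = \sum_(i <- r) f (F i).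
Proof. by elim/big_rec2: _ => [|i u v _ <-]; rewrite ?cofun0 ?cofunD. Qed.

HB.instance Definition _ := gen_eqMixin coind.
HB.instance Definition _ := gen_choiceMixin coind.

Fact co_zero_lin (c : K) (u v : U) : 0 = c%:A *: 0 + 0 :> N.
Proof. by rewrite scaler0 addr0. Qed.
Definition co_zero := @Coind (fun=> 0) co_zero_lin.

Fact co_add_lin (f g : coind) (c : K) u v : f (c *: u + v) + g (c *: u + v) =
  c%:A *: (f u + g u) + (f v + g v).
Proof. by rewrite !cofun_lin scalerDr addrACA. Qed.
Definition co_add f g := Coind (co_add_lin f g).

Fact co_opp_lin (f : coind) (c : K) u v : - f (c *: u + v) = c%:A *: - f u + - f v.
Proof. by rewrite cofun_lin opprD scalerN. Qed.
Definition co_opp f := Coind (co_opp_lin f).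

Fact co_scale_lin a (f : coind) (c : K) u v : f ((c *: u + v) * a) = c%:A *: f (u * a) + f (v * a).
Proof. by rewrite mulrDl -scalerAl cofun_lin. Qed.
Definition co_scale a f := Coind (co_scale_lin a f).

Fact co_addA : associative co_add.
Proof. by move=> f g h; apply: coindP => u; apply: addrA. Qed.
Fact co_addC : commutative co_add.
Proof. by move=> f g; apply: coindP => u; apply: addrC. Qed.
Fact co_add0 : left_id co_zero co_add.
Proof. by move=> f; apply: coindP => u; apply: add0r. Qed.
Fact co_addN : left_inverse co_zero co_opp co_add.
Proof. by move=> f; apply: coindP => u; apply: addNr. Qed.
HB.instance Definition _ := GRing.isZmodule.Build coind co_addA co_addC co_add0 co_addN.

Fact co_scaleA a b f : co_scale a (co_scale b f) = co_scale (a * b) f.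
Proof. by apply: coindP => u /=; rewrite mulrA. Qed.
Fact co_scale1 : left_id 1 co_scale.
Proof. by move=> f; apply: coindP => u /=; rewrite mulr1. Qed.
Fact co_scaleDr : right_distributive co_scale +%R.
Proof. by move=> a f g; apply: coindP. Qed.
Fact co_scaleDl f : {morph co_scale^~ f : a b / a + b}.
Proof. by move=> a b; apply: coindP => u /=; rewrite mulrDr cofunD. Qed.
HB.instance Definition _ :=
  GRing.Zmodule_isLmodule.Build U coind co_scaleA co_scale1 co_scaleDr co_scaleDl.

Lemma coDE (f g : coind) u : (f + g) u = f u + g u. Proof. by []. Qed.
Lemma coNE (f : coind) u : (- f) u = - f u. Proof. by []. Qed.
Lemma coZE a (f : coind) u : (a *: f) u = f (u * a). Proof. by []. Qed.
Lemma coAE (c : K) (f : coind) u : (c%:A *: f) u = c%:A *: f u.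
Proof. by rewrite coZE mulr_algr cofunZ. Qed.

Lemma co_sumE I (r : seq I) (F : I -> coind) u : (\sum_(i <- r) F i) u = \sum_(i <- r) F i u.
Proof. by elim/big_rec2: _ => // i x y _ <-. Qed.

(** Evaluation at 1 turns U-linear maps into Hom_K(U, N) into [K]-linear maps into [N], and these
    always extend. *)
Lemma baer_coind : baer (fun _ : coind => True).
Proof.
move=> I f IP f_lin _; pose NK : lmodType K := resm (in_alg U) N.
have Isub : @submod K U I.
  by split=> [|c u v Iu Iv]; [case: IP|rewrite -mulr_algl; apply: IP.2].
have f0 : f 0 = 0.
  by have := f_lin (-1) 0 0 IP.1 IP.1; rewrite mulr0 addr0 scaleN1r addNr.
have [||g [gE _]] := @baer_extend K U NK I (fun=> True) (fun u => f u 1) Isub (@submodT _ _) (@baer_field _ _).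
- move=> c u v Iu Iv; rewrite -mulr_algl f_lin // coDE coZE mul1r -[c%:A]mulr1 mulr_algl cofunZ.
  by [].
- by [].
have g_lin (c : K) u v : g (c *: u + v) = c%:A *: (g u : N) + g v by rewrite linearP.
exists (@Coind g g_lin) => // a Ia; apply: coindP => w; rewrite coZE /=.
have Iwa : I (w * a) by have := IP.2 w _ _ Ia IP.1; rewrite addr0.
rewrite gE //; have := f_lin w _ _ Ia IP.1; rewrite addr0 f0 addr0 => ->.
by rewrite coZE mul1r.
Qed.

Fact co_act_lin x (f : coind) (c : K) u v : gen x *: f (c *: u + v) - f (gen x * (c *: u + v)) =
  c%:A *: (gen x *: f u - f (gen x * u)) + (gen x *: f v - f (gen x * v)).
Proof.
rewrite mulrDr -scalerAr !cofun_lin scalerDr !scalerA mulr_algr scalerBr scalerA mulr_algl.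
by rewrite opprD addrACA.
Qed.
(** Its invariants are the U-linear maps from U to [N], a copy of [N]; hence the Chevalley-Eilenberg
    complex of this action begins with [N]. *)
Definition co_act x f := Coind (co_act_lin x f).

Lemma co_actE x (f : coind) u : co_act x f u = gen x *: f u - f (gen x * u).
Proof. by []. Qed.

Lemma co_act_linear x : linear (co_act x).
Proof.
move=> a f g; apply: coindP => u.
rewrite co_actE !coDE !coZE scalerDr -mulrA !co_actE opprD addrACA.
by [].
Qed.

Lemma co_act_linl (c : K) x y (f : coind) :
  co_act (c *: x + y) f = c%:A *: co_act x f + co_act y f.
Proof.
apply: coindP => u; rewrite coDE coAE !co_actE gen_lin mulrDl -scalerAl cofun_lin scalerDl.
by rewrite -[c *: gen x]mulr_algl -scalerA scalerBr opprD addrACA.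
Qed.

Lemma co_act_br x y (f : coind) :
  co_act (mx_bracket x y) f = co_act x (co_act y f) - co_act y (co_act x f).
Proof.
apply: coindP => u; rewrite coDE coNE !co_actE gen_br mulrBl cofunB scalerBl -!scalerA !mulrA.
rewrite !scalerBr !opprB addrACA [RHS]addrACA !subrKA [RHS]addrACA.
by congr (_ + _); rewrite addrC.
Qed.

Fact co_unit_lin (m : N) (c : K) (u v : U) : (c *: u + v) *: m = c%:A *: (u *: m) + v *: m.
Proof. by rewrite scalerDl -[c *: u]mulr_algl -scalerA. Qed.
Definition co_unit (m : N) := Coind (co_unit_lin m).

Lemma co_unit_linear : linear co_unit.
Proof.
by move=> a m m'; apply: coindP => u; rewrite coDE coZE /= scalerDr scalerA.
Qed.

Lemma co_unit_inj m : co_unit m = 0 -> m = 0.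
Proof. by move=> /(congr1 (fun f : coind => f 1)) /=; rewrite scale1r. Qed.

Lemma co_act_unit x m : co_act x (co_unit m) = 0.
Proof. by apply: coindP => u; rewrite co_actE /= scalerA subrr. Qed.

Lemma co_act0 (f : coind) : (forall x, co_act x f = 0) -> exists m, co_unit m = f.
Proof.
move=> f0; exists (f 1).
suff H u w : f (u * w) = u *: f w by apply: coindP => u; rewrite -[u]mulr1 H mulr1.
elim/env_ind: u w; elim=> [x|c|s IHs t IHt|s IHs t IHt] w.
- apply/eqP; rewrite eq_sym -subr_eq0; apply/eqP.
  by have := congr1 (fun f : coind => f w) (f0 x).
- by rewrite env_classC mulr_algl cofunZ.
- by rewrite env_classD mulrDl cofunD IHs IHt scalerDl.
- by rewrite env_classM -mulrA IHs IHt scalerA.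
Qed.

Section Filtration.
Variables (D : nat) (b : 'I_D -> 'M[K]_n) (xi : 'I_D -> 'M[K]_n -> K).
Hypotheses (xi_lin : forall j c x y, xi j (c *: x + y) = c * xi j x + xi j y)
  (coordE : forall x, x = \sum_j xi j x *: b j)
  (xi_b : forall j l, xi j (b l) = (j == l)%:R).
Local Notation P := (mpoly D K).
Local Notation q := (ord_map (fun j => gen (b j))).
Local Notation fil := (fil (fun j => gen (b j))).
Local Notation coord := (pbw_coord coordE).
Local Notation coordK := (pbw_coordK coordE).
Local Notation qK := (ord_mapK xi_lin coordE xi_b).
Local Notation mulq := (mul_ord_map (U_comm coordE)).

(** The orthogonal of the PBW filtration. It is separated and complete because U is the union of its
    parts of bounded degree. *)
Definition cofil p (f : coind) : Prop := forall u, fil p u -> f u = 0.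

Definition dq j (u : U) : U := q (mderiv j (coord u)).

Lemma dq_linear j : linear (dq j).
Proof. by move=> c u v; rewrite /dq pbw_coord_linear // mderivD mderivZ ord_mapD ord_mapZ. Qed.

Lemma dqZ j (c : K) u : dq j (c *: u) = c *: dq j u.
Proof. exact: (linearZ_LR (mk_linear (dq_linear j))). Qed.

Lemma dq_sum j I (r : seq I) (F : I -> U) : dq j (\sum_(i <- r) F i) = \sum_(i <- r) dq j (F i).
Proof. exact: (linear_sum (mk_linear (dq_linear j))). Qed.

Fact co_del_lin j (f : coind) (c : K) u v :
  f (dq j (c *: u + v)) = c%:A *: f (dq j u) + f (dq j v).
Proof. by rewrite dq_linear cofun_lin. Qed.
Definition co_del j f := Coind (co_del_lin j f).

Let dqK j f : dq j (q f) = q (mderiv j f).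
Proof. by congr (q (mderiv j _)); exact: qK. Qed.

Let dq_fil j p u : fil p.+1 u -> fil p (dq j u).
Proof. by move=> [f fp ->]; exists (mderiv j f); [exact: msize_mderiv|exact: dqK]. Qed.

Let mul_fil x p u : fil p u -> fil p.+1 (gen x * u).
Proof.
move=> [f fp ->]; rewrite (gen_coord coordE) mulr_suml; apply: fil_sum => j _.
rewrite -scalerAl; apply: filZ; rewrite -[_ * _](subrK (q ('XX_j * f))); apply: filD.
  by apply: fil_le (mulq j f); apply: ltnW.
by exists ('XX_j * f) => //; rewrite -(lin_b xi_b); apply: msize_linM.
Qed.

Let dq_mul l j p u : fil p.+1 u ->
  fil p (gen (b l) * dq j u - dq j (gen (b l) * u) + (j == l)%:R *: u).
Proof.
move=> [f fp ->]; rewrite dqK.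
have dfp := msize_mderiv j fp.
have [g gp gE] := mulq l f; have [h hp hE] := mulq l (mderiv j f).
have {gE}gE : gen (b l) * q f = q ('XX_l * f + g) by rewrite ord_mapD -gE addrC subrK.
have {hE}hE : gen (b l) * q (mderiv j f) = q ('XX_l * mderiv j f + h) by rewrite ord_mapD -hE addrC subrK.
rewrite gE dqK hE -ord_mapB -ord_mapZ -ord_mapD; eexists; last by [].
have -> : 'XX_l * mderiv j f + h - mderiv j ('XX_l * f + g) + (j == l)%:R *: f = h - mderiv j g.
  rewrite mderivD mderivM mderivX mnm1E eq_sym.
  case: eqP => [->|_]; last by rewrite !scale0r mul0r; ring.
  have -> : mnm_sub (mnm1 l) (mnm1 l) = mnm0 by apply/mnmP => i; rewrite mnmBE mnm0E subnn.
  by rewrite mpolyX0 !scale1r; ring.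
apply: msizeD_leq; first exact: leq_trans hp dfp.
by rewrite msizeN; apply: msize_mderiv; apply: leq_trans gp fp.
Qed.

(** The transpose of [dq_mul]: up to lower degree, multiplication by generators and partial
    derivatives commute as in the Weyl algebra. *)
Lemma co_del_act j x p f : cofil p f -> cofil p.+1
  (co_act x (co_del j f) - co_del j (co_act x f) + (xi j x)%:A *: f).
Proof.
move=> fp u up; rewrite !coDE coNE coAE !co_actE /= opprB [X in X + _]addrC subrKA.
have -> : f (gen x * dq j u) - f (dq j (gen x * u)) + (xi j x)%:A *: f u =
    f (\sum_l xi l x *: (gen (b l) * dq j u - dq j (gen (b l) * u) + (j == l)%:R *: u)).
  rewrite -cofunZ -cofunB -cofunD; congr (f _).
  rewrite (eq_bigr (fun l => (xi l x *: gen (b l)) * dq j u - dq j (xi l x *: gen (b l) * u) +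
      (j == l)%:R *: (xi l x *: u))); last first.
    move=> l _; rewrite -!scalerAl scalerDr scalerBr !scalerA [xi l x * _]mulrC.
    by congr (_ - _ + _); rewrite dqZ.
  rewrite big_split /= sumrB -dq_sum -!mulr_suml -gen_coord // [X in _ = _ + X](bigD1 j) //= eqxx scale1r.
  rewrite [X in _ = _ + (_ + X)]big1 ?addr0 // => l; rewrite eq_sym => /negPf ->.
  by rewrite scale0r.
apply: fp; apply: fil_sum => l _; apply: filZ; exact: dq_mul.
Qed.

(** The summand of [co_act] that acts on [N] meets [f] only in degrees below [p], where [f]
    vanishes. What remains is minus the transpose of the Euler operator, equal to minus [p] in
    degree [p], the only degree on which [f] still depends. *)
Lemma co_euler p f : cofil p f -> cofil p.+1 (\sum_j co_del j (co_act (b j) f) + p%:R *: f).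
Proof.
move=> fp u up; rewrite coDE co_sumE coZE mulr_natr.
have -> : \sum_j co_del j (co_act (b j) f) u = - f (\sum_j gen (b j) * dq j u).
  rewrite cofun_sum -sumrN; apply: eq_bigr => j _ /=.
  by rewrite (fp (dq j u)) ?scaler0 ?sub0r //; apply: dq_fil.
rewrite addrC -cofunB; apply: fp; case: up => g gp ->.
have -> : q g *+ p - \sum_j gen (b j) * dq j (q g) =
   q (g *+ p - \sum_j 'XX_j * mderiv j g) -
   \sum_j (gen (b j) * q (mderiv j g) - q ('XX_j * mderiv j g)).
  rewrite ord_mapB ord_map_sum sumrB opprB addrA subrK; congr (_ - _).
    by rewrite -!scaler_nat ord_mapZ.
  by apply: eq_bigr => j _; rewrite dqK.
apply: filB; last first.
  by apply: fil_sum => j _; apply: fil_le (mulq j _); apply: msize_mderiv.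
exists (g *+ p - \sum_j 'XX_j * mderiv j g) => //.
have X j m : 'XX_j * mderiv j (mpolyX K m) = (m j)%:R *: mpolyX K m.
  rewrite mderivX -scalerAr -mpolyXD; have [->|mj] := posnP (m j); first by rewrite !scale0r.
  congr (_ *: mpolyX K _); apply/mnmP => i; rewrite mnmDE mnmBE mnm1E.
  by case: eqP => [<-|_]; rewrite ?subn0 // subnKC.
have -> : g *+ p - \sum_j 'XX_j * mderiv j g = \sum_(m <- msupp g) (g@^m * (p%:R - (mdeg m)%:R)) *: mpolyX K m.
  rewrite (eq_bigr (fun j => \sum_(m <- msupp g) g@^m *: ((m j)%:R *: mpolyX K m))).
    rewrite exchange_big {1}[g]mpolyE -sumrMnl -sumrB; apply: eq_bigr => m _.
    by rewrite -scaler_sumr -scaler_suml -natr_sum -mdegE -scaler_nat !scalerA -scalerBl mulrBr [g@^m * p%:R]mulrC.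
  move=> j _; rewrite {1}[g]mpolyE raddf_sum mulr_sumr; apply: eq_bigr => m _.
  by rewrite /= mderivZ -scalerAr X.
rewrite big_seq; apply: msize_sum_leq => m /msize_mdeg_lt/leq_trans/(_ gp); rewrite ltnS leq_eqVlt.
case/orP => [/eqP <-|mp]; first by rewrite subrr mulr0 scale0r msize0.
by apply: leq_trans (msizeZ_le _ _) _; rewrite msizeX.
Qed.

Lemma cofil_del j p f : cofil p f -> cofil p.+1 (co_del j f).
Proof. by move=> fp u up; apply/fp/dq_fil. Qed.

Lemma cofil_sep f : (forall p, cofil p f) -> f = 0.
Proof.
move=> fp; apply: coindP => u; apply: (fp (msize (coord u))).
by exists (coord u); rewrite ?coordK.
Qed.

Lemma cofil_act x p f : cofil p.+1 f -> cofil p (co_act x f).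
Proof.
move=> fp u up; rewrite co_actE (fp u) ?scaler0 ?sub0r ?fp ?oppr0 //; first exact: mul_fil.
exact: fil_le up.
Qed.

Lemma cofil_complete (s : nat -> coind) : (forall p, cofil p.+1 (s p.+1 - s p)) ->
  exists f, forall p, cofil p.+1 (f - s p).
Proof.
move=> sP.
have st p k u : fil p.+1 u -> s (k + p)%N u = s p u.
  move=> up; elim: k => [//|k <-]; apply/subr0_eq; have := sP (k + p)%N u; apply.
  by apply: fil_le up; rewrite ltnS leq_addl.
have coordF u : fil (msize (coord u)).+1 u by exists (coord u); rewrite ?coordK.
have sE u p : fil p.+1 u -> s (msize (coord u)) u = s p u.
  by move=> up; rewrite -(st _ p u (coordF u)) addnC st.
(* The limit is evaluated at an index depending on [u]; by [sE] a larger index gives the same value,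
   in particular one common to [u], [v] and their combination. *)
have f_lin (c : K) u v : s (msize (coord (c *: u + v))) (c *: u + v) =
    c%:A *: s (msize (coord u)) u + s (msize (coord v)) v.
  pose p := (msize (coord u) + msize (coord v))%N.
  have up : fil p.+1 u by apply: fil_le (coordF u); rewrite ltnS leq_addr.
  have vp : fil p.+1 v by apply: fil_le (coordF v); rewrite ltnS leq_addl.
  rewrite !(sE _ p) //; last exact: fil_lin.
  exact: cofun_lin.
by exists (Coind f_lin) => p u up; rewrite coDE coNE /= (sE u p) ?subrr.
Qed.

End Filtration.
End Coinduced.

(** * Gelfand-Zeitlin modules as torsion modules *)

Section GZTorsion.
Variables (C : numClosedFieldType) (n : nat) (M : lmodType (Ugl C n)).
Local Notation U := (Ugl C n).
Local Notation N := (resm (in_alg U) M).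

Lemma tors_span k (le_kn : (k <= n)%N) (x : M) : tors le_kn x <->
  exists zs : seq (Ugl C k), (forall z, z \in zs -> in_center z) /\
    forall z, in_center z -> spn [seq (corner C le_kn y *: x : N) | y <- zs] (corner C le_kn z *: x : N).
Proof.
split=> [[zs [zsz zsP]]|[zs [zsz zsP]]]; exists zs; split=> // z zz.
  have [y zsy E] := zsP z zz; rewrite -[corner C le_kn z *: x]/(z *: (x : resm (corner C le_kn) M)) E.
  have f_lin : linear (fun b : Ugl C k => corner C le_kn b *: x : N).
    move=> c u v; change (corner C le_kn (c *: u + v) *: x = c%:A *: (corner C le_kn u *: x) + corner C le_kn v *: x).
    by rewrite rmorphD scalerDl cornerZ -[c *: corner C le_kn u]mulr_algl -scalerA.
  exact: (spn_im (mk_linear f_lin) zsy).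
have [a E] := spn_map (zsP z zz).
exists (\sum_i a i *: tnth (in_tuple zs) i).
  elim/big_ind: _ => [|u v|i _]; [exact: (spnP zs).1|exact: (submodD (spnP zs))|].
  by apply: (submodZ _ (spnP zs)); apply/spn_mem/mem_tnth.
change (corner C le_kn z *: x = corner C le_kn (\sum_i a i *: tnth (in_tuple zs) i) *: x).
rewrite E rmorph_sum scaler_suml; apply: eq_bigr => i _.
by rewrite cornerZ -[a i *: corner _ _ _]mulr_algl -scalerA.
Qed.

Let scale_lin (u : U) : (forall c : C, u * c%:A = c%:A * u) -> linear (fun x : N => u *: (x : M) : N).
Proof.
move=> uc c x y; change (u *: (c%:A *: (x : M) + (y : M)) = c%:A *: (u *: (x : M)) + u *: (y : M)).
by rewrite scalerDr !scalerA uc.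
Qed.

Let algC (u : U) (c : C) : u * c%:A = c%:A * u. Proof. by rewrite mulr_algr mulr_algl. Qed.

Let stable (s : seq N) (u : U) := forall x : N, spn s x -> spn s (u *: (x : M)).

Let stable_gen s u (t : seq N) : (forall x : N, x \in s -> spn t (u *: (x : M))) ->
  forall x : N, spn s x -> spn t (u *: (x : M)).
Proof.
move=> su; apply: spn_min => //.
exact: (submod_preim (mk_linear (scale_lin (algC u))) (spnP t)).
Qed.

Let comm j k (le_jn : (j <= n)%N) (le_kn : (k <= n)%N) (y : Ugl C j) (z : Ugl C k) :
  (j <= k)%N -> in_center z ->
  corner C le_jn y * corner C le_kn z = corner C le_kn z * corner C le_jn y.
Proof. by move=> jk zz; rewrite (corner_comp jk le_kn le_jn) -!rmorphM zz. Qed.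

(* Z_j commutes with the image of Z_k for k <= j, so Z_j W is Z_k-stable when W is. *)
Lemma stable_span (s : seq N) j : (forall x : M, all_tors 1 x) -> (j <= n)%N ->
  exists2 t : seq N, forall x : N, x \in s -> spn t x &
    forall k (le_kn : (k <= n)%N), (0 < k <= j)%N -> forall z, in_center z -> stable t (corner C le_kn z).
Proof.
move=> Mt; elim: j => [|j IH] lt_jn.
  by exists s => [x|k le_kn]; [apply: spn_mem|rewrite lt0n leqn0; case: eqP].
have [t st tP] := IH (ltnW lt_jn).
have /choice[zs zsP] : forall x : M, exists zs : seq (Ugl C j.+1), (forall z, z \in zs -> in_center z) /\
    forall z, in_center z -> spn [seq (corner C lt_jn y *: x : N) | y <- zs] (corner C lt_jn z *: x : N).
  by move=> x; apply/tors_span; apply: Mt.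
pose t' : seq N := flatten [seq [seq (corner C lt_jn y *: (x : M) : N) | y <- zs x] | x <- t].
have t'P z : in_center z -> forall x : N, spn t x -> spn t' (corner C lt_jn z *: (x : M)).
  move=> zz; apply: stable_gen => x xt; apply: spn_sub ((zsP x).2 z zz) => u ux.
  by apply/flattenP; exists [seq (corner C lt_jn y *: (x : M) : N) | y <- zs x] => //; apply: map_f.
have one : in_center (1 : Ugl C j.+1) by move=> u; rewrite mulr1 mul1r.
exists t' => [x /st xt|k le_kn /andP[k_gt0 le_kj] z zz].
  by have := t'P 1 one x xt; rewrite rmorph1 scale1r.
apply: stable_gen => _ /flattenP[_ /mapP[x xt ->] /mapP[y /(zsP x).1 yz ->]].
rewrite scalerA comm // -scalerA; move: le_kj; rewrite leq_eqVlt => /orP[/eqP kj|lt_kj]; last first.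
  by apply: t'P => //; apply: tP; [rewrite k_gt0|done|apply: spn_mem].
subst k; rewrite (bool_irrelevance le_kn lt_jn) scalerA -rmorphM.
by apply: t'P; [apply: in_centerM|apply: spn_mem].
Qed.

(** Gamma contains each Z_k. Conversely, multiplying in turn by Z_1, ..., Z_n enlarges the line
    through [v] to a finite-dimensional space stable under all Z_k; the elements of U preserving it
    form a subalgebra, which therefore contains Gamma. *)
Theorem GZ_torsP : GZ_locally_finite M <-> forall x : M, all_tors 1 x.
Proof.
split=> [lf x k le_kn k_gt0|Mt v].
  have [m [h [hG hP]]] := lf x.
  apply/ztors_fin; exists [seq (h i *: x : resm (in_alg (Ugl C k)) (resm (corner C le_kn) M)) | i <- enum 'I_m] => z zz.
  have [|c E] := hP (corner C le_kn z).
    by move=> S SP SZ; apply: (SZ k z); rewrite ?k_gt0.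
  change (spn [seq (h i *: x : resm (in_alg (Ugl C k)) (resm (corner C le_kn) M)) | i <- enum 'I_m]
    (corner C le_kn z *: x : M)).
  rewrite E; set S := map _ _.
  elim/big_ind: _ => [|u w|i _]; [exact: (spnP S).1|exact: (submodD (spnP S))|].
  rewrite -(corner_alg le_kn); apply: (submodZ (c i) (spnP S)); apply: spn_mem.
  by apply: map_f; rewrite mem_enum.
have [t vt tP] := @stable_span [:: (v : N)] n Mt (leqnn n).
pose S : {pred U} := fun g => `[< stable t g >].
have SG g : in_GZ_subalgebra g -> spn t (g *: v : N).
  move=> /(_ S) gS; suff /asboolP : g \in S by apply; apply: vt; apply: mem_head.
  apply: gS => [|k z kn zz]; last first.
    by have /andP[_ le_kn] := kn; apply/asboolP; apply: (tP k le_kn).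
  split=> [|c u w /asboolP uS /asboolP wS|u w /asboolP uS /asboolP wS]; apply/asboolP => x xt.
  - by rewrite scale1r.
  - rewrite scalerDl -[c *: u]mulr_algl -scalerA.
    exact: (submodD (spnP t) (submodZ c (spnP t) (uS x xt)) (wS x xt)).
  - by rewrite -scalerA; apply/uS/wS.
have [s [sG sP]] := @fg_family C N _ U (fun g => g *: v : N) _
  (noeth_spn (s := t) (@noeth_field C)) (spnP t) SG.
exists (size s), (tnth (in_tuple s)); split=> [i|g /sP/spn_map[a ->]]; first exact/sG/mem_tnth.
by exists a.
Qed.

End GZTorsion.

Section MatrixBracket.
Variables (K : fieldType) (n : nat).
Local Notation br := (@mx_bracket K n).

Lemma mx_bracket_linl c x y z : br (c *: x + y) z = c *: br x z + br y z.
Proof.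
by rewrite /mx_bracket mulmxDl mulmxDr -scalemxAl -scalemxAr scalerBr opprD addrACA.
Qed.

Lemma mx_bracket_linr c x y z : br z (c *: x + y) = c *: br z x + br z y.
Proof.
by rewrite /mx_bracket mulmxDl mulmxDr -scalemxAl -scalemxAr scalerBr opprD addrACA.
Qed.

Lemma mx_bracketxx x : br x x = 0. Proof. exact: subrr. Qed.

Lemma mx_bracket_jac x y z : br x (br y z) = br (br x y) z + br y (br x z).
Proof.
rewrite /mx_bracket !(mulmxBl, mulmxBr) !mulmxA !opprB.
by rewrite [RHS]addrACA !subrKA addrACA [RHS]addrACA [- _ - _ in RHS]addrC.
Qed.

(* The sum is the trace of ad x, which may be computed in the basis of elementary matrices. *)
Lemma mx_bracket_unimod (D : nat) (b : 'I_D -> 'M[K]_n) (xi : 'I_D -> 'M[K]_n -> K) :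
  (forall j c x y, xi j (c *: x + y) = c * xi j x + xi j y) ->
  (forall x, x = \sum_j xi j x *: b j) -> (forall j l, xi j (b l) = (j == l)%:R) ->
  forall x, \sum_k xi k (br x (b k)) = 0.
Proof.
move=> xi_lin coordE xi_b x.
have xi0 j : xi j 0 = 0.
  by have := xi_lin j (-1) 0 0; rewrite scaler0 addr0 mulN1r addNr.
have xi_sum j I (r : seq I) (F : I -> 'M[K]_n) (c : I -> K) :
    xi j (\sum_(i <- r) c i *: F i) = \sum_(i <- r) c i * xi j (F i).
  by elim/big_rec2: _ => [|i u v _ <-]; [exact: xi0|exact: xi_lin].
pose E (a : 'I_n * 'I_n) : 'M[K]_n := delta_mx a.1 a.2.
have EE (y : 'M[K]_n) : y = \sum_a y a.1 a.2 *: E a by rewrite {1}(matrix_sum_delta y) pair_bigA.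
have tr (f : 'M[K]_n -> 'M[K]_n) : linear f -> \sum_k xi k (f (b k)) = \sum_a f (E a) a.1 a.2.
  move=> f_lin.
  have f_sum I (r : seq I) (F : I -> 'M[K]_n) (c : I -> K) :
      f (\sum_(i <- r) c i *: F i) = \sum_(i <- r) c i *: f (F i).
    have f0 : f 0 = 0 by have := f_lin (-1) 0 0; rewrite !scaleN1r oppr0 addr0 addNr.
    by elim/big_rec2: _ => [|i u v _ <-]; [exact: f0|exact: f_lin].
  transitivity (\sum_k \sum_a b k a.1 a.2 * xi k (f (E a))).
    by apply: eq_bigr => k _; rewrite {1}(EE (b k)) f_sum xi_sum.
  rewrite exchange_big; apply: eq_bigr => a _.
  rewrite [in RHS](coordE (f (E a))) summxE; apply: eq_bigr => k _.
  by rewrite mxE mulrC.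
rewrite (tr (br x)); last by move=> c u v; apply: mx_bracket_linr.
rewrite -(pair_bigA _ (fun i j => br x (delta_mx i j) i j)) /=.
rewrite (eq_bigr (fun i => \sum_j (x i i - x j j))); last first.
  move=> i _; apply: eq_bigr => j _; rewrite !mxE; congr (_ - _).
    rewrite (bigD1 i) //= big1 ?addr0 => [|l /negPf li]; first by rewrite mxE !eqxx mulr1.
    by rewrite mxE li mulr0.
  rewrite (bigD1 j) //= big1 ?addr0 => [|l /negPf lj]; first by rewrite mxE !eqxx mul1r.
  by rewrite mxE lj andbF mul0r.
rewrite (eq_bigr (fun i => \sum_(j < n) x i i - \sum_(j < n) x j j)); last by move=> i _; rewrite sumrB.
by rewrite sumrB [X in _ - X]exchange_big subrr.
Qed.

End MatrixBracket.

Section CoinducedResolution.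
Variables (C : numClosedFieldType) (n D : nat).
Variables (b : 'I_D -> 'M[C]_n) (xi : 'I_D -> 'M[C]_n -> C).
Hypotheses (xi_lin : forall j c x y, xi j (c *: x + y) = c * xi j x + xi j y)
  (coordE : forall x, x = \sum_j xi j x *: b j)
  (xi_b : forall j l, xi j (b l) = (j == l)%:R).
Local Notation U := (Ugl C n).
Local Notation gen := (env_gen (@mx_bracket C n)).
Local Notation br := (@mx_bracket C n).
Local Notation "''J' N" := (ML 'M[C]_n (coind N)) (at level 8, N at level 2).

Section OneModule.
Variable N : lmodType U.
Local Notation rho := (@co_act C n N).

Definition ce i : {linear 'J N i -> 'J N i.+1} :=
  mk_linear (dCE_linear br (@co_act_linear C n N) (i := i)).

Definition ce_unit : {linear N -> 'J N 0} := mk_linear (@co_unit_linear C n N).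

Let rho_linl (c : C) x y f := @co_act_linl C n N c x y f.

Lemma ce_alt i (f : 'J N i) : alt f -> alt (ce i f).
Proof.
exact: (alt_dCE (@mx_bracket_linl C n) (@mx_bracket_linr C n) (@mx_bracketxx C n)
  (@co_act_linear C n N) rho_linl).
Qed.

Lemma ce_ce i (f : 'J N i) : alt f -> ce i.+1 (ce i f) = 0.
Proof. exact: (dCE_dCE (@mx_bracket_jac C n) (@co_act_linear C n N) (@co_act_br C n N)). Qed.

Lemma ce_exact i (f : 'J N i.+1) : alt f -> ce i.+1 f = 0 -> exists2 g, alt g & ce i g = f.
Proof.
move=> fP df.
have := @dCE_exact C 'M[C]_n br (@mx_bracket_linl C n) (@mx_bracket_linr C n) (@mx_bracketxx C n)
  (@mx_bracket_jac C n) U (coind N) rho (@co_act_linear C n N) rho_linl (@co_act_br C n N) D b xi coordE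
  (@cofil C n N D b) (@co_del C n N D b xi xi_lin coordE xi_b).
apply=> //.
- by move=> m u [g]; rewrite leqn0 msize_poly_eq0 => /eqP -> ->; rewrite ord_map0 cofun0.
- by move=> p m mp u up; apply: mp; apply: fil_le up.
- by move=> p c m m' mp mp' u up; rewrite coDE coAE mp // mp' // scaler0 addr0.
- move=> j c m m'; apply: coindP => u; rewrite coDE coAE.
  by change ((c%:A *: m + m') (dq coordE j u) = c%:A *: m (dq coordE j u) + m' (dq coordE j u)); rewrite coDE coAE.
- exact: cofil_del.
- exact: co_del_act.
- exact: co_euler.
- exact: cofil_act.
- exact: cofil_complete.
- exact: cofil_sep.
Qed.

End OneModule.
End CoinducedResolution.

(** * The trivial module *)

Section Augmentation.
Variables (C : numClosedFieldType) (n : nat).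
Local Notation U := (Ugl C n).
Local Notation gen := (env_gen (@mx_bracket C n)).

Lemma aug_lie_hom : lie_hom (@mx_bracket C n) (fun _ => 0 : C^o).
Proof. by split=> [a x y|x y]; rewrite ?scaler0 ?addr0 // mulr0 subrr. Qed.

Definition aug_fun : U -> C^o := env_lift (fun _ : 'M[C]_n => 0 : C^o).

Lemma aug_props : [/\ linear aug_fun, aug_fun 1 = 1, {morph aug_fun : u v / u * v} &
  forall x, aug_fun (gen x) = 0].
Proof. by have [] := env_lift_universal aug_lie_hom. Qed.

Lemma aug_linear : linear aug_fun. Proof. by case: aug_props. Qed.

Fact aug_zmod : zmod_morphism (aug_fun : U -> C).
Proof. by move=> u v; rewrite addrC -scaleN1r aug_linear scaleN1r addrC. Qed.

Fact aug_monoid : monoid_morphism (aug_fun : U -> C). Proof. by case: aug_props. Qed.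

Definition aug : {rmorphism U -> C} :=
  HB.pack (aug_fun : U -> C) (GRing.isZmodMorphism.Build _ _ _ aug_zmod)
    (GRing.isMonoidMorphism.Build _ _ _ aug_monoid).

Lemma aug_gen x : aug (gen x) = 0. Proof. by have [_ _ _ augg] := aug_props; apply: augg. Qed.

Lemma aug_alg (c : C) : aug c%:A = c.
Proof.
have := aug_linear c 1 0; rewrite addr0 => /(congr1 (fun z : C => z)) E.
have [_ a1 _ _] := aug_props; have a0 : aug_fun 0 = 0 := rmorph0 aug.
by change (aug_fun c%:A = c); rewrite E a0 addr0 a1; apply: mulr1.
Qed.

Definition triv : lmodType U := resm aug C^o.

Lemma trivE u (m : triv) : u *: m = (aug u)%:A *: m.
Proof. by change (aug u * m = aug (aug u)%:A * m); rewrite aug_alg. Qed.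

(** Invariance under right multiplication makes [f] factor through the augmentation, which is also
    how U acts on [f 1]. *)
Lemma coind_invariant (f : coind triv) : (forall x, gen x *: f = 0) -> co_unit (f 1) = f.
Proof.
move=> f0.
suff H u v : f (v * u) = u *: f v by apply: coindP => u; rewrite -[u in RHS]mul1r H.
elim/env_ind: u v; elim=> [x|c|s IHs r IHr|s IHs r IHr] v.
- rewrite -[env_class _ _]/(gen x) trivE aug_gen scale0r scale0r.
  by have := congr1 (fun g : coind triv => g v) (f0 x).
- by rewrite env_classC mulr_algr cofunZ.
- by rewrite env_classD mulrDr cofunD IHs IHr scalerDl.
- rewrite env_classM mulrA IHr IHs scalerA trivE [RHS]trivE !rmorphM.
  by rewrite mulrC.
Qed.

Lemma co_unitZ u (m : triv) : u *: co_unit m = (aug u)%:A *: co_unit m.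
Proof.
have H a : a *: co_unit m = co_unit (a *: m).
  by apply: coindP => v; rewrite coZE /= scalerA.
by rewrite !H -trivE.
Qed.

End Augmentation.

(** * Global dimension from the coresolution *)

Section GlobalDimension.
Variables (C : numClosedFieldType) (n D : nat).
Variables (b : 'I_D -> 'M[C]_n) (xi : 'I_D -> 'M[C]_n -> C).
Hypotheses (xi_lin : forall j c x y, xi j (c *: x + y) = c * xi j x + xi j y)
  (coordE : forall x, x = \sum_j xi j x *: b j)
  (xi_b : forall j l, xi j (b l) = (j == l)%:R).
Local Notation U := (Ugl C n).
Local Notation gen := (env_gen (@mx_bracket C n)).
Local Notation "''J' N" := (ML 'M[C]_n (coind N)) (at level 8, N at level 2).

Lemma ce_unit_ker (N : lmodType U) (y : 'J N 0) : ce N 0 y = 0 -> exists x, ce_unit N x = y.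
Proof. by move=> dy; apply: co_act0 => x; have := congr1 (fun f : 'J N 1 => f x) dy. Qed.

Lemma ce_ce_unit (N : lmodType U) (x : N) : ce N 0 (ce_unit N x) = 0.
Proof. by apply: funext => y; apply: co_act_unit. Qed.

Lemma ce_top (N : lmodType U) i (f : 'J N i) : (D < i)%N -> alt f -> f = 0.
Proof. exact: alt_top coordE i f. Qed.

Lemma coef0_aug i (w : 'J (triv C n) i) u : coef0 (@co_act C n _) w ->
  u *: w = (aug C n u)%:A *: w.
Proof.
elim: i w => [|i IH] w w0; last by apply: funext => x; apply: (IH (w x) (w0 x)).
by have [m <-] := co_act0 w0; apply: co_unitZ.
Qed.

Lemma coef0_invariant i (f : 'J (triv C n) i) : (forall x, gen x *: f = 0) ->
  coef0 (@co_act C n _) f.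
Proof.
elim: i f => [|i IH] f f0 x.
  by rewrite -(coind_invariant f0) co_act_unit.
by apply: (IH (f x)) => y; have := congr1 (fun g : 'J (triv C n) i.+1 => g x) (f0 y).
Qed.

(* t is either everything or the Gelfand-Zeitlin torsion. *)
Variables (P : lmodType U -> Prop) (t : forall M : lmodType U, M -> Prop)
  (small : forall X : lmodType U, (X -> Prop) -> Prop).
Arguments t {M}.
Hypotheses (t_sub : forall M, submod (@t M))
  (t_ann : forall (M M' : lmodType U) (x : M) (y : M'), (forall u : U, u *: x = 0 -> u *: y = 0) -> t x -> t y)
  (Pt : forall M, P M -> forall x : M, t x)
  (smallP : small_axioms P small)
  (P_smod : forall (X : lmodType U) (S : X -> Prop) (SP : submod S), small S -> (forall x, S x -> t x) -> P (smod SP))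
  (t_exact : forall N, P N -> forall i (f : 'J N i.+1), alt f -> t f -> ce N i.+1 f = 0 ->
    exists g, [/\ alt g, t g & ce N i g = f]).

Lemma t_lin (M M' : lmodType U) (f : {linear M -> M'}) x : t x -> t (f x).
Proof. by apply: t_ann => u ux; rewrite -linearZ ux linear0. Qed.

Definition ce_cplx (N : lmodType U) : cplx U :=
  @Cplx U (fun i => 'J N i) (fun i => ce N i) (fun i f => alt f /\ t f).

Lemma ce_good N : P N -> good P (ce_cplx N).
Proof.
move=> PN; split=> /= [i|i x [xa xt]|i x [xa _]|i x [xa xt] dx|i X Y p f PY fT pf].
- by apply: submodI => //; apply: alt_submod.
- by split; [apply: ce_alt|apply: (@t_lin _ _ (ce N i))].
- exact: ce_ce.
- by have [g [ga gt gE]] := t_exact PN xa xt dx; exists g.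
- have [x|g [gE gA]] := baer_factor (@alt_submod C 'M[C]_n U (coind N) i) (baer_alt xi_lin coordE (@baer_coind C n N)) _ pf.
    by have [] := fT x.
  by exists g; split=> // y; split=> //; apply: t_lin; apply: Pt.
Qed.

Lemma ce_small N M : P M -> small_closed P small M (ce_cplx N).
Proof.
move=> PM i S SP Ss SJ; apply: P_smod => // -[z m] /SJ[_ /= zt].
have -> : (z, m) = (z, 0) + (0, m) :> ('J N i * M)%type.
  by congr pair; rewrite ?addr0 ?add0r.
apply: submodD => //; first by apply: t_ann zt => u uz; congr pair; rewrite ?scaler0.
by apply: t_ann (Pt PM m) => u um; congr pair; rewrite ?scaler0.
Qed.

Let unitT N : P N -> forall x, @cT U (ce_cplx N) 0 (ce_unit N x).
Proof. by move=> PN x; split=> //; apply: t_lin; apply: Pt. Qed.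

Let unit_exact N y : @cT U (ce_cplx N) 0 y -> cd (ce_cplx N) 0 y = 0 -> exists x, ce_unit N x = y.
Proof. by move=> _; apply: ce_unit_ker. Qed.

Lemma Ext_above d M N : P M -> P N -> (D < d)%N -> ~ Ext_neq0 P d M N.
Proof.
case: d => // d PM PN lt_Dd.
apply: (Ext_vanish (ce_good PN) PM (unitT PN) (@co_unit_inj C n N) (@ce_ce_unit N)
  (@unit_exact N) smallP (ce_small PM) PN) => x [xa _].
exact: ce_top xa.
Qed.

(** The class is that of [m -> m w]. Were it a coboundary, given by [psi], then [psi 1] would be a
    U-invariant form of degree [D - 1], closed by unimodularity, and [w] would vanish. *)
Let Ext_top_form i (w : 'J (triv C n) i.+1) : D = i.+1 -> P (triv C n) ->
  alt w -> coef0 (@co_act C n _) w -> w <> 0 -> Ext_neq0 P i.+1 (triv C n) (triv C n).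
Proof.
set T := triv C n => Di PT wa w0 nzw.
have phi_lin : linear (fun m : T => (m : C)%:A *: w).
  move=> u m m'; change ((aug C n u * m + m')%:A *: w = u *: (m%:A *: w) + m'%:A *: w).
  rewrite !scalerDl; congr (_ + _).
  transitivity ((m : C)%:A *: (u *: w)); last by rewrite !scalerA mulr_algr mulr_algl.
  by rewrite (coef0_aug u w0) scalerA mulr_algl scalerA mulrC.
pose phi : {linear T -> cJ (ce_cplx T) i.+1} := mk_linear phi_lin.
(* Whatever kills the trivial module kills [w], since U acts on [w] through the augmentation. *)
have wt : t w.
  apply: (t_ann (x := (1 : C) : T)) (Pt PT _) => u /eqP.
  rewrite coef0_aug //; change (aug C n u * 1 == 0 -> (aug C n u)%:A *: w = 0).
  by rewrite mulr1 => /eqP ->; rewrite scale0r scale0r.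
have phiT m : @cT U (ce_cplx T) i.+1 (phi m).
  by split; [apply: submodZ => //; apply: alt_submod|apply: submodZ].
have phid m : cd (ce_cplx T) i.+1 (phi m) = 0.
  by apply: (@ce_top T i.+2); [rewrite Di|apply: ce_alt; have [] := phiT m].
have [E [E0 [Ephi E00]]] := Ext_nonzero (ce_good PT) PT (unitT PT) (@co_unit_inj C n T)
  (@ce_ce_unit T) (@unit_exact T) smallP (ce_small PT) PT phiT phid.
exists E, E0 => EE0.
have [psi psiT psiE] := ylift_equiv (ce_good PT) PT (unitT PT) (@ce_ce_unit T) EE0 Ephi E00.
have : phi (1 : C) - 0 = 0.
  rewrite psiE; apply: (@top_closed C _ _ (@mx_bracket_linl C n) (@mx_bracket_linr C n) (@mx_bracketxx C n)
    U _ _ (@co_act_linear C n T) (@co_act_linl C n T) D b xi xi_lin coordE xi_b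
    (mx_bracket_unimod xi_lin coordE xi_b) i) => //; first by have [] := psiT (1 : C).
  apply: coef0_invariant => x; rewrite -linearZ.
  have -> : gen x *: ((1 : C) : T) = 0 by rewrite trivE aug_gen !scale0r.
  exact: linear0.
by rewrite subr0 /= scale1r scale1r.
Qed.

Lemma Ext_top : (0 < D)%N -> P (triv C n) -> Ext_neq0 P D (triv C n) (triv C n).
Proof.
set T := triv C n => D_gt0 PT.
have nz1 : co_unit ((1 : C) : T) != 0.
  by apply/eqP => /co_unit_inj /eqP; rewrite oner_eq0.
have [w [wa w0 nzw]] := top_form (@mx_bracket C n) (@co_act_linear C n T) xi_lin xi_b
  (fun x => co_act_unit x _) nz1.
have [i Di] : exists i, D = i.+1 by case: (D) D_gt0 => // i _; exists i.
move: w wa w0 nzw; rewrite Di => w wa w0 nzw; exact: Ext_top_form nzw.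
Qed.

Theorem gl_dimE (R : realType) : (0 < D)%N -> P (triv C n) -> gl_dim R P = (D%:R)%:E.
Proof.
move=> D_gt0 PT; apply: Order.POrderTheory.le_anti; apply/andP; split.
  apply: ge_ereal_sup => _ [M [PM ->]]; apply: ge_ereal_sup => _ [d [N [PN ext ->]]].
  rewrite lee_fin Num.Theory.ler_nat leqNgt; apply/negP => lt_Dd.
  exact: Ext_above lt_Dd ext.
apply: (@Order.POrderTheory.le_trans _ _ (proj_dim R P (triv C n))); last first.
  by apply: ereal_sup_ubound; exists (triv C n).
by apply: ereal_sup_ubound; exists D, (triv C n); split=> //; apply: Ext_top.
Qed.

End GlobalDimension.

Section SmallSubmodules.
Variable A : pzRingType.

Lemma small_fg (P : lmodType A -> Prop) : noeth_ring A ->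
  (forall X, P X -> fin_gen X) -> small_axioms P (@fg A).
Proof.
move=> An Pfg; split.
- exact: fg0.
- exact: fg_add.
- by move=> X /Pfg/fin_genP.
- by move=> X Y f S; apply: fg_im.
- by move=> X S T SP Tfg; apply: (noeth_fg An Tfg SP).
move=> X Y f S E SP [e eP] ES.
have [s [sS fs]] : exists s : seq X, (forall x, x \in s -> S x) /\ map f s = e.
  have : forall y, y \in e -> E y by move=> y ye; apply/eP/spn_mem.
  elim: e {eP} => [|y e IH] eE; first by exists [::].
  have [|s [sS <-]] := IH; first by move=> z ze; apply: eE; rewrite inE ze orbT.
  have [x Sx <-] := ES y (eE y (mem_head _ _)).
  by exists (x :: s); split=> // z; rewrite inE => /predU1P[->|/sS].
exists (spn s); split.
- exact: spnP.
- by exists s.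
- exact: spn_min SP sS.
- by move=> x /(spn_im f); rewrite fs => /eP.
- move=> y /eP; rewrite -fs => /spn_map[a ->].
  exists (\sum_i a i *: tnth (in_tuple s) i); last first.
    by rewrite linear_sum; apply: eq_bigr => i _; rewrite linearZ.
  by apply: submod_sum (spnP s) _ => i _; apply: submodZ (spnP s) _; apply/spn_mem/mem_tnth.
Qed.

Lemma small_submod (P : lmodType A -> Prop) : small_axioms P (@submod A).
Proof.
split=> //; [exact: submod0|exact: submod_add|by move=> X Y f S; apply: submod_im|].
move=> X Y f S E SP EP ES; exists (fun x => S x /\ E (f x)); split=> //.
- by apply: submodI => //; apply: submod_preim.
- by apply: submodI => //; apply: submod_preim.
- by move=> x [].
- by move=> x [].
- by move=> y Ey; have [x Sx fx] := ES y Ey; exists x; rewrite ?fx.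
Qed.

End SmallSubmodules.

Section BothCategories.
Variables (C : numClosedFieldType) (n D : nat).
Variables (b : 'I_D -> 'M[C]_n) (xi : 'I_D -> 'M[C]_n -> C).
Hypotheses (xi_lin : forall j c x y, xi j (c *: x + y) = c * xi j x + xi j y)
  (coordE : forall x, x = \sum_j xi j x *: b j)
  (xi_b : forall j l, xi j (b l) = (j == l)%:R).
Local Notation U := (Ugl C n).

Lemma all_tors_ann k (M M' : lmodType U) (x : M) (y : M') :
  (forall u : U, u *: x = 0 -> u *: y = 0) -> all_tors k x -> all_tors k y.
Proof. by move=> xy tx j le_jn kj; apply: tors_ann xy (tx j le_jn kj). Qed.

Lemma triv_GZ : GZ_module (triv C n).
Proof.
split; first by exists 1%N, (fun=> 1 : C) => v; exists (fun=> (v : C)%:A); rewrite big_ord1; symmetry;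
  change (aug C n v%:A * 1 = v); rewrite mulr1 aug_alg.
apply/GZ_torsP => x j le_jn _.
(* The centers act on the trivial module by scalars, so 1 alone suffices. *)
exists [:: 1]; split=> [z|z _]; first by rewrite inE => /eqP -> u; rewrite mulr1 mul1r.
exists ((aug C n (corner C le_jn z))%:A).
  by exists (aug C n (corner C le_jn z)), 0; rewrite addr0.
change (corner C le_jn z *: x = corner C le_jn (aug C n (corner C le_jn z))%:A *: x).
by rewrite corner_alg trivE.
Qed.

Lemma gl_dim_all (R : realType) : (0 < D)%N -> gl_dim R (@all_modules U) = (D%:R)%:E.
Proof.
move=> D_gt0.
apply: (@gl_dimE C n D b xi xi_lin coordE xi_b _ (fun _ _ => True) (@submod U)) => //.
  exact: small_submod.
move=> N _ i f fa _ df.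
by have [g ga gE] := ce_exact xi_lin coordE xi_b fa df; exists g.
Qed.

Lemma gl_dim_GZ (R : realType) : (0 < D)%N -> gl_dim R (@GZ_module C n) = (D%:R)%:E.
Proof.
move=> D_gt0.
have GZt (M : lmodType U) : GZ_module M -> forall x : M, all_tors 1 x by move=> [_ /GZ_torsP].
apply: (@gl_dimE C n D b xi xi_lin coordE xi_b _ (fun M => @all_tors C n 1 M) (@fg U)) => //.
- exact: all_tors_submod.
- exact: all_tors_ann.
- by apply: small_fg => [|M []]; [exact: Ugl_noeth|].
- move=> X S SP Sfg St; split; first exact: sm_fg.
  apply/GZ_torsP => x; apply: all_tors_ann (St _ (sm_prop x)) => u ux.
  by apply: sm_inj.
- move=> N NGZ i f fa ft df.
  apply: (@all_tors_exact C n (fun i => ML 'M[C]_n (coind N) i) (ce N) (fun i => @alt _ _ _ _ i)) => //.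
  + by move=> j; apply: alt_submod.
  + by move=> j x; apply: ce_alt.
  + by move=> j x; apply: ce_ce.
  + by move=> j x xa dx; apply: (ce_exact xi_lin coordE xi_b xa dx).
  + by move=> j; apply: (baer_alt xi_lin coordE (@baer_coind C n N)).
  (* Cocycles of degree 0 form the copy of [N], and [N] is torsion by assumption. *)
  + move=> x k le_kn _ dx k_gt0; have [y <-] := ce_unit_ker dx.
    by apply: tors_ann (GZt N NGZ y k le_kn k_gt0) => u uy; rewrite -linearZ uy linear0.
- exact: triv_GZ.
Qed.

End BothCategories.

Theorem corollary2 (R : realType) (n : nat) (n_gt0 : (0 < n)%N) :
  gl_dim R (@GZ_module R[i] n) = gl_dim R (@all_modules (Ugl R[i] n)) /\
  gl_dim R (@all_modules (Ugl R[i] n)) = ((\dim {: 'M[R[i]]_n})%:R)%:E.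
Proof.
have [D [b [xi [Dn xi_lin coordE xi_b]]]] := @Ugl_basis R[i] n.
have D_gt0 : (0 < D)%N by rewrite Dn dimvf /dim /= muln_gt0 n_gt0.
by rewrite (gl_dim_GZ xi_lin coordE xi_b) // (gl_dim_all xi_lin coordE xi_b) // Dn.
Qed.
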